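(* In $\mathbf{ZF}$, each of the following statements implies the one beneath it (where (ii) may be read in any one of its three versions): (i) $\mathbf{CMC}$: every denumerable family of non-empty sets has a multiple choice function. (ii) For every family $\{\mathbf{X}_n: n\in\omega\}$ of topological spaces, if there exists a family $\{\mathcal{B}_n: n\in\omega\}$ such that, for every $n\in\omega$, $\mathcal{B}_n$ is a $\sigma$-locally finite (resp., $\sigma$-point-finite, $\sigma$-interior-preserving) base of $\mathbf{X}_n$, then the product $\mathbf{X}=\prod_{n\in\omega}\mathbf{X}_n$ has a $\sigma$-locally finite (resp., $\sigma$-point-finite, $\sigma$-interior-preserving) base. (iii) For every family $\{\mathbf{X}_n: n\in\omega\}$ of countable, compact metrizable spaces, if there exists a family $\{\mathcal{B}_n: n\in\omega\}$ such that, for every $n\in\omega$, $\mathcal{B}_n$ is a $\sigma$-locally finite base of $\mathbf{X}_n$, then the product $\mathbf{X}=\prod_{n\in\omega}\mathbf{X}_n$ has a $\sigma$-interior-preserving base. (iv) $\mathbf{CPcofin(\omega)QM}$: every countable product of quasi-metrizable countable cofinite spaces is quasi-metrizable. (v) $\mathbf{CMC}_\omega$: every denumerable family of denumerable sets has a multiple choice function.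
   Context: The theory is $\mathbf{ZF}$ (no choice). A set is countable if it is equipotent with a subset of $\omega$, denumerable if infinite and countable. A multiple choice function of a family $\{X_j: j\in J\}$ is a function $f$ on $J$ such that each $f(j)$ is a non-empty finite subset of $X_j$. A family $\mathcal{U}$ of subsets of a space $\mathbf{X}$ is locally finite if every point has a neighborhood meeting only finitely many members of $\mathcal{U}$; point-finite if every point belongs to at most finitely many members of $\mathcal{U}$; interior-preserving if for every $x\in X$ the set $\bigcap\{U\in\mathcal{U}: x\in U\}$ is open in $\mathbf{X}$ (an empty intersection being $X$). $\mathcal{U}$ is $\sigma$-locally finite (resp. $\sigma$-point-finite, $\sigma$-interior-preserving) if it is a countable union of locally finite (resp. point-finite, interior-preserving) subfamilies. A cofinite space is a set $X$ with topology $\{\emptyset\}\cup\{U\subseteq X: X\setminus U\text{ is finite}\}$. A quasi-metric on $X$ is $d:X\times X\to[0,+\infty)$ with $d(x,x)=0$, $d(x,y)\le d(x,z)+d(z,y)$, and $d(x,y)=0\Rightarrow x=y$; its topology $\tau(d)$ consists of all $V\subseteq X$ such that for every $x\in V$ there is $n\in\omega$ with $\{y: d(x,y)<2^{-n}\}\subseteq V$. A space is quasi-metrizable if its topology equals $\tau(d)$ for some quasi-metric $d$. Products carry the Tychonoff topology. *)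

(* Defs.v *)
(** A theorem of ZF is read, through Gödel's completeness theorem, as a statement
    true in every model of ZF.  The sets of the theory are the elements of a
    model [M]; every notion below (omega, finiteness, functions, the reals,
    topologies) is internal to [M] and quantifies over elements of [M] only, so
    that no choice principle of the metatheory is available inside [M]. *)

Set Implicit Arguments.
Unset Strict Implicit.

Record set_structure := SetStructure {
  carrier :> Type;
  mem : carrier -> carrier -> Prop
}.
Arguments mem {s} _ _.

Notation "x ∈ y" := (mem x y) (at level 70, no associativity).

(** First-order formulas of set theory with de Bruijn indices.  The two schemas
    of ZF range over these formulas only; with arbitrary predicates on [M] they
    would let choice functions of the metatheory into [M]. *)

Inductive formula : Type :=
| Fmem (i j : nat)
| Feq (i j : nat)
| Fbot
| Fimp (p q : formula)
| Fand (p q : formula)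
| For (p q : formula)
| Fall (p : formula)
| Fex (p : formula).

Definition scons {A : Type} (x : A) (e : nat -> A) (n : nat) : A :=
  match n with
  | O => x
  | S k => e k
  end.

Fixpoint sat (M : set_structure) (e : nat -> M) (p : formula) : Prop :=
  match p with
  | Fmem i j => e i ∈ e j
  | Feq i j => e i = e j
  | Fbot => False
  | Fimp p q => sat e p -> sat e q
  | Fand p q => sat e p /\ sat e q
  | For p q => sat e p \/ sat e q
  | Fall p => forall x : M, sat (scons x e) p
  | Fex p => exists x : M, sat (scons x e) p
  end.

Section SetTheory.

Context {M : set_structure}.
Implicit Types (x y z : M).

Definition is_empty x := forall z, ~ z ∈ x.
Definition nonempty x := exists z, z ∈ x.
Definition subset x y := forall z, z ∈ x -> z ∈ y.
Definition is_upair (p a b : M) := forall z, z ∈ p <-> z = a \/ z = b.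
Definition is_union (u x : M) := forall z, z ∈ u <-> exists y, y ∈ x /\ z ∈ y.
Definition is_inter (w u v : M) := forall z, z ∈ w <-> z ∈ u /\ z ∈ v.
Definition is_diff (w u v : M) := forall z, z ∈ w <-> z ∈ u /\ ~ z ∈ v.
Definition is_powerset (p x : M) := forall z, z ∈ p <-> subset z x.
Definition is_succ (y x : M) := forall z, z ∈ y <-> z ∈ x \/ z = x.
Definition is_one (o : M) := exists z, is_empty z /\ is_succ o z.

Definition is_inductive (w : M) :=
  (exists e, is_empty e /\ e ∈ w) /\
  (forall x, x ∈ w -> exists y, is_succ y x /\ y ∈ w).
Definition is_omega (w : M) :=
  is_inductive w /\ forall i, is_inductive i -> subset w i.
Definition is_nat (n : M) := exists w, is_omega w /\ n ∈ w.

Definition is_pair (p a b : M) :=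
  exists u v, is_upair u a a /\ is_upair v a b /\ is_upair p u v.

Definition is_cartesian (P A B : M) :=
  forall p, p ∈ P <-> exists a b, a ∈ A /\ b ∈ B /\ is_pair p a b.

Definition maps (f x y : M) := exists p, is_pair p x y /\ p ∈ f.

(** [f] is a function with domain [A]; a family indexed by [A] is such an [f]. *)
Definition is_function (f A : M) :=
  (forall p, p ∈ f -> exists x y, x ∈ A /\ is_pair p x y) /\
  (forall x, x ∈ A -> exists! y, maps f x y).

Definition is_bijection (f A B : M) :=
  is_function f A /\
  (forall x y, maps f x y -> y ∈ B) /\
  (forall y, y ∈ B -> exists! x, maps f x y).

Definition equipotent (A B : M) := exists f, is_bijection f A B.
Definition finite (A : M) := exists n, is_nat n /\ equipotent A n.
Definition infinite (A : M) := ~ finite A.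
Definition countable (A : M) :=
  exists w S, is_omega w /\ subset S w /\ equipotent A S.
Definition denumerable (A : M) := infinite A /\ countable A.

Definition has_multiple_choice (J X : M) :=
  exists f, is_function f J /\
    forall j A F, maps X j A -> maps f j F ->
      nonempty F /\ finite F /\ subset F A.

Definition is_topology (X T : M) :=
  (forall U, U ∈ T -> subset U X) /\
  (forall U, is_empty U -> U ∈ T) /\
  X ∈ T /\
  (forall C U, subset C T -> is_union U C -> U ∈ T) /\
  (forall U V W, U ∈ T -> V ∈ T -> is_inter W U V -> W ∈ T).

Definition is_nbhd (T N X x : M) :=
  subset N X /\ exists O, O ∈ T /\ x ∈ O /\ subset O N.

Definition is_base (X T B : M) :=
  subset B T /\
  forall U x, U ∈ T -> x ∈ U -> exists V, V ∈ B /\ x ∈ V /\ subset V U.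

Definition family_of_subsets (X C : M) := forall U, U ∈ C -> subset U X.

Definition locally_finite (X T C : M) :=
  family_of_subsets X C /\
  forall x, x ∈ X -> exists N, is_nbhd T N X x /\
    exists S, finite S /\
      forall V, V ∈ S <-> V ∈ C /\ exists y, y ∈ V /\ y ∈ N.

Definition point_finite (X T C : M) :=
  family_of_subsets X C /\
  forall x, x ∈ X -> exists S, finite S /\ forall V, V ∈ S <-> V ∈ C /\ x ∈ V.

Definition interior_preserving (X T C : M) :=
  family_of_subsets X C /\
  forall x, x ∈ X -> exists I, I ∈ T /\
    forall y, y ∈ I <-> y ∈ X /\ forall U, U ∈ C -> x ∈ U -> y ∈ U.

Definition sigma (P : M -> M -> M -> Prop) (X T B : M) :=
  exists K D, countable K /\ is_function D K /\
    (forall k C, maps D k C -> P X T C) /\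
    (forall V, V ∈ B <-> exists k C, maps D k C /\ V ∈ C).

Definition sigma_base (P : M -> M -> M -> Prop) (X T B : M) :=
  is_base X T B /\ sigma P X T B.

Definition compact (X T : M) :=
  forall C, subset C T -> (forall x, x ∈ X -> exists U, U ∈ C /\ x ∈ U) ->
    exists D, subset D C /\ finite D /\
      forall x, x ∈ X -> exists U, U ∈ D /\ x ∈ U.

Definition is_cofinite_topology (X T : M) :=
  forall U, U ∈ T <->
    is_empty U \/
    (subset U X /\ exists C, is_diff C X U /\ finite C).

(** A family of spaces over [J] is given by the family [X] of underlying sets
    and the family [T] of topologies. *)
Definition space_family (J X T : M) :=
  is_function X J /\ is_function T J /\
  forall j A tau, maps X j A -> maps T j tau -> is_topology A tau.

Definition is_product (J X P : M) :=
  forall x, x ∈ P <->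
    is_function x J /\ forall j A a, maps X j A -> maps x j a -> a ∈ A.

(** [x] lies in the box given by the family [O], whose domain is a set of
    coordinates of [x]. *)
Definition in_box (O x : M) :=
  forall j V a, maps O j V -> maps x j a -> a ∈ V.

Definition is_product_topology (J T P S : M) :=
  forall U, U ∈ S <->
    subset U P /\
    forall x, x ∈ U -> exists F O,
      subset F J /\ finite F /\ is_function O F /\
      (forall j V tau, maps O j V -> maps T j tau -> V ∈ tau) /\
      in_box O x /\
      (forall y, y ∈ P -> in_box O y -> y ∈ U).

Definition is_product_space (J X T P S : M) :=
  is_product J X P /\ is_product_topology J T P S.

(** [f n] equals [k] for the function [f] on omega with [f 0 = z] and with
    [step (f i) (f (i + 1))] for all [i]. *)
Definition iterates (step : M -> M -> Prop) (z n k : M) :=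
  exists w f e, is_omega w /\ is_function f w /\ is_empty e /\ maps f e z /\
    (forall i j a b, is_succ j i -> maps f i a -> maps f j b -> step a b) /\
    maps f n k.

Definition nat_add (m n k : M) := iterates (fun a b => is_succ b a) m n k.
Definition nat_mul (m n k : M) :=
  exists z, is_empty z /\ iterates (fun a b => nat_add a m b) z n k.
Definition nat_exp2 (n k : M) :=
  exists o, is_one o /\ iterates (fun a b => nat_add a a b) o n k.

(** The fraction [a / b] with positive numerator and denominator.  Distinct
    pairs may denote the same rational: [frac_le] is only a preorder. *)
Definition is_fraction (q a b : M) :=
  is_nat a /\ nonempty a /\ is_nat b /\ nonempty b /\ is_pair q a b.
Definition fraction (q : M) := exists a b, is_fraction q a b.

Definition frac_lt (p q : M) :=
  exists a b c d ad cb, is_fraction p a b /\ is_fraction q c d /\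
    nat_mul a d ad /\ nat_mul c b cb /\ ad ∈ cb.
Definition frac_le (p q : M) :=
  exists a b c d ad cb, is_fraction p a b /\ is_fraction q c d /\
    nat_mul a d ad /\ nat_mul c b cb /\ (ad ∈ cb \/ ad = cb).
Definition frac_add (p q r : M) :=
  exists a b c d ad cb s bd, is_fraction p a b /\ is_fraction q c d /\
    nat_mul a d ad /\ nat_mul c b cb /\ nat_add ad cb s /\ nat_mul b d bd /\
    is_fraction r s bd.

(** Dedekind construction: the real [t >= 0] is its open upper cut, the set of
    all fractions [q] with [t < q].  Thus [0] is the set of all fractions and
    the order of reals is reverse inclusion of cuts. *)
Definition nnreal (u : M) :=
  (forall q, q ∈ u -> fraction q) /\
  nonempty u /\
  (forall p q, p ∈ u -> frac_le p q -> q ∈ u) /\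
  (forall q, q ∈ u -> exists p, p ∈ u /\ frac_lt p q).

Definition real_zero (u : M) := forall q, q ∈ u <-> fraction q.
Definition real_le (u v : M) := subset v u.
Definition real_lt (u v : M) := real_le u v /\ u <> v.
Definition real_add (u v w : M) :=
  forall r, r ∈ w <->
    exists p q s, p ∈ u /\ q ∈ v /\ frac_add p q s /\ frac_le s r.

(** [r] is the real number [2 ^ (- n)]. *)
Definition half_pow (n r : M) :=
  exists o k h, is_one o /\ nat_exp2 n k /\ is_fraction h o k /\
    forall q, q ∈ r <-> frac_lt h q.

Definition dist (d x y u : M) := exists p, is_pair p x y /\ maps d p u.

Definition is_quasi_metric (X d : M) :=
  (exists P, is_cartesian P X X /\ is_function d P) /\
  (forall x y u, dist d x y u -> nnreal u) /\
  (forall x u, dist d x x u -> real_zero u) /\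
  (forall x y z u v w s,
     dist d x y u -> dist d x z v -> dist d z y w ->
     real_add v w s -> real_le u s) /\
  (forall x y u, dist d x y u -> real_zero u -> x = y).

Definition is_metric (X d : M) :=
  is_quasi_metric X d /\
  forall x y u, dist d x y u -> dist d y x u.

Definition induced_topology (X d T : M) :=
  forall V, V ∈ T <->
    subset V X /\
    forall x, x ∈ V -> exists n r, is_nat n /\ half_pow n r /\
      forall y u, dist d x y u -> real_lt u r -> y ∈ V.

Definition quasi_metrizable (X T : M) :=
  exists d, is_quasi_metric X d /\ induced_topology X d T.
Definition metrizable (X T : M) :=
  exists d, is_metric X d /\ induced_topology X d T.

End SetTheory.

Record ZF (M : set_structure) : Prop := {
  zf_extensionality : forall x y : M, (forall z, z ∈ x <-> z ∈ y) -> x = y;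
  zf_foundation : forall x : M,
    nonempty x -> exists y, y ∈ x /\ forall z, z ∈ y -> ~ z ∈ x;
  zf_pairing : forall a b : M, exists p, is_upair p a b;
  zf_union : forall x : M, exists u, is_union u x;
  zf_powerset : forall x : M, exists p, is_powerset p x;
  zf_infinity : exists w : M, is_inductive w;
  zf_separation : forall (p : formula) (e : nat -> M) (a : M),
    exists b, forall z, z ∈ b <-> z ∈ a /\ sat (scons z e) p;
  zf_replacement : forall (p : formula) (e : nat -> M) (a : M),
    (forall x y y', x ∈ a -> sat (scons x (scons y e)) p ->
       sat (scons x (scons y' e)) p -> y = y') ->
    exists b, forall y, y ∈ b <-> exists x, x ∈ a /\ sat (scons x (scons y e)) p
}.

Definition CMC (M : set_structure) : Prop :=
  forall J X : M, denumerable J -> is_function X J ->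
    (forall j A, maps X j A -> nonempty A) ->
    has_multiple_choice J X.

Definition CMC_omega (M : set_structure) : Prop :=
  forall J X : M, denumerable J -> is_function X J ->
    (forall j A, maps X j A -> denumerable A) ->
    has_multiple_choice J X.

Definition sigma_base_family {M : set_structure} (P : M -> M -> M -> Prop)
    (J X T Bs : M) : Prop :=
  is_function Bs J /\
  forall j A tau B, maps X j A -> maps T j tau -> maps Bs j B ->
    sigma_base P A tau B.

Definition countable_products_have_sigma_base (M : set_structure)
    (P : M -> M -> M -> Prop) : Prop :=
  forall w X T : M, is_omega w -> space_family w X T ->
    (exists Bs, sigma_base_family P w X T Bs) ->
    forall Y S, is_product_space w X T Y S ->
      exists B, sigma_base P Y S B.

Definition compact_metrizable_products_have_sigma_ip_base
    (M : set_structure) : Prop :=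
  forall w X T : M, is_omega w -> space_family w X T ->
    (forall n A tau, maps X n A -> maps T n tau ->
       countable A /\ compact A tau /\ metrizable A tau) ->
    (exists Bs, sigma_base_family locally_finite w X T Bs) ->
    forall Y S, is_product_space w X T Y S ->
      exists B, sigma_base interior_preserving Y S B.

Definition CPcofin_omega_QM (M : set_structure) : Prop :=
  forall J X T : M, countable J -> space_family J X T ->
    (forall j A tau, maps X j A -> maps T j tau ->
       quasi_metrizable A tau /\ countable A /\ is_cofinite_topology A tau) ->
    forall Y S, is_product_space J X T Y S -> quasi_metrizable Y S.

(* Main.v *)
(** CMC selects, for each [n], finitely many sigma-decompositions of the base of
    [X_n]; their union is again one, because local finiteness, point-finiteness
    and interior preservation survive finite unions.  These properties also pass
    to preimages and to pairwise intersections, so with the decompositions chosen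
    uniformly the boxes restricting the first [k] coordinates at level [k] form
    one family each, and together they are a base of the product.

    A locally finite family is point-finite, and a point-finite family of open
    sets is interior-preserving; this gives the second implication.

    For countable sets [A_n], a sigma-interior-preserving base of the product of
    the one-point compactifications of the discrete [A_n] yields at the point
    (infinity, infinity, ...) countably many minimal open neighbourhoods [O_m].
    The set [F_{n,m}] of all [x] in [A_n] that leave [O_m] when put at coordinate
    [n] is finite, and the union of the [F_{n,m}] over [m] is [A_n].  Uniform
    exhaustions by finite sets define a quasi-metric on the product of the
    cofinite spaces [A_n].  Conversely a quasi-metric on the product of the
    cofinite spaces [A_n + {infinity}] gives such exhaustions, by the balls about
    (infinity, infinity, ...), and the first non-empty set of each exhaustion is
    a multiple choice.

    All of this takes place inside the model: the schemas apply to first-order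
    formulas only, so every predicate or function used in a separation,
    replacement, induction or recursion comes with a proof of definability. *)

From Stdlib Require Import Arith Classical ClassicalEpsilon FunctionalExtensionality Ring.
Require Import Defs.

Set Implicit Arguments.
Unset Strict Implicit.

(** * Definable predicates and terms *)

(** Without choice the product of the sets A_n may be empty. Adjoining A_n itself to each factor as
    an extra point gives the product a definable point, n ↦ A_n, at which every later construction
    is anchored; moving one coordinate of this point turns a neighbourhood in the product into a
    neighbourhood in a factor. One object, such as a base of one product or one quasi-metric on it,
    is obtained by a single instantiation, whereas one object for each n would be a choice.
    Therefore data for all n are read off one object on one product.

    Multiple choice returns finite sets of candidates, so the candidates must be of a kind that can
    be merged; decompositions indexed by [omega] merge index by index.

    The quasi-metrics come from decreasing sequences of preorders. They take only the values 0 and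
    2^-n and satisfy the triangle inequality with a maximum in place of the sum, which keeps the
    arithmetic of cuts small.

    The operator [epsilon] of the metatheory enters only through definite descriptions, whose graphs
    are first-order, so it selects nothing inside the model. *)

Section Definability.
Context {M : set_structure}.

Definition lift (s : nat -> nat) (n : nat) : nat :=
  match n with O => O | S k => S (s k) end.

Fixpoint rename (s : nat -> nat) (p : formula) : formula :=
  match p with
  | Fmem i j => Fmem (s i) (s j)
  | Feq i j => Feq (s i) (s j)
  | Fbot => Fbot
  | Fimp p q => Fimp (rename s p) (rename s q)
  | Fand p q => Fand (rename s p) (rename s q)
  | For p q => For (rename s p) (rename s q)
  | Fall p => Fall (rename (lift s) p)
  | Fex p => Fex (rename (lift s) p)
  end.

Lemma scons_lift (s : nat -> nat) (e : nat -> M) x :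
  (fun n => scons x e (lift s n)) = scons x (fun n => e (s n)).
Proof. apply functional_extensionality; intros [|n]; reflexivity. Qed.

Lemma sat_rename p : forall s (e : nat -> M),
  sat e (rename s p) <-> sat (fun n => e (s n)) p.
Proof.
  induction p; intros s e; simpl; try tauto;
    try (rewrite IHp1, IHp2; tauto).
  - split; intros H x; specialize (H x); rewrite IHp, scons_lift in *; exact H.
  - split; intros [x H]; exists x; rewrite IHp, scons_lift in *; exact H.
Qed.

Definition valuation (r : nat -> nat + M) (e : nat -> M) (n : nat) : M :=
  match r n with inl i => e i | inr c => c end.

(** Each variable of the formula stands for an entry of the environment or for
    a parameter from [M]. *)
Definition Def (P : (nat -> M) -> Prop) : Prop :=
  exists p r, forall e, sat (valuation r e) p <-> P e.

(** The language has no function symbols, so a term is definable when its graph is: slot 0 receives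
    the value, and the arguments move up by one slot. *)
Definition Term (t : (nat -> M) -> M) : Prop :=
  Def (fun e => e 0 = t (fun n => e (S n))).

Lemma Def_ext (P Q : (nat -> M) -> Prop) :
  (forall e, P e <-> Q e) -> Def P -> Def Q.
Proof.
  intros H [p [r Hp]]; exists p, r; intro e; rewrite Hp; apply H.
Qed.

Lemma Def_rename (s : nat -> nat) (P : (nat -> M) -> Prop) :
  Def P -> Def (fun e => P (fun n => e (s n))).
Proof.
  intros [p [r Hp]].
  exists p, (fun n => match r n with inl i => inl (s i) | inr c => inr c end).
  intro e; rewrite <- Hp.
  replace (valuation _ e) with (valuation r (fun n => e (s n))); [tauto|].
  apply functional_extensionality; intro n; unfold valuation.
  now destruct (r n).
Qed.

(** The two formulas come with different variable maps. Moving the variables of one to the even and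
    of the other to the odd indices lets a single interleaved map serve both. *)
Lemma Def_common (P Q : (nat -> M) -> Prop) : Def P -> Def Q ->
  exists p q r, forall e,
    (sat (valuation r e) p <-> P e) /\ (sat (valuation r e) q <-> Q e).
Proof.
  intros [p [r Hp]] [q [r' Hq]].
  exists (rename (fun n => 2 * n) p), (rename (fun n => S (2 * n)) q),
    (fun n => if Nat.even n then r (Nat.div2 n) else r' (Nat.div2 n)).
  intro e; rewrite !sat_rename, <- Hp, <- Hq; split.
  - replace (fun n => valuation _ e (2 * n)) with (valuation r e); [tauto|].
    apply functional_extensionality; intro n; unfold valuation.
    now rewrite Nat.even_even, Nat.div2_double.
  - replace (fun n => valuation _ e (S (2 * n))) with (valuation r' e); [tauto|].
    apply functional_extensionality; intro n; unfold valuation.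
    rewrite <- Nat.add_1_r, Nat.even_odd, Nat.add_1_r.
    now rewrite Nat.div2_succ_double.
Qed.

Lemma Def_imp (P Q : (nat -> M) -> Prop) :
  Def P -> Def Q -> Def (fun e => P e -> Q e).
Proof.
  intros HP HQ; destruct (Def_common HP HQ) as [p [q [r H]]].
  exists (Fimp p q), r; intro e; simpl; destruct (H e); tauto.
Qed.

Lemma Def_and (P Q : (nat -> M) -> Prop) :
  Def P -> Def Q -> Def (fun e => P e /\ Q e).
Proof.
  intros HP HQ; destruct (Def_common HP HQ) as [p [q [r H]]].
  exists (Fand p q), r; intro e; simpl; destruct (H e); tauto.
Qed.

Lemma Def_or (P Q : (nat -> M) -> Prop) :
  Def P -> Def Q -> Def (fun e => P e \/ Q e).
Proof.
  intros HP HQ; destruct (Def_common HP HQ) as [p [q [r H]]].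
  exists (For p q), r; intro e; simpl; destruct (H e); tauto.
Qed.

Lemma Def_iff (P Q : (nat -> M) -> Prop) :
  Def P -> Def Q -> Def (fun e => P e <-> Q e).
Proof. intros; apply Def_and; apply Def_imp; assumption. Qed.

Lemma Def_False : Def (fun _ => False).
Proof.
  destruct (classic (inhabited M)) as [[c]|H].
  - exists Fbot, (fun _ => inr c); simpl; tauto.
  - exists Fbot, (fun _ => inl 0); simpl; tauto.
Qed.

Lemma Def_not (P : (nat -> M) -> Prop) : Def P -> Def (fun e => ~ P e).
Proof. intro H; exact (Def_imp H Def_False). Qed.

(** Passing under a quantifier: variables that [r] sends to slot 0 become the bound variable, every
    other variable is shifted past the binder, and references to later slots go down by one. *)
Lemma bind_valuation (r : nat -> nat + M) : exists s r', forall x e,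
  (fun n => scons x (valuation r' e) (s n)) = valuation r (scons x e).
Proof.
  exists (fun n => match r n with inl O => O | _ => S n end),
    (fun n => match r n with inl (S i) => inl i | a => a end).
  intros x e; apply functional_extensionality; intro n; unfold valuation.
  destruct (r n) as [[|i]|c] eqn:E; simpl; try rewrite E; reflexivity.
Qed.

Lemma Def_all (Q : (nat -> M) -> M -> Prop) :
  Def (fun e => Q (fun n => e (S n)) (e 0)) -> Def (fun e => forall x, Q e x).
Proof.
  intros [p [r Hp]]; destruct (bind_valuation r) as [s [r' Hr]].
  exists (Fall (rename s p)), r'; intro e; simpl.
  split; intros H x; specialize (H x).
  - rewrite sat_rename, Hr, Hp in H; exact H.
  - rewrite sat_rename, Hr, Hp; exact H.
Qed.

Lemma Def_ex (Q : (nat -> M) -> M -> Prop) :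
  Def (fun e => Q (fun n => e (S n)) (e 0)) -> Def (fun e => exists x, Q e x).
Proof.
  intros [p [r Hp]]; destruct (bind_valuation r) as [s [r' Hr]].
  exists (Fex (rename s p)), r'; intro e; simpl.
  split; intros [x H]; exists x.
  - rewrite sat_rename, Hr, Hp in H; exact H.
  - rewrite sat_rename, Hr, Hp; exact H.
Qed.

Lemma Term_var i : Term (fun e => e i).
Proof.
  exists (Feq 0 (S i)), (fun n => inl n); intro e; simpl; unfold valuation; tauto.
Qed.

Lemma Term_const c : Term (fun _ => c).
Proof.
  exists (Feq 0 1), (fun n => match n with O => inl O | _ => inr c end).
  intro e; simpl; unfold valuation; tauto.
Qed.

Lemma Term_shift t : Term t -> Term (fun e => t (fun n => e (S n))).
Proof.
  intro H; apply (Def_rename (fun n => match n with O => O | S k => S (S k) end)) in H.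
  exact H.
Qed.

(** Instances of these classes are what [definable] looks up for the head symbol of an atomic
    predicate or of a term. *)
Class DefP1 (P : M -> Prop) : Prop := defP1 : Def (fun e => P (e 0)).
Class DefP2 (P : M -> M -> Prop) : Prop := defP2 : Def (fun e => P (e 0) (e 1)).
Class DefP3 (P : M -> M -> M -> Prop) : Prop :=
  defP3 : Def (fun e => P (e 0) (e 1) (e 2)).
Class DefF1 (f : M -> M) : Prop := defF1 : Term (fun e => f (e 0)).
Class DefF2 (f : M -> M -> M) : Prop := defF2 : Term (fun e => f (e 0) (e 1)).
Class DefF3 (f : M -> M -> M -> M) : Prop :=
  defF3 : Term (fun e => f (e 0) (e 1) (e 2)).

(** A term is eliminated by naming its value: [P e (t e)] says that some [x] equals [t e] and
    satisfies [P e]. *)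
Lemma Def_subst (P : (nat -> M) -> M -> Prop) t :
  Term t -> Def (fun e => P (fun n => e (S n)) (e 0)) -> Def (fun e => P e (t e)).
Proof.
  intros Ht HP.
  apply Def_ext with (P := fun e => exists x, x = t e /\ P e x).
  - intro e; split; [intros [x [-> H]]; exact H | eauto].
  - apply (Def_ex (Q := fun e x => x = t e /\ P e x)).
    apply Def_and; [exact Ht | exact HP].
Qed.

Lemma Def_P1 P {H : DefP1 P} t : Term t -> Def (fun e => P (t e)).
Proof.
  intro Ht; apply (Def_subst (P := fun _ x => P x)); assumption.
Qed.

(** Substituting the arguments one at a time stacks them in reverse order in the environment; the
    final renaming restores the order. *)
Lemma Def_P2 P {H : DefP2 P} t u : Term t -> Term u -> Def (fun e => P (t e) (u e)).
Proof.
  intros Ht Hu.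
  apply (Def_subst (P := fun e x => P x (u e))); [exact Ht|].
  apply (Def_subst (P := fun e y => P (e 0) y) (t := fun e => u (fun n => e (S n)))).
  - apply Term_shift, Hu.
  - exact (Def_rename (fun n => match n with O => 1 | _ => 0 end) H).
Qed.

Lemma Def_P3 P {H : DefP3 P} t u v :
  Term t -> Term u -> Term v -> Def (fun e => P (t e) (u e) (v e)).
Proof.
  intros Ht Hu Hv.
  apply (Def_subst (P := fun e x => P x (u e) (v e))); [exact Ht|].
  apply (Def_subst (P := fun e y => P (e 0) y (v (fun n => e (S n))))
    (t := fun e => u (fun n => e (S n)))).
  - apply Term_shift, Hu.
  - apply (Def_subst (P := fun e z => P (e 1) (e 0) z)
      (t := fun e => v (fun n => e (S (S n))))).
    + apply (Term_shift (t := fun e => v (fun n => e (S n)))), Term_shift, Hv.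
    + exact (Def_rename
        (fun n => match n with O => 2 | S O => 1 | _ => 0 end) H).
Qed.

Lemma Term_subst (f : (nat -> M) -> M -> M) t :
  Term t -> Term (fun e => f (fun n => e (S n)) (e 0)) -> Term (fun e => f e (t e)).
Proof.
  intros Ht Hf.
  apply (Def_subst (P := fun e x => e 0 = f (fun n => e (S n)) x)
    (t := fun e => t (fun n => e (S n)))); [apply Term_shift, Ht|].
  (* The slot of the value and the slot of the argument change places. *)
  exact (Def_rename (fun n => match n with O => 1 | S O => 0 | k => k end) Hf).
Qed.

Lemma Term_rename s (t : (nat -> M) -> M) :
  Term t -> Term (fun e => t (fun n => e (s n))).
Proof.
  intro H; apply (Def_rename (fun n => match n with O => O | S k => S (s k) end)) in H.
  exact H.
Qed.

Lemma Term_F1 f {H : DefF1 f} t : Term t -> Term (fun e => f (t e)).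
Proof.
  intros Ht; apply (Term_subst (f := fun _ x => f x)); assumption.
Qed.

Lemma Term_F2 f {H : DefF2 f} t u :
  Term t -> Term u -> Term (fun e => f (t e) (u e)).
Proof.
  intros Ht Hu; apply (Term_subst (f := fun e x => f x (u e))); [exact Ht|].
  apply (Term_subst (f := fun e y => f (e 0) y) (t := fun e => u (fun n => e (S n)))).
  - apply Term_shift, Hu.
  - exact (Term_rename (fun n => match n with O => 1 | _ => 0 end) H).
Qed.

Lemma Term_F3 f {H : DefF3 f} t u v :
  Term t -> Term u -> Term v -> Term (fun e => f (t e) (u e) (v e)).
Proof.
  intros Ht Hu Hv; apply (Term_subst (f := fun e x => f x (u e) (v e))); [exact Ht|].
  apply (Term_subst (f := fun e y => f (e 0) y (v (fun n => e (S n))))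
    (t := fun e => u (fun n => e (S n)))); [apply Term_shift, Hu|].
  apply (Term_subst (f := fun e z => f (e 1) (e 0) z)
    (t := fun e => v (fun n => e (S (S n))))).
  - apply (Term_shift (t := fun e => v (fun n => e (S n)))), Term_shift, Hv.
  - exact (Term_rename (fun n => match n with O => 2 | S O => 1 | _ => 0 end) H).
Qed.

Lemma Def_eq (t u : (nat -> M) -> M) : Term t -> Term u -> Def (fun e => t e = u e).
Proof.
  intros Ht Hu; apply (Def_subst (P := fun e x => x = u e)); assumption.
Qed.

Lemma Def_ex_unique (Q : (nat -> M) -> M -> Prop) :
  Def (fun e => Q (fun n => e (S n)) (e 0)) -> Def (fun e => exists! x, Q e x).
Proof.
  intro HQ; apply (Def_ex (Q := fun e x => unique (Q e) x)); unfold unique.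
  apply Def_and; [exact HQ|].
  apply (Def_all (Q := fun e y => Q (fun n => e (S n)) y -> e 0 = y)).
  apply Def_imp; [|apply Def_eq; apply Term_var].
  exact (Def_rename (fun n => match n with O => 0 | S k => S (S k) end) HQ).
Qed.

#[global] Instance DefP2_mem : DefP2 (@mem M).
Proof.
  exists (Fmem 0 1), (fun n => inl n); intro e; simpl; unfold valuation; tauto.
Qed.

Lemma separation {HM : ZF M} (P : M -> Prop) (a : M) :
  Def (fun e => P (e 0)) -> exists b, forall z, z ∈ b <-> z ∈ a /\ P z.
Proof.
  intros [p [r Hp]]; destruct (bind_valuation r) as [s [r' Hr]].
  (* [P] reads slot 0 only, so any background environment serves; the constant one at [a] uses an
     element already at hand. *)
  destruct (zf_separation HM (rename s p) (valuation r' (fun _ => a)) a) as [b Hb].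
  exists b; intro z; rewrite Hb, sat_rename, Hr, Hp; tauto.
Qed.

Lemma replacement {HM : ZF M} (f : M -> M) (a : M) :
  Term (fun e => f (e 0)) -> exists b, forall y, y ∈ b <-> exists x, x ∈ a /\ y = f x.
Proof.
  (* The schema keeps the argument in slot 0 and the value in slot 1, the reverse of the convention
     of [Term]. *)
  intro Hf; apply (Def_rename (fun n => match n with O => 1 | _ => 0 end)) in Hf.
  destruct Hf as [p [r Hp]].
  destruct (bind_valuation r) as [s [r' Hr]].
  destruct (bind_valuation r') as [s' [r'' Hr']].
  assert (E : forall x y, sat (scons x (scons y (valuation r'' (fun _ => a))))
    (rename (fun n => match s n with O => O | S k => S (s' k) end) p) <-> y = f x).
  { intros x y; rewrite sat_rename.
    rewrite <- (Hp (scons x (scons y (fun _ => a)))), <- Hr, <- Hr'.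
    match goal with |- sat ?a _ <-> sat ?b _ => replace b with a; [tauto|] end.
    apply functional_extensionality; intro n; destruct (s n); reflexivity. }
  destruct (zf_replacement HM (p := rename (fun n => match s n with O => O | S k => S (s' k) end) p)
    (e := valuation r'' (fun _ => a)) (a := a)) as [b Hb].
  - intros x y y' _ Hy Hy'; apply E in Hy, Hy'; congruence.
  - exists b; intro y; rewrite Hb; split; intros [x [Hx H]]; exists x;
      (split; [exact Hx|]); apply E; exact H.
Qed.

End Definability.

Existing Class ZF.

(** Applications are tried with three arguments before two and two before one; otherwise an argument
    that does not depend on the environment would be absorbed into the head. *)
Ltac definable_step :=
  cbv beta;
  match goal with
  | |- Def (fun e => False) => apply Def_False
  | |- Def (fun e => ~ @?P e) => apply (@Def_not _ P)
  | |- Def (fun e => @?P e /\ @?Q e) => apply (@Def_and _ P Q)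
  | |- Def (fun e => @?P e \/ @?Q e) => apply (@Def_or _ P Q)
  | |- Def (fun e => @?P e <-> @?Q e) => apply (@Def_iff _ P Q)
  | |- Def (fun e => @?P e -> @?Q e) => apply (@Def_imp _ P Q)
  | |- Def (fun e => forall x, @?P e x) => apply (@Def_all _ P)
  | |- Def (fun e => exists! x, @?P e x) => apply (@Def_ex_unique _ P)
  | |- Def (fun e => exists x, @?P e x) => apply (@Def_ex _ P)
  | |- Def (fun e => @?t e = @?u e) => apply (@Def_eq _ t u)
  | |- Def (fun e => ?P (@?t e) (@?u e) (@?v e)) => apply (@Def_P3 _ P _ t u v)
  | |- Def (fun e => ?P (@?t e) (@?u e)) => apply (@Def_P2 _ P _ t u)
  | |- Def (fun e => ?P (@?t e)) => apply (@Def_P1 _ P _ t)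
  | |- Term (fun e => ?c) => apply (@Term_const _ c)
  | |- Term (fun e => e ?i) => apply (@Term_var _ i)
  | |- Term (fun e => ?f (@?t e) (@?u e) (@?v e)) => apply (@Term_F3 _ f _ t u v)
  | |- Term (fun e => ?f (@?t e) (@?u e)) => apply (@Term_F2 _ f _ t u)
  | |- Term (fun e => ?f (@?t e)) => apply (@Term_F1 _ f _ t)
  end.
(** An extension point: it is redefined each time new operations that bind variables acquire their
    own definability rules. *)
Ltac definable_hook := fail.
Ltac definable_unfold :=
  try unfold DefP1; try unfold DefP2; try unfold DefP3;
  try unfold DefF1; try unfold DefF2; try unfold DefF3.
Ltac definable := definable_unfold; repeat (definable_hook || definable_step).

#[global] Hint Mode DefP1 - ! : typeclass_instances.
#[global] Hint Mode DefP2 - ! : typeclass_instances.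
#[global] Hint Mode DefP3 - ! : typeclass_instances.
#[global] Hint Mode DefF1 - ! : typeclass_instances.
#[global] Hint Mode DefF2 - ! : typeclass_instances.
#[global] Hint Mode DefF3 - ! : typeclass_instances.
#[global] Hint Extern 0 (DefP1 (fun _ => _)) => solve [definable] : typeclass_instances.
#[global] Hint Extern 0 (DefP2 (fun _ => _)) => solve [definable] : typeclass_instances.
#[global] Hint Extern 0 (DefP3 (fun _ => _)) => solve [definable] : typeclass_instances.
#[global] Hint Extern 0 (DefF1 (fun _ => _)) => solve [definable] : typeclass_instances.
#[global] Hint Extern 0 (DefF2 (fun _ => _)) => solve [definable] : typeclass_instances.
#[global] Hint Extern 0 (DefF3 (fun _ => _)) => solve [definable] : typeclass_instances.

(** * Set operations *)

Section SetOperations.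
Context {M : set_structure} {HM : ZF M}.
Implicit Types x y z a b f : M.

Lemma ext x y : (forall z, z ∈ x <-> z ∈ y) -> x = y.
Proof. apply (zf_extensionality HM). Qed.

Lemma ZF_inhabited : inhabited M.
Proof. destruct (zf_infinity HM) as [w _]; exact (inhabits w). Qed.

(** Definite description with the empty set as default value, so that [the P]
    is definable whenever [P] is. *)
Definition the (P : M -> Prop) : M :=
  epsilon ZF_inhabited
    (fun y => unique P y \/ (~ (exists z, unique P z) /\ is_empty y)).

Lemma exists_empty : exists y : M, is_empty y.
Proof. destruct (zf_infinity HM) as [w [[e [He _]] _]]; eauto. Qed.

(** The equivalence covers the default case as well, so its right side is a formula for the graph of
    [the] with no proviso on [P]. *)
Lemma the_char (P : M -> Prop) y :
  y = the P <-> (unique P y \/ (~ (exists z, unique P z) /\ is_empty y)).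
Proof.
  assert (H : exists y, unique P y \/ (~ (exists z, unique P z) /\ is_empty y)).
  { destruct (classic (exists z, unique P z)) as [[z Hz]|H]; [eauto|].
    destruct exists_empty as [y0 Hy]; eauto. }
  pose proof (epsilon_spec ZF_inhabited _ H) as E; fold (the P) in E; split.
  - intros ->; exact E.
  - destruct E as [E|[E1 E2]]; intros [H1|[H1 H2]].
    + symmetry; apply E, H1.
    + exfalso; eauto.
    + exfalso; eauto.
    + apply ext; intro z; split; intro Hz; exfalso; [exact (H2 z Hz) | exact (E2 z Hz)].
Qed.

Lemma the_spec (P : M -> Prop) : (exists! y, P y) -> P (the P).
Proof.
  intros [y Hy]; assert (y = the P) as <- by (apply the_char; auto); apply Hy.
Qed.

Lemma the_eq (P : M -> Prop) y : P y -> (forall z, P z -> y = z) -> the P = y.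
Proof. intros; symmetry; apply the_char; left; split; auto. Qed.

Lemma Term_the (P : (nat -> M) -> M -> Prop) :
  Def (fun e => P (fun n => e (S n)) (e 0)) -> Term (fun e => the (P e)).
Proof.
  intro HP; unfold Term.
  eapply Def_ext; [intro e; symmetry; apply the_char|].
  assert (E : Def (fun e => unique (P (fun n => e (S n))) (e 0))).
  { unfold unique; apply Def_and; [exact HP|].
    apply (Def_all (Q := fun e y => P (fun n => e (S n)) y -> e 0 = y)).
    apply Def_imp; [|apply Def_eq; apply Term_var].
    exact (Def_rename (fun n => match n with O => 0 | S k => S (S k) end) HP). }
  apply Def_or; [exact E|].
  apply Def_and.
  - apply Def_not, (Def_ex (Q := fun e y => unique (P (fun n => e (S n))) y)).
    exact (Def_rename (fun n => match n with O => 0 | S k => S (S k) end) E).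
  - unfold is_empty; definable.
Qed.

End SetOperations.

Ltac definable_the :=
  match goal with
  | |- Term (fun e => the (@?P e)) => apply (@Term_the _ _ P)
  end.
Ltac definable_hook ::= cbv beta; definable_the.

Section SetOperations.
Context {M : set_structure} {HM : ZF M}.
Implicit Types x y z a b f : M.

#[global] Instance is_empty_def : DefP1 (@is_empty M).
Proof. unfold is_empty; definable. Qed.
#[global] Instance nonempty_def : DefP1 (@nonempty M).
Proof. unfold nonempty; definable. Qed.
#[global] Instance subset_def : DefP2 (@subset M).
Proof. unfold subset; definable. Qed.
#[global] Instance is_upair_def : DefP3 (@is_upair M).
Proof. unfold is_upair; definable. Qed.
#[global] Instance is_pair_def : DefP3 (@is_pair M).
Proof. unfold is_pair; definable. Qed.
#[global] Instance maps_def : DefP3 (@maps M).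
Proof. unfold maps; definable. Qed.
#[global] Instance is_function_def : DefP2 (@is_function M).
Proof. unfold is_function; definable. Qed.
#[global] Instance is_bijection_def : DefP3 (@is_bijection M).
Proof. unfold is_bijection; definable. Qed.
#[global] Instance equipotent_def : DefP2 (@equipotent M).
Proof. unfold equipotent; definable. Qed.
#[global] Instance is_nat_def : DefP1 (@is_nat M).
Proof. unfold is_nat, is_omega, is_inductive, is_succ; definable. Qed.
#[global] Instance finite_def : DefP1 (@finite M).
Proof. unfold finite; definable. Qed.
#[global] Instance locally_finite_def : DefP3 (@locally_finite M).
Proof. unfold locally_finite, is_nbhd, family_of_subsets; definable. Qed.
#[global] Instance point_finite_def : DefP3 (@point_finite M).
Proof. unfold point_finite, family_of_subsets; definable. Qed.
#[global] Instance interior_preserving_def : DefP3 (@interior_preserving M).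
Proof. unfold interior_preserving, family_of_subsets; definable. Qed.

Definition empty : M := the is_empty.
Definition upair a b : M := the (fun p => is_upair p a b).
Definition sing a : M := upair a a.
Definition pair a b : M := upair (sing a) (upair a b).
Definition Union x : M := the (fun u => is_union u x).
Definition cup a b : M := Union (upair a b).
Definition pow x : M := the (fun p => is_powerset p x).
(** Written for arbitrary predicates of the metatheory; only [in_sep] demands definability, because
    only then does the schema provide the described set. The same holds for [image] and [lam]. *)
Definition sep a (P : M -> Prop) : M := the (fun b => forall z, z ∈ b <-> z ∈ a /\ P z).
Definition image a (f : M -> M) : M :=
  the (fun b => forall y, y ∈ b <-> exists x, x ∈ a /\ y = f x).
(** A case distinction as a description, so that it is definable as soon as its condition and its
    branches are. *)
Definition cond (P : Prop) a b : M := the (fun y => P /\ y = a \/ ~ P /\ y = b).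
Definition inter a b : M := sep a (fun z => z ∈ b).
Definition diff a b : M := sep a (fun z => ~ z ∈ b).
Definition succ x : M := cup x (sing x).
Definition app f x : M := the (fun y => pair x y ∈ f).
Definition lam a (t : M -> M) : M := image a (fun x => pair x (t x)).
Definition cart a b : M := Union (image a (fun x => image b (fun y => pair x y))).

#[global] Instance upair_def : DefF2 upair.
Proof. unfold upair; definable. Qed.
#[global] Instance sing_def : DefF1 sing.
Proof. unfold sing; definable. Qed.
#[global] Instance pair_def : DefF2 pair.
Proof. unfold pair; definable. Qed.
#[global] Instance Union_def : DefF1 Union.
Proof. unfold Union, is_union; definable. Qed.
#[global] Instance cup_def : DefF2 cup.
Proof. unfold cup; definable. Qed.
#[global] Instance pow_def : DefF1 pow.
Proof. unfold pow, is_powerset; definable. Qed.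
#[global] Instance inter_def : DefF2 inter.
Proof. unfold inter, sep; definable. Qed.
#[global] Instance diff_def : DefF2 diff.
Proof. unfold diff, sep; definable. Qed.
#[global] Instance succ_def : DefF1 succ.
Proof. unfold succ; definable. Qed.
#[global] Instance app_def : DefF2 app.
Proof. unfold app; definable. Qed.
#[global] Instance cart_def : DefF2 cart.
Proof. unfold cart, image; definable. Qed.

(** [sep], [image], [cond] and [lam] take propositions, predicates or functions of the metatheory
    and so fall outside the classes [DefF1] to [DefF3]. Each has its own rule; a bound variable
    becomes a new slot 0. *)
Lemma Term_sep (a : (nat -> M) -> M) (P : (nat -> M) -> M -> Prop) : Term a ->
  Def (fun e => P (fun n => e (S n)) (e 0)) -> Term (fun e => sep (a e) (P e)).
Proof.
  intros Ha HP; unfold sep; apply Term_the, Def_all, Def_iff; [definable|].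
  apply Def_and.
  - apply Def_P2; [exact _ | apply Term_var|].
    exact (Term_shift (Term_shift Ha)).
  - exact (Def_rename (fun n => match n with O => 0 | S k => S (S k) end) HP).
Qed.

Lemma Term_image (a : (nat -> M) -> M) (t : (nat -> M) -> M -> M) : Term a ->
  Term (fun e => t (fun n => e (S n)) (e 0)) -> Term (fun e => image (a e) (t e)).
Proof.
  intros Ha Ht; unfold image; apply Term_the, Def_all, Def_iff; [definable|].
  apply Def_ex, Def_and.
  - apply Def_P2; [exact _ | apply Term_var|].
    exact (Term_shift (Term_shift (Term_shift Ha))).
  - apply Def_eq; [apply Term_var|].
    exact (Term_rename (fun n => match n with O => 0 | S k => S (S (S k)) end) Ht).
Qed.

Lemma Term_cond (P : (nat -> M) -> Prop) (a b : (nat -> M) -> M) :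
  Def P -> Term a -> Term b -> Term (fun e => cond (P e) (a e) (b e)).
Proof.
  intros HP Ha Hb; unfold cond; apply Term_the.
  apply Term_shift in Ha, Hb; apply (Def_rename S) in HP.
  apply Def_or; apply Def_and; try apply Def_eq; try apply Term_var; try assumption.
  apply Def_not; assumption.
Qed.

Lemma Term_lam (a : (nat -> M) -> M) (t : (nat -> M) -> M -> M) : Term a ->
  Term (fun e => t (fun n => e (S n)) (e 0)) -> Term (fun e => lam (a e) (t e)).
Proof.
  intros Ha Ht; apply (Term_image (t := fun e x => pair x (t e x))); [exact Ha|].
  apply Term_F2; [exact _ | apply Term_var | exact Ht].
Qed.

End SetOperations.

Ltac definable_binder :=
  match goal with
  | |- Term (fun e => sep (@?a e) (@?P e)) => apply (@Term_sep _ _ a P)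
  | |- Term (fun e => image (@?a e) (@?t e)) => apply (@Term_image _ _ a t)
  | |- Term (fun e => lam (@?a e) (@?t e)) => apply (@Term_lam _ _ a t)
  | |- Term (fun e => cond (@?P e) (@?a e) (@?b e)) => apply (@Term_cond _ _ P a b)
  end.
Ltac definable_hook ::= cbv beta; (definable_the || definable_binder).

Section SetOperations.
Context {M : set_structure} {HM : ZF M}.
Implicit Types x y z a b f A B : M.

Lemma in_empty x : ~ x ∈ empty.
Proof.
  assert (H : is_empty empty); [|apply H].
  apply (the_spec (P := @is_empty M)); destruct exists_empty as [y Hy]; exists y; split; [exact Hy|].
  intros y' Hy'; apply ext; intro z; split; intro Hz; exfalso;
    [exact (Hy z Hz) | exact (Hy' z Hz)].
Qed.

(** Extensionality makes a set with a given membership condition unique, so existence is all that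
    the description requires. *)
Lemma the_set_spec (Q : M -> Prop) :
  (exists b, forall z, z ∈ b <-> Q z) ->
  forall z, z ∈ the (fun b => forall z, z ∈ b <-> Q z) <-> Q z.
Proof.
  intros [b Hb]; apply (the_spec (P := fun b => forall z, z ∈ b <-> Q z)).
  exists b; split; [exact Hb|].
  intros b' Hb'; apply ext; intro z; rewrite Hb, Hb'; tauto.
Qed.

Lemma is_empty_iff x : is_empty x <-> x = empty.
Proof.
  split; [|intros ->; exact in_empty].
  intro H; apply ext; intro z; split; intro Hz; exfalso;
    [exact (H z Hz) | exact (in_empty Hz)].
Qed.

Lemma in_upair z a b : z ∈ upair a b <-> z = a \/ z = b.
Proof. apply (the_set_spec (Q := fun z => z = a \/ z = b)), (zf_pairing HM). Qed.

Lemma in_sing z a : z ∈ sing a <-> z = a.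
Proof. unfold sing; rewrite in_upair; tauto. Qed.

Lemma in_Union z x : z ∈ Union x <-> exists y, y ∈ x /\ z ∈ y.
Proof. apply (the_set_spec (Q := fun z => exists y, y ∈ x /\ z ∈ y)), (zf_union HM). Qed.

Lemma in_pow z x : z ∈ pow x <-> subset z x.
Proof. apply (the_set_spec (Q := fun z => subset z x)), (zf_powerset HM). Qed.

Lemma in_cup z a b : z ∈ cup a b <-> z ∈ a \/ z ∈ b.
Proof.
  unfold cup; rewrite in_Union; split.
  - intros [y [Hy Hz]]; apply in_upair in Hy as [->| ->]; auto.
  - intros [H|H]; [exists a|exists b]; rewrite in_upair; auto.
Qed.

Lemma in_sep a P {HP : DefP1 P} z : z ∈ sep a P <-> z ∈ a /\ P z.
Proof.
  apply (the_set_spec (Q := fun z => z ∈ a /\ P z)).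
  apply separation, HP.
Qed.

Lemma in_image a t {Ht : DefF1 t} y : y ∈ image a t <-> exists x, x ∈ a /\ y = t x.
Proof.
  apply (the_set_spec (Q := fun y => exists x, x ∈ a /\ y = t x)).
  apply replacement, Ht.
Qed.

Lemma in_inter z a b : z ∈ inter a b <-> z ∈ a /\ z ∈ b.
Proof. unfold inter; rewrite in_sep by definable; reflexivity. Qed.

Lemma in_diff z a b : z ∈ diff a b <-> z ∈ a /\ ~ z ∈ b.
Proof. unfold diff; rewrite in_sep by definable; reflexivity. Qed.

Lemma in_succ z x : z ∈ succ x <-> z ∈ x \/ z = x.
Proof. unfold succ; rewrite in_cup, in_sing; tauto. Qed.

Lemma cond_true (P : Prop) a b : P -> cond P a b = a.
Proof. intro H; apply the_eq; [auto|intros z [[_ ?]|[? _]]; [auto|tauto]]. Qed.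

Lemma cond_false (P : Prop) a b : ~ P -> cond P a b = b.
Proof. intro H; apply the_eq; [auto|intros z [[? _]|[_ ?]]; [tauto|auto]]. Qed.

Lemma upair_inj a b c d : upair a b = upair c d -> a = c /\ b = d \/ a = d /\ b = c.
Proof.
  intro E.
  assert (H : forall z, (z = a \/ z = b) <-> (z = c \/ z = d)).
  { intro z; rewrite <- !in_upair, E; tauto. }
  pose proof (proj1 (H a) (or_introl eq_refl)).
  pose proof (proj1 (H b) (or_intror eq_refl)).
  pose proof (proj2 (H c) (or_introl eq_refl)).
  pose proof (proj2 (H d) (or_intror eq_refl)).
  intuition congruence.
Qed.

Lemma pair_inj a b c d : pair a b = pair c d -> a = c /\ b = d.
Proof.
  intro E; apply upair_inj in E.
  destruct E as [[E1 E2]|[E1 E2]]; apply upair_inj in E1, E2; intuition congruence.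
Qed.

Lemma is_pair_iff p a b : is_pair p a b <-> p = pair a b.
Proof.
  assert (U : forall u c d, is_upair u c d <-> u = upair c d).
  { intros u c d; split; [|intros -> z; apply in_upair].
    intro H; apply ext; intro z; rewrite in_upair; apply H. }
  unfold is_pair; split.
  - intros [u [v [H1 [H2 H3]]]]; apply U in H1, H2, H3; now subst.
  - intros ->; exists (sing a), (upair a b); rewrite !U; auto.
Qed.

Lemma maps_iff f x y : maps f x y <-> pair x y ∈ f.
Proof.
  unfold maps; split.
  - intros [p [Hp H]]; apply is_pair_iff in Hp; now subst.
  - intro H; exists (pair x y); now rewrite is_pair_iff.
Qed.

Lemma in_cart p a b : p ∈ cart a b <-> exists x y, x ∈ a /\ y ∈ b /\ p = pair x y.
Proof.
  unfold cart; rewrite in_Union; split.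
  - intros [u [Hu Hp]]; apply in_image in Hu; [|definable].
    destruct Hu as [x [Hx ->]]; apply in_image in Hp; [|definable].
    destruct Hp as [y [Hy ->]]; eauto.
  - intros [x [y [Hx [Hy ->]]]]; exists (image b (fun y => pair x y)).
    rewrite !in_image by definable; split; [exists x|exists y]; auto.
Qed.

(** For Kuratowski pairs [y ∈ upair x y ∈ pair x y ∈ f]. This gives a set that bounds all values of
    [f], as separation requires. *)
Lemma pair_Union_Union f x y : pair x y ∈ f -> y ∈ Union (Union f).
Proof.
  intro H; rewrite in_Union; exists (upair x y); split; [|rewrite in_upair; auto].
  rewrite in_Union; exists (pair x y); split; [exact H|].
  unfold pair; rewrite in_upair; auto.
Qed.

Lemma app_maps f A x : is_function f A -> x ∈ A -> maps f x (app f x).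
Proof.
  intros [_ H] Hx; rewrite maps_iff; apply (the_spec (P := fun y => pair x y ∈ f)).
  destruct (H x Hx) as [y [Hy Hu]]; exists y; split.
  - now apply maps_iff.
  - intros y' Hy'; apply Hu; now apply maps_iff.
Qed.

Lemma maps_app f A x y : is_function f A -> (maps f x y <-> x ∈ A /\ y = app f x).
Proof.
  intros Hf; split.
  - intro H; assert (Hx : x ∈ A).
    { apply maps_iff in H; destruct (proj1 Hf _ H) as [x' [y' [Hx' E]]].
      apply is_pair_iff, pair_inj in E; destruct E; now subst. }
    split; [exact Hx|].
    destruct (proj2 Hf x Hx) as [y' [_ Hu]].
    rewrite <- (Hu _ H); apply Hu, (app_maps Hf Hx).
  - intros [Hx ->]; exact (app_maps Hf Hx).
Qed.

Lemma function_ext f g A : is_function f A -> is_function g A ->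
  (forall x, x ∈ A -> app f x = app g x) -> f = g.
Proof.
  assert (H : forall f g, is_function f A -> is_function g A ->
    (forall x, x ∈ A -> app f x = app g x) -> subset f g).
  { intros f' g' Hf Hg E p Hp.
    destruct (proj1 Hf p Hp) as [x [y [Hx Exy]]]; apply is_pair_iff in Exy; subst p.
    rewrite <- maps_iff, (maps_app x y Hf) in Hp; destruct Hp as [_ ->].
    rewrite <- maps_iff, (maps_app _ _ Hg); auto. }
  intros Hf Hg E; apply ext; intro z; split; apply H; auto.
  intros; symmetry; auto.
Qed.

Lemma in_lam A t {Ht : DefF1 t} p : p ∈ lam A t <-> exists x, x ∈ A /\ p = pair x (t x).
Proof. unfold lam; rewrite in_image by definable; reflexivity. Qed.

Lemma maps_lam A t {Ht : DefF1 t} x y : maps (lam A t) x y <-> x ∈ A /\ y = t x.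
Proof.
  rewrite maps_iff, in_lam by definable; split.
  - intros [x' [Hx E]]; apply pair_inj in E as [-> ->]; auto.
  - intros [Hx ->]; eauto.
Qed.

Lemma lam_function A t {Ht : DefF1 t} : is_function (lam A t) A.
Proof.
  split.
  - intros p Hp; rewrite in_lam in Hp by definable; destruct Hp as [x [Hx ->]].
    exists x, (t x); rewrite is_pair_iff; auto.
  - intros x Hx; exists (t x); split.
    + apply maps_lam; auto.
    + intros y Hy; rewrite maps_lam in Hy by definable; symmetry; apply Hy.
Qed.

Lemma app_lam A t {Ht : DefF1 t} x : x ∈ A -> app (lam A t) x = t x.
Proof.
  intro Hx; symmetry.
  apply (maps_app (A := A)); [apply lam_function; exact Ht | apply maps_lam; auto].
Qed.

Lemma app_Union_Union f A x : is_function f A -> x ∈ A -> app f x ∈ Union (Union f).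
Proof.
  intros Hf Hx; apply (@pair_Union_Union f x), maps_iff, (app_maps Hf Hx).
Qed.

Lemma subset_refl A : subset A A.
Proof. intros x Hx; exact Hx. Qed.

Lemma subset_antisym A B : subset A B -> subset B A -> A = B.
Proof. intros H1 H2; apply ext; intro z; split; auto. Qed.

Lemma subset_cup A B C : subset A C -> subset B C -> subset (cup A B) C.
Proof. intros H1 H2 x Hx; apply in_cup in Hx as [Hx|Hx]; auto. Qed.

(** Foundation for [sing x]. The lemma is also what makes a set [A] a point outside [A], available
    later as a point at infinity. *)
Lemma mem_irrefl x : ~ x ∈ x.
Proof.
  intro H; destruct (zf_foundation HM (x := sing x)) as [y [Hy Hn]].
  - exists x; now apply in_sing.
  - apply in_sing in Hy; subst y; apply (Hn x H); now apply in_sing.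
Qed.

End SetOperations.

(** Unification would otherwise compare sets by unfolding their descriptions. *)
#[global] Opaque the empty upair sing pair Union cup pow sep image cond inter diff succ
  app lam cart.

Ltac membership_step :=
  rewrite in_cup || rewrite in_inter || rewrite in_diff || rewrite in_sing ||
  rewrite in_upair || rewrite in_succ || rewrite in_pow || rewrite in_Union ||
  rewrite in_cart || (rewrite in_sep by definable) || (rewrite in_image by definable).
Ltac membership_step_in H :=
  rewrite in_cup in H || rewrite in_inter in H || rewrite in_diff in H ||
  rewrite in_sing in H || rewrite in_upair in H || rewrite in_succ in H ||
  rewrite in_pow in H || rewrite in_Union in H || rewrite in_cart in H ||
  (rewrite in_sep in H by definable) || (rewrite in_image in H by definable).
Tactic Notation "membership" := cbv beta; repeat (membership_step; cbv beta).
Tactic Notation "membership" "in" hyp(H) :=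
  cbv beta in H; repeat (membership_step_in H; cbv beta in H).

(** * Natural numbers and recursion *)

Section NaturalNumbers.
Context {M : set_structure} {HM : ZF M}.

Definition omega : M := the is_omega.

Lemma is_succ_iff (y x : M) : is_succ y x <-> y = succ x.
Proof.
  split; [|intros -> z; apply in_succ].
  intro H; apply ext; intro z; rewrite in_succ; apply H.
Qed.

Lemma is_inductive_iff (w : M) :
  is_inductive w <-> empty ∈ w /\ forall x, x ∈ w -> succ x ∈ w.
Proof.
  unfold is_inductive; split.
  - intros [[e [He Hw]] H]; apply is_empty_iff in He; subst e; split; [exact Hw|].
    intros x Hx; destruct (H x Hx) as [y [Hy Hyw]].
    apply is_succ_iff in Hy; now subst.
  - intros [H0 H]; split; [exists empty; now rewrite is_empty_iff|].
    intros x Hx; exists (succ x); rewrite is_succ_iff; auto.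
Qed.

(** Two least inductive sets include each other. One exists: separate, from any inductive set, the
    elements common to all inductive sets. *)
Lemma is_omega_iff (w : M) : is_omega w <-> w = omega.
Proof.
  assert (U : forall w w' : M, is_omega w -> is_omega w' -> w = w').
  { intros w1 w2 [H1 H2] [H3 H4]; apply subset_antisym; auto. }
  assert (H : is_omega omega).
  { apply (the_spec (P := @is_omega M)).
    destruct (zf_infinity HM) as [w0 Hw0].
    pose (w1 := sep w0 (fun z => forall i, is_inductive i -> z ∈ i)).
    assert (D : DefP1 (fun z : M => forall i, is_inductive i -> z ∈ i)).
    { unfold is_inductive, is_succ; definable. }
    assert (Hw1 : is_omega w1).
    { split.
      - apply is_inductive_iff; unfold w1; rewrite in_sep by exact D; split.
        + split; [now apply is_inductive_iff|].
          intros i Hi; now apply is_inductive_iff in Hi.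
        + intros x Hx; rewrite in_sep in * by exact D; destruct Hx as [Hx Hi].
          split; [apply is_inductive_iff in Hw0; now apply Hw0|].
          intros i Hi'; pose proof (Hi i Hi'); apply is_inductive_iff in Hi'; now apply Hi'.
      - intros i Hi x Hx; unfold w1 in Hx; rewrite in_sep in Hx by exact D.
        now apply Hx. }
    exists w1; split; auto. }
  split; [intro; apply U; auto | intros ->; exact H].
Qed.

Lemma is_nat_iff (n : M) : is_nat n <-> n ∈ omega.
Proof.
  split; [|exists omega; now rewrite is_omega_iff].
  intros [w [Hw Hn]]; apply is_omega_iff in Hw; now subst.
Qed.

Lemma zero_omega : empty ∈ omega.
Proof.
  assert (H : is_omega omega) by now apply is_omega_iff.
  destruct H as [H _]; apply is_inductive_iff in H; apply H.
Qed.

Lemma succ_omega n : n ∈ omega -> succ n ∈ omega.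
Proof.
  assert (H : is_omega omega) by now apply is_omega_iff.
  destruct H as [H _]; apply is_inductive_iff in H; apply H.
Qed.

(** Separation turns [P] into an inductive subset of [omega]. Definability is essential, since
    [omega] of the model may contain nonstandard numbers. *)
Lemma omega_ind (P : M -> Prop) {HP : DefP1 P} :
  P empty -> (forall n, n ∈ omega -> P n -> P (succ n)) ->
  forall n, n ∈ omega -> P n.
Proof.
  intros H0 HS n Hn.
  assert (H : is_omega omega) by now apply is_omega_iff.
  assert (Hs : n ∈ sep omega P); [|rewrite in_sep in Hs by exact HP; apply Hs].
  apply (proj2 H); [|exact Hn].
  apply is_inductive_iff; split.
  - rewrite in_sep by exact HP; split; [apply zero_omega | exact H0].
  - intros x Hx; rewrite in_sep in * by exact HP; destruct Hx.
    split; [now apply succ_omega | auto].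
Qed.

Lemma omega_mem m n : n ∈ omega -> m ∈ n -> m ∈ omega.
Proof.
  intro Hn; revert n Hn m.
  apply (omega_ind (P := fun n => forall m, m ∈ n -> m ∈ omega)).
  - intros m Hm; destruct (in_empty Hm).
  - intros n Hn IH m Hm; membership in Hm; destruct Hm as [Hm| ->]; auto.
Qed.

Lemma omega_trans k m n : n ∈ omega -> k ∈ m -> m ∈ n -> k ∈ n.
Proof.
  intro Hn; revert n Hn k m.
  apply (omega_ind (P := fun n => forall k m, k ∈ m -> m ∈ n -> k ∈ n)).
  - intros k m _ Hm; destruct (in_empty Hm).
  - intros n Hn IH k m Hk Hm; membership in Hm; membership.
    destruct Hm as [Hm| ->]; eauto.
Qed.

Lemma mem_succ (n : M) : n ∈ succ n.
Proof. membership; auto. Qed.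

Lemma mem_mem_succ (m n : M) : m ∈ n -> m ∈ succ n.
Proof. membership; auto. Qed.

(** Here and below [m ∈ succ n] expresses m ≤ n for natural numbers, and [m ∈ n] the strict
    order. *)
Lemma zero_mem_succ n : n ∈ omega -> empty ∈ succ n.
Proof.
  revert n; apply (omega_ind (P := fun n => empty ∈ succ n)); intros; membership; auto.
  membership in H0; auto.
Qed.

Lemma succ_mem_succ m n : n ∈ omega -> m ∈ n -> succ m ∈ succ n.
Proof.
  intro Hn; revert n Hn m.
  apply (omega_ind (P := fun n => forall m, m ∈ n -> succ m ∈ succ n)).
  - intros m Hm; destruct (in_empty Hm).
  - intros n Hn IH m Hm; membership in Hm; destruct Hm as [Hm| ->].
    + apply mem_mem_succ, IH, Hm.
    + apply mem_succ.
Qed.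

Lemma omega_trichotomy m n : m ∈ omega -> n ∈ omega -> m ∈ n \/ m = n \/ n ∈ m.
Proof.
  intros Hm Hn; revert n Hn m Hm.
  apply (omega_ind (P := fun n => forall m, m ∈ omega -> m ∈ n \/ m = n \/ n ∈ m)).
  - intros m Hm; right.
    pose proof (zero_mem_succ Hm) as H; membership in H; destruct H; auto.
  - intros n Hn IH m Hm; destruct (IH m Hm) as [H|[H|H]].
    + left; now apply mem_mem_succ.
    + left; subst; apply mem_succ.
    + right; apply (succ_mem_succ Hm) in H; membership in H; destruct H; auto.
Qed.

Lemma omega_asym m n : n ∈ omega -> m ∈ n -> n ∈ m -> False.
Proof.
  intros Hn H1 H2; apply (@mem_irrefl _ _ n).
  exact (omega_trans Hn H2 H1).
Qed.

Lemma zero_or_succ n : n ∈ omega -> n = empty \/ exists m, m ∈ omega /\ n = succ m.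
Proof.
  revert n; apply (omega_ind (P := fun n => n = empty \/ exists m, m ∈ omega /\ n = succ m)).
  - auto.
  - intros n Hn _; right; eauto.
Qed.

Lemma succ_inj m n : n ∈ omega -> succ m = succ n -> m = n.
Proof.
  intros Hn E.
  assert (H1 : m ∈ succ n) by (rewrite <- E; apply mem_succ).
  assert (H2 : n ∈ succ m) by (rewrite E; apply mem_succ).
  membership in H1; membership in H2.
  destruct H1 as [H1|H1]; [|exact H1]; destruct H2 as [H2|H2]; [|auto].
  destruct (omega_asym Hn H1 H2).
Qed.

(** Foundation yields a membership-minimal witness, and membership is the order of [omega]. *)
Lemma omega_least (P : M -> Prop) {HP : DefP1 P} n : n ∈ omega -> P n ->
  exists m, m ∈ omega /\ P m /\ forall k, k ∈ m -> ~ P k.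
Proof.
  intros Hn H; destruct (zf_foundation HM (x := sep omega P)) as [m [Hm Hl]].
  - exists n; now rewrite in_sep by exact HP.
  - rewrite in_sep in Hm by exact HP; destruct Hm as [Hm Pm].
    exists m; split; [exact Hm|]; split; [exact Pm|].
    intros k Hk Pk; apply (Hl k Hk); rewrite in_sep by exact HP; split; [|exact Pk].
    exact (omega_mem Hm Hk).
Qed.

Lemma succ_trans k m n : n ∈ omega -> k ∈ succ m -> m ∈ succ n -> k ∈ succ n.
Proof.
  intros Hn H1 H2; membership in H1; destruct H1 as [H1| ->]; [|exact H2].
  exact (omega_trans (succ_omega Hn) H1 H2).
Qed.

Lemma mem_succ_trans k m n : n ∈ omega -> k ∈ m -> m ∈ succ n -> k ∈ n.
Proof.
  intros Hn Hk Hm; membership in Hm; destruct Hm as [Hm| ->]; [|exact Hk].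
  exact (omega_trans Hn Hk Hm).
Qed.

Lemma omega_total m n : m ∈ omega -> n ∈ omega -> m ∈ succ n \/ n ∈ succ m.
Proof.
  intros Hm Hn; destruct (omega_trichotomy Hm Hn) as [H|[->|H]];
    auto using mem_succ, mem_mem_succ.
Qed.

Lemma omega_max m n : m ∈ omega -> n ∈ omega ->
  exists k, k ∈ omega /\ m ∈ succ k /\ n ∈ succ k.
Proof.
  intros Hm Hn; destruct (omega_total Hm Hn); eauto using mem_succ.
Qed.

(** A recursion must be carried out inside the model, whose numbers need not be standard. The sets
    [f] are its finite initial segments; any two agree on their common domain, so [rec] can read its
    value at [n] from any of them. *)
Definition approximates (z : M) (G : M -> M -> M) n f :=
  is_function f (succ n) /\ app f empty = z /\
  forall i, i ∈ n -> app f (succ i) = G i (app f i).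

#[global] Instance approximates_def z G {HG : DefF2 G} : DefP2 (approximates z G).
Proof. unfold approximates; definable. Qed.

Definition rec (z : M) (G : M -> M -> M) n : M :=
  the (fun y => exists f, approximates z G n f /\ y = app f n).

Lemma approximates_agree z G m n f g : m ∈ omega -> n ∈ omega ->
  approximates z G m f -> approximates z G n g ->
  forall i, i ∈ succ m -> i ∈ succ n -> app f i = app g i.
Proof.
  intros Hm Hn [_ [Hf Hf']] [_ [Hg Hg']] i Him Hin.
  assert (Hi : i ∈ omega) by exact (omega_mem (succ_omega Hm) Him).
  revert i Hi Him Hin.
  apply (omega_ind (P := fun i => i ∈ succ m -> i ∈ succ n -> app f i = app g i)).
  - congruence.
  - intros i Hi IH H1 H2.
    assert (L : forall n, n ∈ omega -> succ i ∈ succ n -> i ∈ n).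
    { intros k Hk H; membership in H; destruct H as [H|<-]; [|apply mem_succ].
      exact (omega_trans Hk (mem_succ i) H). }
    rewrite Hf', Hg' by auto; f_equal; apply IH; apply mem_mem_succ; auto.
Qed.

Lemma rec_eq z G n f : n ∈ omega -> approximates z G n f -> rec z G n = app f n.
Proof.
  intros Hn Hf; apply the_eq; [eauto|].
  intros y [g [Hg ->]]; apply (approximates_agree Hn Hn Hf Hg); apply mem_succ.
Qed.

Lemma approximates_exists z G {HG : DefF2 G} n : n ∈ omega ->
  exists f, approximates z G n f.
Proof.
  revert n; apply (omega_ind (P := fun n => exists f, approximates z G n f)).
  - exists (lam (succ empty) (fun _ => z)); split; [|split].
    + apply lam_function; definable.
    + rewrite app_lam; [reflexivity | definable | apply mem_succ].
    + intros i Hi; destruct (in_empty Hi).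
  - intros n Hn [f [Hf [H0 HS]]].
    (* The old approximation is kept on [succ n]; the one new index, [succ n] itself, gets a further
       application of [G]. *)
    exists (lam (succ (succ n))
      (fun i => cond (i ∈ succ n) (app f i) (G n (app f n)))); split; [|split].
    + apply lam_function; definable.
    + rewrite app_lam by (definable || now apply zero_mem_succ, succ_omega).
      now rewrite cond_true by now apply zero_mem_succ.
    + intros i Hi.
      rewrite !app_lam by (definable || auto using succ_mem_succ, succ_omega, mem_mem_succ).
      rewrite (cond_true (P := i ∈ succ n)) by exact Hi.
      membership in Hi; destruct Hi as [Hi| ->].
      * rewrite cond_true by now apply succ_mem_succ.
        auto.
      * rewrite cond_false by apply mem_irrefl; reflexivity.
Qed.

Lemma rec_zero z G {HG : DefF2 G} : rec z G empty = z.
Proof.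
  destruct (approximates_exists z (G := G) zero_omega) as [f Hf].
  rewrite (rec_eq zero_omega Hf); destruct Hf as [_ [E _]]; exact E.
Qed.

Lemma rec_succ z G {HG : DefF2 G} n : n ∈ omega -> rec z G (succ n) = G n (rec z G n).
Proof.
  intro Hn.
  destruct (approximates_exists z (G := G) (succ_omega Hn)) as [f Hf].
  destruct (approximates_exists z (G := G) Hn) as [g Hg].
  rewrite (rec_eq (succ_omega Hn) Hf), (rec_eq Hn Hg).
  rewrite <- (approximates_agree (succ_omega Hn) Hn Hf Hg);
    auto using mem_succ, mem_mem_succ.
  destruct Hf as [_ [_ E]]; apply E, mem_succ.
Qed.

Lemma Term_rec (z : (nat -> M) -> M) (G : (nat -> M) -> M -> M -> M) (n : (nat -> M) -> M) :
  Term z -> Term (fun e => G (fun k => e (S (S k))) (e 1) (e 0)) -> Term n ->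
  Term (fun e => rec (z e) (G e) (n e)).
Proof.
  intros Hz HG Hn; unfold rec, approximates.
  pose proof (Term_rename (fun k => S (S k)) Hn) as Hn2.
  pose proof (Term_rename (fun k => S (S (S k))) Hn) as Hn3.
  pose proof (Term_rename (fun k => S (S k)) Hz) as Hz2.
  apply Term_the, Def_ex, Def_and; [|definable; exact Hn2].
  apply Def_and; [definable; exact Hn2|].
  apply Def_and; [definable; exact Hz2|].
  apply Def_all, Def_imp; [definable; exact Hn3|].
  apply Def_eq; [definable|].
  (* Slots 0, 1 and 2 now hold the index, the approximation and the described value; the outer
     environment starts at slot 3. *)
  apply (Term_subst (f := fun e y => G (fun k => e (S (S (S k)))) (e 0) y)
    (t := fun e => app (e 1) (e 0))); [definable|].
  exact (Term_rename
    (fun n => match n with O => 0 | S O => 1 | S (S k) => S (S (S (S k))) end) HG).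
Qed.

End NaturalNumbers.

#[global] Opaque omega rec.

Ltac definable_rec :=
  match goal with
  | |- Term (fun e => rec (@?z e) (@?G e) (@?n e)) => apply (@Term_rec _ _ z G n)
  end.
Ltac definable_hook ::= cbv beta; (definable_the || definable_binder || definable_rec).

(** * Finite and countable sets *)

Section FiniteSets.
Context {M : set_structure} {HM : ZF M}.

Lemma equipotent_intro (f : M -> M) {Hf : DefF1 f} A B :
  (forall x, x ∈ A -> f x ∈ B) ->
  (forall x x', x ∈ A -> x' ∈ A -> f x = f x' -> x = x') ->
  (forall y, y ∈ B -> exists x, x ∈ A /\ f x = y) -> equipotent A B.
Proof.
  intros H1 H2 H3; exists (lam A f); split; [|split].
  - apply lam_function; exact Hf.
  - intros x y H; rewrite maps_lam in H by exact Hf; destruct H as [Hx ->]; auto.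
  - intros y Hy; destruct (H3 y Hy) as [x [Hx E]]; exists x; split.
    + rewrite maps_lam by exact Hf; auto.
    + intros x' Hx'; rewrite maps_lam in Hx' by exact Hf.
      destruct Hx'; apply H2; auto; congruence.
Qed.

Lemma equipotent_elim A B : equipotent A B -> exists f : M,
  (forall x, x ∈ A -> app f x ∈ B) /\
  (forall x x', x ∈ A -> x' ∈ A -> app f x = app f x' -> x = x') /\
  (forall y, y ∈ B -> exists x, x ∈ A /\ app f x = y).
Proof.
  intros [f [Hf [H1 H2]]]; exists f; split; [|split].
  - intros x Hx; apply (H1 x), (app_maps Hf Hx).
  - intros x x' Hx Hx' E.
    pose proof (app_maps Hf Hx) as F; pose proof (app_maps Hf Hx') as F'.
    rewrite <- E in F'.
    destruct (H2 _ (H1 _ _ F)) as [u [_ Hu]].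
    rewrite <- (Hu _ F); exact (Hu _ F').
  - intros y Hy; destruct (H2 y Hy) as [x [Hx _]]; exists x.
    apply (maps_app _ _ Hf) in Hx; intuition auto.
Qed.

Lemma finite_iff (A : M) : finite A <-> exists n, n ∈ omega /\ equipotent A n.
Proof.
  unfold finite; split; intros [n [Hn H]]; exists n; split; auto; now apply is_nat_iff.
Qed.

Lemma finite_omega n : n ∈ omega -> finite n.
Proof.
  intro Hn; apply finite_iff; exists n; split; [exact Hn|].
  apply (equipotent_intro (f := fun x => x)); eauto.
Qed.

Lemma finite_empty : finite (empty : M).
Proof. apply finite_omega, zero_omega. Qed.

Lemma cup_sing_id x (A : M) : x ∈ A -> cup A (sing x) = A.
Proof.
  intro H; apply ext; intro z; membership; split; [intros [?| ->]; auto | auto].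
Qed.

Lemma finite_insert x (A : M) : finite A -> finite (cup A (sing x)).
Proof.
  intro HA; destruct (classic (x ∈ A)) as [Hx|Hx]; [now rewrite cup_sing_id|].
  apply finite_iff in HA as [n [Hn HA]].
  apply equipotent_elim in HA as [f [H1 [H2 H3]]].
  apply finite_iff; exists (succ n); split; [now apply succ_omega|].
  apply (equipotent_intro (f := fun y => cond (y = x) n (app f y))).
  - intros y Hy; membership in Hy; destruct (classic (y = x)) as [->|E].
    + rewrite cond_true by reflexivity; apply mem_succ.
    + rewrite cond_false by exact E; apply mem_mem_succ; destruct Hy; [auto | tauto].
  - assert (N : forall y, y ∈ A -> app f y <> n).
    { intros y Hy E; apply (@mem_irrefl _ _ n); rewrite <- E at 1; auto. }
    intros y y' Hy Hy'; membership in Hy; membership in Hy'.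
    destruct (classic (y = x)) as [E|E], (classic (y' = x)) as [E'|E'];
      rewrite ?(cond_true _ _ E), ?(cond_false _ _ E),
        ?(cond_true _ _ E'), ?(cond_false _ _ E'); intro F.
    + congruence.
    + symmetry in F; destruct Hy' as [Hy'|Hy']; [destruct (N y' Hy' F) | contradiction].
    + destruct Hy as [Hy|Hy]; [destruct (N y Hy F) | contradiction].
    + destruct Hy as [Hy|Hy], Hy' as [Hy'|Hy']; try contradiction; auto.
  - intros y Hy; membership in Hy; destruct Hy as [Hy| ->].
    + destruct (H3 y Hy) as [u [Hu E]]; exists u; membership; split; [auto|].
      rewrite cond_false; [exact E | intros ->; auto].
    + exists x; membership; split; [auto | now rewrite cond_true].
Qed.

(** Induction on the number of elements: removing the point that a bijection onto [succ n] sends to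
    [n] leaves a set equipotent to [n]. *)
Lemma finite_ind (P : M -> Prop) {HP : DefP1 P} : P empty ->
  (forall A x, finite A -> ~ x ∈ A -> P A -> P (cup A (sing x))) ->
  forall A, finite A -> P A.
Proof.
  intros H0 HS.
  assert (H : forall n, n ∈ omega -> forall A, equipotent A n -> P A).
  { apply (omega_ind (P := fun n => forall A, equipotent A n -> P A)).
    - intros A HA; apply equipotent_elim in HA as [f [H1 _]].
      replace A with empty; [exact H0|].
      symmetry; apply is_empty_iff; intros x Hx; exact (in_empty (H1 x Hx)).
    - intros n Hn IH A HA; apply equipotent_elim in HA as [f [H1 [H2 H3]]].
      destruct (H3 n (mem_succ n)) as [x [Hx E]].
      assert (HA : equipotent (diff A (sing x)) n).
      { apply (equipotent_intro (f := fun y => app f y)).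
        - intros y Hy; membership in Hy; destruct Hy as [Hy Hyx].
          pose proof (H1 y Hy) as F; membership in F; destruct F as [F|F]; [exact F|].
          destruct Hyx; apply H2; congruence.
        - intros y y' Hy Hy'; membership in Hy; membership in Hy'; apply H2; tauto.
        - intros y Hy; destruct (H3 y (mem_mem_succ Hy)) as [u [Hu F]].
          exists u; membership; split; [split; [exact Hu|]|exact F].
          intros ->; apply (@mem_irrefl _ _ n); congruence. }
      replace A with (cup (diff A (sing x)) (sing x)).
      + apply HS; [apply finite_iff; eauto | membership; tauto | auto].
      + apply ext; intro z; membership; split; [intros [[? _]| ->]; auto|].
        intro Hz; destruct (classic (z = x)); auto. }
  intros A HA; apply finite_iff in HA as [n [Hn HA]]; eauto.
Qed.

Lemma finite_subset (A B : M) : finite A -> subset B A -> finite B.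
Proof.
  intro HA; revert A HA B; apply (finite_ind (P := fun A => forall B, subset B A -> finite B)).
  - intros B HB; replace B with empty; [apply finite_empty|].
    symmetry; apply is_empty_iff; intros x Hx; exact (in_empty (HB x Hx)).
  - intros A x _ Hx IH B HB.
    assert (H : finite (diff B (sing x))).
    { apply IH; intros y Hy; membership in Hy; destruct Hy as [Hy Hyx].
      apply HB in Hy; membership in Hy; tauto. }
    destruct (classic (x ∈ B)) as [HxB|HxB].
    + replace B with (cup (diff B (sing x)) (sing x)); [now apply finite_insert|].
      apply ext; intro z; membership; split; [intros [[? _]| ->]; auto|].
      intro Hz; destruct (classic (z = x)); auto.
    + replace B with (diff B (sing x)); [exact H|].
      apply ext; intro z; membership; split; [tauto|].
      intro Hz; split; [auto | intros ->; auto].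
Qed.

Lemma finite_cup (A B : M) : finite A -> finite B -> finite (cup A B).
Proof.
  intros HA HB; revert B HB; apply (finite_ind (P := fun B => finite (cup A B))).
  - replace (cup A empty) with A; [exact HA|].
    apply ext; intro z; membership; pose proof (@in_empty _ _ z); tauto.
  - intros B x _ _ IH.
    replace (cup A (cup B (sing x))) with (cup (cup A B) (sing x)).
    + now apply finite_insert.
    + apply ext; intro z; membership; tauto.
Qed.

Lemma finite_sing (x : M) : finite (sing x).
Proof.
  apply finite_subset with (cup empty (sing x)); [apply finite_insert, finite_empty|].
  intros z; membership; auto.
Qed.

Lemma finite_image (f : M -> M) {Hf : DefF1 f} A : finite A -> finite (image A f).
Proof.
  revert A; apply (finite_ind (P := fun A => finite (image A f))).
  - apply finite_subset with empty; [apply finite_empty|].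
    intros y Hy; membership in Hy; destruct Hy as [x [Hx _]]; destruct (in_empty Hx).
  - intros A x _ _ IH; apply finite_subset with (cup (image A f) (sing (f x))).
    + now apply finite_insert.
    + intros y Hy; membership in Hy; destruct Hy as [u [Hu ->]].
      membership in Hu; membership; destruct Hu as [Hu| ->]; eauto.
Qed.

Lemma finite_pow (A : M) : finite A -> finite (pow A).
Proof.
  revert A; apply (finite_ind (P := fun A => finite (pow A))).
  - apply finite_subset with (sing empty); [apply finite_sing|].
    intros B HB; membership in HB; membership; apply is_empty_iff.
    intros x Hx; exact (in_empty (HB x Hx)).
  - intros A x _ _ IH.
    apply finite_subset with (cup (pow A) (image (pow A) (fun B => cup B (sing x)))).
    + apply finite_cup; [exact IH | apply finite_image; [definable | exact IH]].
    + intros B HB; membership in HB; membership.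
      destruct (classic (x ∈ B)) as [Hx|Hx].
      * right; exists (diff B (sing x)); split.
        -- membership; intros z Hz; membership in Hz; destruct Hz as [Hz Hzx].
           apply HB in Hz; membership in Hz; tauto.
        -- apply ext; intro z; membership; split; [|intros [[? _]| ->]; auto].
           intro Hz; destruct (classic (z = x)); auto.
      * left; intros z Hz; pose proof (HB z Hz) as H; membership in H.
        destruct H as [H| ->]; [exact H | tauto].
Qed.

Lemma finite_Union (A : M) : finite A -> (forall x, x ∈ A -> finite x) -> finite (Union A).
Proof.
  revert A; apply (finite_ind
    (P := fun A => (forall x, x ∈ A -> finite x) -> finite (Union A))).
  - intros _; apply finite_subset with empty; [apply finite_empty|].
    intros y Hy; membership in Hy; destruct Hy as [x [Hx _]]; destruct (in_empty Hx).
  - intros A x _ _ IH H.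
    apply finite_subset with (cup (Union A) x).
    + apply finite_cup; [apply IH; intros; apply H; membership; auto|].
      apply H; membership; auto.
    + intros z Hz; membership in Hz; membership; destruct Hz as [y [Hy Hz]].
      membership in Hy; destruct Hy as [Hy| ->]; eauto.
Qed.

(** A common bound without choosing the individual ones: elements are added one at a time, and
    monotonicity allows passing to the larger of two bounds. *)
Lemma finite_bound (A : M) (phi : M -> M -> Prop) {Hphi : DefP2 phi} : finite A ->
  (forall x, x ∈ A -> exists m, m ∈ omega /\ phi x m) ->
  (forall x m n, phi x m -> m ∈ succ n -> n ∈ omega -> phi x n) ->
  exists m, m ∈ omega /\ forall x, x ∈ A -> phi x m.
Proof.
  intros HA H Hmono; revert A HA H.
  apply (finite_ind (P := fun A => (forall x, x ∈ A -> exists m, m ∈ omega /\ phi x m) ->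
    exists m, m ∈ omega /\ forall x, x ∈ A -> phi x m)).
  - intros _; exists empty; split; [apply zero_omega|].
    intros x Hx; destruct (in_empty Hx).
  - intros A x _ _ IH H.
    destruct IH as [m [Hm IH]]; [intros; apply H; membership; auto|].
    destruct (H x) as [n [Hn Hx]]; [membership; auto|].
    destruct (omega_max Hm Hn) as [k [Hk [Hmk Hnk]]].
    exists k; split; [exact Hk|].
    intros y Hy; membership in Hy; destruct Hy as [Hy| ->]; eauto.
Qed.

Lemma finite_value_bound (g F : M) : finite F -> (forall x, x ∈ F -> app g x ∈ omega) ->
  exists m, m ∈ omega /\ forall x, x ∈ F -> app g x ∈ m.
Proof.
  intros HF Hg; apply (finite_bound (phi := fun x m => app g x ∈ m) HF).
  - intros x Hx; exists (succ (app g x)); split; [apply succ_omega; auto | apply mem_succ].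
  - intros x m n Hx Hmn Hn; exact (mem_succ_trans Hn Hx Hmn).
Qed.

(** A finite [omega] would have a strict upper bound [m] among its own elements, whence [m ∈ m]. *)
Lemma infinite_omega : ~ finite (omega : M).
Proof.
  intro H; destruct (finite_bound (phi := fun x m : M => x ∈ m) H) as [m [Hm Hb]].
  - intros x Hx; exists (succ x); split; [now apply succ_omega | apply mem_succ].
  - intros x m n Hx Hmn Hn; exact (mem_succ_trans Hn Hx Hmn).
  - exact (mem_irrefl (Hb m Hm)).
Qed.

(** The inverse of [f] is a definite description, which exhibits [A] as part of an image of a subset
    of [B]. *)
Lemma finite_injective (f : M -> M) {Hf : DefF1 f} A B : finite B ->
  (forall x, x ∈ A -> f x ∈ B) ->
  (forall x x', x ∈ A -> x' ∈ A -> f x = f x' -> x = x') -> finite A.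
Proof.
  intros HB H1 H2.
  apply finite_subset with
    (image (image A f) (fun y => the (fun x => x ∈ A /\ f x = y))).
  - apply finite_image; [definable|]; apply finite_subset with B; [exact HB|].
    intros y Hy; membership in Hy; destruct Hy as [x [Hx ->]]; auto.
  - intros x Hx; membership; exists (f x); split; [membership; eauto|].
    symmetry; apply the_eq; [auto|]; intros z [Hz E]; auto.
Qed.

Lemma countable_injective (f : M -> M) {Hf : DefF1 f} A :
  (forall x, x ∈ A -> f x ∈ omega) ->
  (forall x x', x ∈ A -> x' ∈ A -> f x = f x' -> x = x') -> countable A.
Proof.
  intros H1 H2; exists omega, (image A f); split; [now apply is_omega_iff|].
  split.
  - intros y Hy; membership in Hy; destruct Hy as [x [Hx ->]]; auto.
  - apply (equipotent_intro (f := f)); auto.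
    + intros x Hx; membership; eauto.
    + intros y Hy; membership in Hy; destruct Hy as [x [Hx ->]]; eauto.
Qed.

Lemma countable_elim A : countable A -> exists g : M,
  (forall x, x ∈ A -> app g x ∈ omega) /\
  (forall x x', x ∈ A -> x' ∈ A -> app g x = app g x' -> x = x').
Proof.
  intros [w [S [Hw [HS H]]]]; apply is_omega_iff in Hw; subst w.
  apply equipotent_elim in H as [g [H1 [H2 _]]]; exists g; split; [|exact H2].
  intros x Hx; auto.
Qed.

Lemma countable_omega : countable (omega : M).
Proof. apply (countable_injective (f := fun x => x)); auto. Qed.

(** All codes move up by one, which frees code 0 for the new point [A]. *)
Lemma countable_succ A : countable A -> countable (succ A).
Proof.
  intro HA; destruct (countable_elim HA) as [g [H1 H2]].
  apply (countable_injective (f := fun x => cond (x = A) empty (succ (app g x)))).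
  - intros x Hx; membership in Hx; destruct (classic (x = A)) as [E|E].
    + rewrite cond_true by exact E; apply zero_omega.
    + rewrite cond_false by exact E; apply succ_omega; apply H1; tauto.
  - assert (N : forall n : M, succ n <> empty).
    { intros n E; apply (@in_empty _ _ n); rewrite <- E; apply mem_succ. }
    intros x x' Hx Hx'; membership in Hx; membership in Hx'.
    destruct (classic (x = A)) as [E|E], (classic (x' = A)) as [E'|E'];
      rewrite ?(cond_true _ _ E), ?(cond_false _ _ E),
        ?(cond_true _ _ E'), ?(cond_false _ _ E'); intro F.
    + congruence.
    + symmetry in F; destruct (N _ F).
    + destruct (N _ F).
    + destruct Hx as [Hx|Hx], Hx' as [Hx'|Hx']; try contradiction.
      apply succ_inj in F; auto.
Qed.

(** An injection [g] into [omega] exhausts [A] by these finite pieces; the compactifications and the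
    cofinite spaces owe their finite sets to them. *)
Lemma finite_initial (g : M -> M) {Hg : DefF1 g} A m : m ∈ omega ->
  (forall x x', x ∈ A -> x' ∈ A -> g x = g x' -> x = x') ->
  finite (sep A (fun x => g x ∈ m)).
Proof.
  intros Hm H; apply (finite_injective (f := g) (B := m)).
  - now apply finite_omega.
  - intros x Hx; membership in Hx; tauto.
  - intros x x' Hx Hx'; membership in Hx; membership in Hx'; apply H; tauto.
Qed.

End FiniteSets.

(** * Arithmetic and fractions *)

Section Arithmetic.
Context {M : set_structure} {HM : ZF M}.

(** The sequence never leaves [omega], so [step] has to agree with [G] there only; this lets
    multiplication and powers be built on a relation already known on natural numbers. *)
Lemma iterates_iff (step : M -> M -> Prop) (G : M -> M) {HG : DefF1 G} z n k :
  z ∈ omega -> (forall a, a ∈ omega -> G a ∈ omega) ->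
  (forall a b, a ∈ omega -> (step a b <-> b = G a)) ->
  iterates step z n k <-> n ∈ omega /\ k = rec z (fun _ a => G a) n.
Proof.
  intros Hz Hcl Hstep.
  assert (Hrec : forall n, n ∈ omega -> rec z (fun _ a => G a) n ∈ omega).
  { apply (omega_ind (P := fun n => rec z (fun _ a => G a) n ∈ omega)).
    - rewrite rec_zero by definable; exact Hz.
    - intros i Hi IH; rewrite rec_succ by (definable || exact Hi); auto. }
  split.
  - intros [w [f [e [Hw [Hf [He [H0 [HS Hn]]]]]]]].
    apply is_omega_iff in Hw; apply is_empty_iff in He; subst w e.
    apply (maps_app _ _ Hf) in H0 as [_ H0]; apply (maps_app _ _ Hf) in Hn as [Hn ->].
    split; [exact Hn|].
    revert n Hn; apply (omega_ind (P := fun n => app f n = rec z (fun _ a => G a) n)).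
    + now rewrite rec_zero by definable.
    + intros i Hi IH; rewrite rec_succ by (definable || exact Hi).
      rewrite <- IH; apply Hstep; [rewrite IH; auto|].
      apply (HS i (succ i)); [now apply is_succ_iff| |];
        apply (app_maps Hf); auto using succ_omega.
  - intros [Hn ->].
    exists omega, (lam omega (fun i => rec z (fun _ a => G a) i)), empty.
    assert (D : DefF1 (fun i => rec z (fun _ a => G a) i)) by definable.
    rewrite is_omega_iff, is_empty_iff, !maps_lam by exact D.
    rewrite rec_zero by definable.
    repeat split; try reflexivity; try exact Hn; try apply zero_omega.
    + exact (proj1 (@lam_function _ _ omega _ D)).
    + exact (proj2 (@lam_function _ _ omega _ D)).
    + intros i j a b Hj Ha Hb; apply is_succ_iff in Hj; subst j.
      rewrite maps_lam in Ha, Hb by exact D; destruct Ha as [Hi ->], Hb as [_ ->].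
      rewrite rec_succ by (definable || exact Hi); apply Hstep; auto.
Qed.

Definition add (m n : M) := rec m (fun _ a => succ a) n.
Definition mul (m n : M) := rec empty (fun _ a => add a m) n.
Definition one : M := succ empty.
Definition exp2 (n : M) := rec one (fun _ a => add a a) n.

#[global] Instance add_def : DefF2 add.
Proof. unfold add; definable. Qed.
#[global] Instance mul_def : DefF2 mul.
Proof. unfold mul; definable. Qed.
#[global] Instance exp2_def : DefF1 exp2.
Proof. unfold exp2; definable. Qed.

Lemma add_zero m : add m empty = m.
Proof. unfold add; now rewrite rec_zero by definable. Qed.
Lemma add_succ m n : n ∈ omega -> add m (succ n) = succ (add m n).
Proof. intro Hn; unfold add; now rewrite rec_succ by (definable || exact Hn). Qed.
Lemma mul_zero m : mul m empty = empty.
Proof. unfold mul; now rewrite rec_zero by definable. Qed.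
Lemma mul_succ m n : n ∈ omega -> mul m (succ n) = add (mul m n) m.
Proof. intro Hn; unfold mul; now rewrite rec_succ by (definable || exact Hn). Qed.
Lemma exp2_zero : exp2 empty = one.
Proof. unfold exp2; now rewrite rec_zero by definable. Qed.
Lemma one_succ : one = succ empty.
Proof. reflexivity. Qed.
Lemma exp2_succ n : n ∈ omega -> exp2 (succ n) = add (exp2 n) (exp2 n).
Proof. intro Hn; unfold exp2; now rewrite rec_succ by (definable || exact Hn). Qed.

Lemma add_one m : add m one = succ m.
Proof. rewrite one_succ, add_succ, add_zero by exact zero_omega; reflexivity. Qed.

Lemma one_omega : one ∈ omega.
Proof. rewrite one_succ; apply succ_omega, zero_omega. Qed.

Lemma add_omega m n : m ∈ omega -> n ∈ omega -> add m n ∈ omega.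
Proof.
  intro Hm; revert n; apply (omega_ind (P := fun n => add m n ∈ omega)).
  - now rewrite add_zero.
  - intros n Hn IH; rewrite add_succ by exact Hn; now apply succ_omega.
Qed.

Lemma mul_omega m n : m ∈ omega -> n ∈ omega -> mul m n ∈ omega.
Proof.
  intro Hm; revert n; apply (omega_ind (P := fun n => mul m n ∈ omega)).
  - rewrite mul_zero; apply zero_omega.
  - intros n Hn IH; rewrite mul_succ by exact Hn; now apply add_omega.
Qed.

Lemma exp2_omega n : n ∈ omega -> exp2 n ∈ omega.
Proof.
  revert n; apply (omega_ind (P := fun n => exp2 n ∈ omega)).
  - rewrite exp2_zero; apply one_omega.
  - intros n Hn IH; rewrite exp2_succ by exact Hn; now apply add_omega.
Qed.

Lemma nat_add_iff m n k : m ∈ omega -> (nat_add m n k <-> n ∈ omega /\ k = add m n).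
Proof.
  intro Hm; apply (iterates_iff (G := fun a => succ a)).
  - exact Hm.
  - intros; now apply succ_omega.
  - intros; apply is_succ_iff.
Qed.

Lemma nat_mul_iff m n k : m ∈ omega -> (nat_mul m n k <-> n ∈ omega /\ k = mul m n).
Proof.
  intro Hm.
  assert (E : iterates (fun a b => nat_add a m b) empty n k <->
    n ∈ omega /\ k = mul m n).
  { apply (iterates_iff (G := fun a => add a m)).
    - apply zero_omega.
    - intros; now apply add_omega.
    - intros a b Ha; rewrite nat_add_iff by exact Ha; tauto. }
  rewrite <- E; unfold nat_mul; split.
  - intros [z [Hz H]]; apply is_empty_iff in Hz; now subst.
  - intro H; exists empty; now rewrite is_empty_iff.
Qed.

Lemma is_one_iff (o : M) : is_one o <-> o = one.
Proof.
  unfold is_one; split.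
  - intros [z [Hz Ho]]; apply is_empty_iff in Hz; apply is_succ_iff in Ho; now subst.
  - intros ->; exists empty; rewrite is_empty_iff, is_succ_iff; auto.
Qed.

Lemma nat_exp2_iff n k : nat_exp2 n k <-> n ∈ omega /\ k = exp2 n.
Proof.
  assert (E : iterates (fun a b : M => nat_add a a b) one n k <->
    n ∈ omega /\ k = exp2 n).
  { apply (iterates_iff (G := fun a => add a a)).
    - apply one_omega.
    - intros; now apply add_omega.
    - intros a b Ha; rewrite nat_add_iff by exact Ha; tauto. }
  rewrite <- E; unfold nat_exp2; split.
  - intros [o [Ho H]]; apply is_one_iff in Ho; now subst.
  - intro H; exists one; now rewrite is_one_iff.
Qed.

#[local] Opaque add mul exp2 one.

(** Natural numbers of the model as a type, to make [ring] available. *)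
Definition num : Type := {n : M | n ∈ omega}.
Implicit Types a b c d k l m n : num.

Definition value (n : num) : M := proj1_sig n.
Lemma value_omega n : value n ∈ omega.
Proof. exact (proj2_sig n). Qed.

Definition num0 : num := exist (fun x : M => x ∈ omega) empty zero_omega.
Definition num1 : num := exist (fun x : M => x ∈ omega) one one_omega.
Definition nadd m n : num := exist (fun x : M => x ∈ omega) _ (add_omega (value_omega m) (value_omega n)).
Definition nmul m n : num := exist (fun x : M => x ∈ omega) _ (mul_omega (value_omega m) (value_omega n)).

Lemma value_inj m n : value m = value n -> m = n.
Proof.
  destruct m as [m Hm], n as [n Hn]; simpl; intros ->; f_equal; apply proof_irrelevance.
Qed.

(** Induction over [num] is sound only for predicates mirrored by a definable [Q] of the model, so
    each use must exhibit one. *)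
Lemma num_ind (P : num -> Prop) (Q : M -> Prop) {HQ : DefP1 Q} :
  (forall n, P n <-> Q (value n)) ->
  P num0 -> (forall n, P n -> P (nadd n num1)) -> forall n, P n.
Proof.
  intros E H0 HS n; apply E; destruct n as [n Hn]; simpl.
  revert n Hn; apply (omega_ind (P := Q)).
  - apply (E num0), H0.
  - intros n Hn H; pose (n' := exist (fun x : M => x ∈ omega) n Hn : num).
    assert (F : succ n = value (nadd n' num1)).
    { simpl; rewrite add_one; reflexivity. }
    rewrite F; apply E, HS, E, H.
Qed.

Lemma nadd_0_r m : nadd m num0 = m.
Proof. apply value_inj, add_zero. Qed.

Lemma nadd_1_r m n : nadd m (nadd n num1) = nadd (nadd m n) num1.
Proof.
  apply value_inj; simpl.
  rewrite !add_one.
  apply add_succ, value_omega.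
Qed.

Lemma nmul_0_r m : nmul m num0 = num0.
Proof. apply value_inj, mul_zero. Qed.

Lemma nmul_1_r m n : nmul m (nadd n num1) = nadd (nmul m n) m.
Proof.
  apply value_inj; simpl; rewrite add_one.
  apply mul_succ, value_omega.
Qed.

Lemma nadd_assoc m n k : nadd m (nadd n k) = nadd (nadd m n) k.
Proof.
  revert k; apply (num_ind (Q := fun k : M => add (value m) (add (value n) k) =
    add (add (value m) (value n)) k)).
  - intro k; split; [intro H; exact (f_equal value H) | intro H; apply value_inj, H].
  - now rewrite !nadd_0_r.
  - intros k IH; now rewrite !nadd_1_r, IH.
Qed.

Lemma nadd_0_l m : nadd num0 m = m.
Proof.
  revert m; apply (num_ind (Q := fun k : M => add empty k = k)).
  - intro k; split; [intro H; exact (f_equal value H) | intro H; apply value_inj, H].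
  - now rewrite nadd_0_r.
  - intros k IH; now rewrite nadd_1_r, IH.
Qed.

Lemma nadd_comm m n : nadd m n = nadd n m.
Proof.
  assert (E : forall m, nadd m num1 = nadd num1 m).
  { apply (num_ind (Q := fun k : M => add k one = add one k)).
    - intro k; split; [intro H; exact (f_equal value H) | intro H; apply value_inj, H].
    - now rewrite nadd_0_r, nadd_0_l.
    - intros k IH; now rewrite nadd_1_r, <- IH. }
  revert n; apply (num_ind (Q := fun k : M => add (value m) k = add k (value m))).
  - intro k; split; [intro H; exact (f_equal value H) | intro H; apply value_inj, H].
  - now rewrite nadd_0_r, nadd_0_l.
  - intros k IH; rewrite nadd_1_r, IH, E, <- (nadd_assoc k num1 m), <- (E m).
    now rewrite nadd_1_r, E.
Qed.

Lemma nmul_add_r m n k : nmul m (nadd n k) = nadd (nmul m n) (nmul m k).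
Proof.
  revert k; apply (num_ind (Q := fun k : M => mul (value m) (add (value n) k) =
    add (mul (value m) (value n)) (mul (value m) k))).
  - intro k; split; [intro H; exact (f_equal value H) | intro H; apply value_inj, H].
  - now rewrite nmul_0_r, !nadd_0_r.
  - intros k IH; now rewrite nadd_1_r, !nmul_1_r, IH, nadd_assoc.
Qed.

Lemma nmul_assoc m n k : nmul m (nmul n k) = nmul (nmul m n) k.
Proof.
  revert k; apply (num_ind (Q := fun k : M => mul (value m) (mul (value n) k) =
    mul (mul (value m) (value n)) k)).
  - intro k; split; [intro H; exact (f_equal value H) | intro H; apply value_inj, H].
  - now rewrite !nmul_0_r.
  - intros k IH; now rewrite !nmul_1_r, nmul_add_r, IH.
Qed.

Lemma nmul_0_l m : nmul num0 m = num0.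
Proof.
  revert m; apply (num_ind (Q := fun k : M => mul empty k = empty)).
  - intro k; split; [intro H; exact (f_equal value H) | intro H; apply value_inj, H].
  - apply nmul_0_r.
  - intros k IH; now rewrite nmul_1_r, IH, nadd_0_r.
Qed.

Lemma nmul_add_l m n k : nmul (nadd m n) k = nadd (nmul m k) (nmul n k).
Proof.
  revert k; apply (num_ind (Q := fun k : M => mul (add (value m) (value n)) k =
    add (mul (value m) k) (mul (value n) k))).
  - intro k; split; [intro H; exact (f_equal value H) | intro H; apply value_inj, H].
  - now rewrite !nmul_0_r, nadd_0_r.
  - intros k IH; rewrite !nmul_1_r, IH, <- !nadd_assoc; f_equal.
    rewrite !nadd_assoc; f_equal; apply nadd_comm.
Qed.

Lemma nmul_1_l m : nmul num1 m = m.
Proof.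
  revert m; apply (num_ind (Q := fun k : M => mul one k = k)).
  - intro k; split; [intro H; exact (f_equal value H) | intro H; apply value_inj, H].
  - apply nmul_0_r.
  - intros k IH; now rewrite nmul_1_r, IH.
Qed.

Lemma nmul_comm m n : nmul m n = nmul n m.
Proof.
  revert n; apply (num_ind (Q := fun k : M => mul (value m) k = mul k (value m))).
  - intro k; split; [intro H; exact (f_equal value H) | intro H; apply value_inj, H].
  - now rewrite nmul_0_r, nmul_0_l.
  - intros k IH; now rewrite nmul_1_r, nmul_add_l, nmul_1_l, IH.
Qed.

Lemma num_semiring : semi_ring_theory num0 num1 nadd nmul (@eq num).
Proof.
  constructor; intros; auto using nadd_0_l, nadd_comm, nadd_assoc, nmul_1_l, nmul_0_l,
    nmul_comm, nmul_assoc, nmul_add_l.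
Qed.
Add Ring num_ring : num_semiring.

Definition lt m n := value m ∈ value n.
Definition le m n := value m ∈ value n \/ value m = value n.
Local Infix "+" := nadd.
Local Infix "*" := nmul.
Local Infix "<" := lt.
Local Infix "<=" := le.

Lemma value_succ n : value (n + num1) = succ (value n).
Proof. simpl; rewrite add_one; reflexivity. Qed.

Lemma lt_add m c : m < m + (c + num1).
Proof.
  revert c; apply (num_ind (Q := fun c : M => value m ∈ add (value m) (add c one))).
  - intro; reflexivity.
  - rewrite nadd_0_l; unfold lt; rewrite value_succ; apply mem_succ.
  - intros c IH; rewrite nadd_assoc; unfold lt; rewrite value_succ.
    apply mem_mem_succ, IH.
Qed.

Lemma lt_iff m n : m < n <-> exists c, n = m + (c + num1).
Proof.
  split; [|intros [c ->]; apply lt_add].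
  revert n.
  apply (num_ind (P := fun n => m < n -> exists c, n = m + (c + num1))
    (Q := fun n : M => value m ∈ n -> exists c : M, c ∈ omega /\
    n = add (value m) (add c one))).
  - intro n; unfold lt; split.
    + intros H L; destruct (H L) as [c ->]; exists (value c).
      split; [apply value_omega | reflexivity].
    + intros H L; destruct (H L) as [c [Hc E]]; exists (exist (fun x : M => x ∈ omega) c Hc : num).
      apply value_inj, E.
  - intro H; destruct (in_empty H).
  - intros n IH H; unfold lt in H; rewrite value_succ in H; membership in H.
    destruct H as [H|H].
    + destruct (IH H) as [c ->]; exists (c + num1); ring.
    + apply value_inj in H; subst; exists num0; ring.
Qed.

Lemma le_iff m n : m <= n <-> exists c, n = m + c.
Proof.
  unfold le; fold (m < n); rewrite lt_iff; split.
  - intros [[c ->]|E]; [eauto|apply value_inj in E; subst; exists num0; ring].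
  - intros [c ->]; destruct (zero_or_succ (value_omega c)) as [E|[c' [Hc' E]]].
    + right; simpl; now rewrite E, add_zero.
    + left; exists (exist (fun x : M => x ∈ omega) c' Hc' : num); f_equal; apply value_inj.
      now rewrite value_succ.
Qed.

Lemma lt_le_or m n : m < n \/ n <= m.
Proof.
  unfold lt, le; destruct (omega_trichotomy (value_omega m) (value_omega n)) as [H|[H|H]];
    auto.
Qed.

Lemma lt_not_le m n : m < n -> n <= m -> False.
Proof.
  intros H [H'|H'].
  - exact (omega_asym (value_omega n) H H').
  - unfold lt in H; rewrite H' in H; exact (mem_irrefl H).
Qed.

Lemma lt_le m n : m < n -> m <= n.
Proof. left; assumption. Qed.

Lemma lt_le_trans m n k : m < n -> n <= k -> m < k.
Proof.
  rewrite !lt_iff, le_iff; intros [c ->] [d ->]; exists (c + d); ring.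
Qed.

Lemma le_lt_trans m n k : m <= n -> n < k -> m < k.
Proof.
  rewrite !lt_iff, le_iff; intros [c ->] [d ->]; exists (c + d); ring.
Qed.

Lemma le_refl m : m <= m.
Proof. right; reflexivity. Qed.

Lemma le_mul m n k : m <= n -> m * k <= n * k.
Proof. rewrite !le_iff; intros [c ->]; exists (c * k); ring. Qed.

Lemma lt_mul m n k : num0 < k -> m < n -> m * k < n * k.
Proof.
  (* The two sides differ by (d + 1)(c + 1), which is the successor of the witness. *)
  rewrite !lt_iff; intros [c ->] [d ->]; exists (d * c + d + c); ring.
Qed.

Lemma lt_mul_cancel m n k : m * k < n * k -> m < n.
Proof.
  intro H; destruct (lt_le_or m n) as [L|L]; [exact L|].
  destruct (lt_not_le H (le_mul k L)).
Qed.

(** * Positive fractions and their order *)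

Definition ratio a b : M := pair (value a) (value b).

Lemma nonempty_num a : nonempty (value a) <-> num0 < a.
Proof.
  unfold lt; simpl; split; [intros [z Hz] | intro H; exists empty; exact H].
  destruct (zero_or_succ (value_omega a)) as [E|[m [Hm E]]]; rewrite E in *.
  - destruct (in_empty Hz).
  - now apply zero_mem_succ.
Qed.

Lemma is_fraction_iff (q u v : M) : is_fraction q u v <->
  exists a b, num0 < a /\ num0 < b /\ u = value a /\ v = value b /\ q = ratio a b.
Proof.
  unfold is_fraction; rewrite !is_nat_iff, is_pair_iff; split.
  - intros [Ha [Ha' [Hb [Hb' ->]]]].
    exists (exist (fun x : M => x ∈ omega) u Ha : num), (exist (fun x : M => x ∈ omega) v Hb : num); rewrite <- !nonempty_num; auto.
  - intros [a [b [Ha [Hb [-> [-> ->]]]]]]; rewrite !nonempty_num.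
    auto using value_omega.
Qed.

Lemma ratio_inj a b c d : ratio a b = ratio c d -> a = c /\ b = d.
Proof. intro E; apply pair_inj in E as [E1 E2]; split; apply value_inj; assumption. Qed.

Lemma fraction_iff q : fraction q <-> exists a b, num0 < a /\ num0 < b /\ q = ratio a b.
Proof.
  unfold fraction; split.
  - intros [u [v H]]; apply is_fraction_iff in H as [a [b H]].
    exists a, b; tauto.
  - intros [a [b H]]; exists (value a), (value b); apply is_fraction_iff.
    exists a, b; tauto.
Qed.

Lemma frac_lt_iff p q : frac_lt p q <-> exists a b c d,
  num0 < a /\ num0 < b /\ num0 < c /\ num0 < d /\
  p = ratio a b /\ q = ratio c d /\ a * d < c * b.
Proof.
  unfold frac_lt; split.
  - intros [a' [b' [c' [d' [ad [cb [H1 [H2 [H3 [H4 H5]]]]]]]]]].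
    apply is_fraction_iff in H1 as [a [b [Ha [Hb [-> [-> ->]]]]]].
    apply is_fraction_iff in H2 as [c [d [Hc [Hd [-> [-> ->]]]]]].
    apply (nat_mul_iff _ _ (value_omega _)) in H3 as [_ ->], H4 as [_ ->].
    exists a, b, c, d; auto 10.
  - intros [a [b [c [d [Ha [Hb [Hc [Hd [-> [-> H]]]]]]]]]].
    exists (value a), (value b), (value c), (value d), (value (a * d)), (value (c * b)).
    rewrite !is_fraction_iff, !(nat_mul_iff _ _ (value_omega _)).
    split; [exists a, b; auto|]; split; [exists c, d; auto|]; auto using value_omega.
Qed.

Lemma frac_le_iff p q : frac_le p q <-> exists a b c d,
  num0 < a /\ num0 < b /\ num0 < c /\ num0 < d /\
  p = ratio a b /\ q = ratio c d /\ a * d <= c * b.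
Proof.
  unfold frac_le; split.
  - intros [a' [b' [c' [d' [ad [cb [H1 [H2 [H3 [H4 H5]]]]]]]]]].
    apply is_fraction_iff in H1 as [a [b [Ha [Hb [-> [-> ->]]]]]].
    apply is_fraction_iff in H2 as [c [d [Hc [Hd [-> [-> ->]]]]]].
    apply (nat_mul_iff _ _ (value_omega _)) in H3 as [_ ->], H4 as [_ ->].
    exists a, b, c, d; auto 10.
  - intros [a [b [c [d [Ha [Hb [Hc [Hd [-> [-> H]]]]]]]]]].
    exists (value a), (value b), (value c), (value d), (value (a * d)), (value (c * b)).
    rewrite !is_fraction_iff, !(nat_mul_iff _ _ (value_omega _)).
    split; [exists a, b; auto|]; split; [exists c, d; auto|]; auto using value_omega.
Qed.

Lemma frac_add_iff p q r : frac_add p q r <-> exists a b c d,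
  num0 < a /\ num0 < b /\ num0 < c /\ num0 < d /\
  p = ratio a b /\ q = ratio c d /\ r = ratio (a * d + c * b) (b * d).
Proof.
  unfold frac_add; split.
  - intros [a' [b' [c' [d' [ad [cb [s [bd [H1 [H2 [H3 [H4 [H5 [H6 H7]]]]]]]]]]]]]].
    apply is_fraction_iff in H1 as [a [b [Ha [Hb [-> [-> ->]]]]]].
    apply is_fraction_iff in H2 as [c [d [Hc [Hd [-> [-> ->]]]]]].
    apply (nat_mul_iff _ _ (value_omega _)) in H3 as [_ ->], H4 as [_ ->], H6 as [_ ->].
    apply (nat_add_iff _ _ (value_omega (a * d))) in H5 as [_ ->].
    exists a, b, c, d; repeat (split; [assumption || reflexivity|]).
    apply is_fraction_iff in H7 as [u [v [_ [_ [Eu [Ev ->]]]]]].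
    unfold ratio; now rewrite <- Eu, <- Ev.
  - intros [a [b [c [d [Ha [Hb [Hc [Hd [-> [-> ->]]]]]]]]]].
    exists (value a), (value b), (value c), (value d), (value (a * d)), (value (c * b)),
      (value (a * d + c * b)), (value (b * d)).
    rewrite !is_fraction_iff, !(nat_mul_iff _ _ (value_omega _)),
      !(nat_add_iff _ _ (value_omega _)).
    split; [exists a, b; auto|]; split; [exists c, d; auto|].
    repeat (split; [auto using value_omega|]).
    exists (a * d + c * b), (b * d).
    apply lt_iff in Ha as [a0 ->], Hb as [b0 ->], Hc as [c0 ->], Hd as [d0 ->].
    split; [|split; [|auto]]; apply lt_iff.
    + exists (a0 * d0 + a0 + d0 + c0 * b0 + c0 + b0 + num1); ring.
    + exists (b0 * d0 + b0 + d0); ring.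
Qed.

Implicit Types p q r s : M.

Lemma frac_lt_fraction p q : frac_lt p q -> fraction p /\ fraction q.
Proof.
  rewrite frac_lt_iff, !fraction_iff; intros [a [b [c [d H]]]].
  split; [exists a, b | exists c, d]; tauto.
Qed.

(** The claim [a * f < e * b] is multiplied by the middle denominator [d], proved through
    [c * b * f], and [d] is cancelled. *)
Lemma frac_lt_trans p q r : frac_lt p q -> frac_lt q r -> frac_lt p r.
Proof.
  rewrite !frac_lt_iff.
  intros [a [b [c [d [Ha [Hb [Hc [Hd [-> [-> H1]]]]]]]]]].
  intros [c' [d' [e [f [_ [_ [He [Hf [E [-> H2]]]]]]]]]].
  apply ratio_inj in E as [<- <-].
  exists a, b, e, f; repeat (split; [assumption || reflexivity|]).
  apply (@lt_mul_cancel _ _ d).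
  replace (a * f * d) with (a * d * f) by ring.
  apply (lt_le_trans (lt_mul Hf H1)).
  replace (c * b * f) with (c * f * b) by ring.
  replace (e * b * d) with (e * d * b) by ring.
  apply le_mul, lt_le, H2.
Qed.

Lemma frac_lt_le_trans p q r : frac_lt p q -> frac_le q r -> frac_lt p r.
Proof.
  rewrite !frac_lt_iff, frac_le_iff.
  intros [a [b [c [d [Ha [Hb [Hc [Hd [-> [-> H1]]]]]]]]]].
  intros [c' [d' [e [f [_ [_ [He [Hf [E [-> H2]]]]]]]]]].
  apply ratio_inj in E as [<- <-].
  exists a, b, e, f; repeat (split; [assumption || reflexivity|]).
  apply (@lt_mul_cancel _ _ d).
  replace (a * f * d) with (a * d * f) by ring.
  apply (lt_le_trans (lt_mul Hf H1)).
  replace (c * b * f) with (c * f * b) by ring.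
  replace (e * b * d) with (e * d * b) by ring.
  apply le_mul, H2.
Qed.

Lemma frac_lt_irrefl p : ~ frac_lt p p.
Proof.
  rewrite frac_lt_iff; intros [a [b [c [d [_ [_ [_ [_ [-> [E H]]]]]]]]]].
  apply ratio_inj in E as [<- <-]; exact (lt_not_le H (le_refl _)).
Qed.

Lemma frac_lt_or_le p q : fraction p -> fraction q -> frac_lt p q \/ frac_le q p.
Proof.
  rewrite !fraction_iff, frac_lt_iff, frac_le_iff.
  intros [a [b [Ha [Hb ->]]]] [c [d [Hc [Hd ->]]]].
  destruct (lt_le_or (a * d) (c * b)) as [H|H]; [left|right].
  - exists a, b, c, d; auto 10.
  - exists c, d, a, b; auto 10.
Qed.

Lemma frac_lt_le p q : frac_lt p q -> frac_le p q.
Proof.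
  rewrite frac_lt_iff, frac_le_iff; intros [a [b [c [d H]]]].
  exists a, b, c, d; pose proof (@lt_le (a * d) (c * b)); tauto.
Qed.

Lemma positive_mul a b : num0 < a -> num0 < b -> num0 < a * b.
Proof.
  rewrite !lt_iff; intros [c ->] [d ->]; exists (c * d + c + d); ring.
Qed.

Lemma positive_add a b : num0 < a -> num0 < a + b.
Proof. rewrite !lt_iff; intros [c ->]; exists (c + b); ring. Qed.

(** The mediant lies strictly between. After cross multiplication both inequalities have the same
    difference as the given one, hence the same witness [k]. *)
Lemma frac_dense p q : frac_lt p q -> exists r, frac_lt p r /\ frac_lt r q.
Proof.
  rewrite frac_lt_iff; intros [a [b [c [d [Ha [Hb [Hc [Hd [-> [-> H]]]]]]]]]].
  exists (ratio (a + c) (b + d)); rewrite !frac_lt_iff.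
  apply lt_iff in H as [k H]; split.
  - exists a, b, (a + c), (b + d).
    repeat (split; [auto using positive_add|]).
    apply lt_iff; exists k; ring [H].
  - exists (a + c), (b + d), c, d.
    repeat (split; [auto using positive_add|]).
    apply lt_iff; exists k; ring [H].
Qed.

Lemma frac_add_lt p q s : frac_add p q s -> frac_lt p s /\ frac_lt q s.
Proof.
  rewrite frac_add_iff, !frac_lt_iff.
  intros [a [b [c [d [Ha [Hb [Hc [Hd [-> [-> ->]]]]]]]]]].
  assert (P1 : num0 < a * d + c * b) by auto using positive_add, positive_mul.
  assert (P2 : num0 < b * d) by auto using positive_mul.
  split.
  - exists a, b, (a * d + c * b), (b * d).
    repeat (split; [assumption || reflexivity|]).
    (* The cross products for the sum and for [p] differ by exactly this amount. *)
    assert (P : num0 < c * b * b) by auto using positive_mul.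
    apply lt_iff in P as [k P]; apply lt_iff; exists k.
    rewrite <- (nadd_0_l (k + num1)), <- P; ring.
  - exists c, d, (a * d + c * b), (b * d).
    repeat (split; [assumption || reflexivity|]).
    assert (P : num0 < a * d * d) by auto using positive_mul.
    apply lt_iff in P as [k P]; apply lt_iff; exists k.
    rewrite <- (nadd_0_l (k + num1)), <- P; ring.
Qed.

Lemma frac_unbounded p : fraction p -> exists q, frac_lt p q.
Proof.
  rewrite fraction_iff; intros [a [b [Ha [Hb ->]]]]; exists (ratio (a + a) b).
  apply frac_lt_iff; exists a, b, (a + a), b.
  repeat (split; [auto using positive_add|]); apply lt_mul; [exact Hb|].
  apply lt_iff in Ha as [c Ha]; apply lt_iff; exists c.
  rewrite Ha at 2; ring.
Qed.

(** * Powers of two *)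

Definition nexp n : num := exist (fun x : M => x ∈ omega) _ (exp2_omega (value_omega n)).

Lemma nexp_0 : nexp num0 = num1.
Proof. apply value_inj, exp2_zero. Qed.

Lemma nexp_succ n : nexp (n + num1) = nexp n + nexp n.
Proof. apply value_inj; simpl; rewrite add_one; apply exp2_succ, value_omega. Qed.

Lemma lt_nexp n : n < nexp n.
Proof.
  revert n; apply (num_ind (Q := fun n : M => n ∈ exp2 n)).
  - intro; reflexivity.
  - rewrite nexp_0; apply lt_iff; exists num0; ring.
  - intros n H; rewrite nexp_succ; apply lt_iff in H as [c H].
    apply lt_iff; rewrite H; exists (n + c + c); ring.
Qed.

Lemma positive_nexp n : num0 < nexp n.
Proof.
  apply le_lt_trans with n; [|apply lt_nexp].
  apply le_iff; exists n; ring.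
Qed.

Lemma nexp_lt m n : m < n -> nexp m < nexp n.
Proof.
  rewrite (lt_iff m); intros [c ->]; revert c.
  apply (num_ind (Q := fun c : M => exp2 (value m) ∈ exp2 (add (value m) (add c one)))).
  - intro; reflexivity.
  - rewrite nadd_0_l, nexp_succ; pose proof (positive_nexp m) as H.
    apply lt_iff in H as [c H]; apply lt_iff; rewrite H; exists c; ring.
  - intros c IH; rewrite nadd_assoc, nexp_succ.
    apply (lt_le_trans IH), le_iff; eauto.
Qed.

(** The rational endpoint of the cut that [half_pow] describes, namely 2 to the power -n. *)
Definition half (n : M) : M := pair one (exp2 n).

#[global] Instance half_def : DefF1 half.
Proof. unfold half; definable. Qed.

Lemma positive_1 : num0 < num1.
Proof. apply lt_iff; exists num0; ring. Qed.

Lemma half_fraction (n : M) : n ∈ omega -> fraction (half n).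
Proof.
  intro Hn; pose (n' := exist (fun x : M => x ∈ omega) n Hn : num).
  apply fraction_iff; exists num1, (nexp n').
  split; [apply positive_1|]; split; [apply positive_nexp | reflexivity].
Qed.

Lemma half_pow_iff (n r : M) : half_pow n r <->
  n ∈ omega /\ forall q, q ∈ r <-> frac_lt (half n) q.
Proof.
  unfold half_pow; split.
  - intros [o [k [h [Ho [Hk [Hh Hr]]]]]].
    apply is_one_iff in Ho; apply nat_exp2_iff in Hk as [Hn ->]; subst o.
    split; [exact Hn|].
    destruct Hh as [_ [_ [_ [_ Hh]]]]; apply is_pair_iff in Hh; subst h; exact Hr.
  - intros [Hn Hr]; exists one, (exp2 n), (half n).
    split; [now apply is_one_iff|]; split; [now apply nat_exp2_iff|].
    split; [|exact Hr].
    pose (n' := exist (fun x : M => x ∈ omega) n Hn : num).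
    apply is_fraction_iff; exists num1, (nexp n').
    repeat split; auto using positive_1, positive_nexp.
Qed.

Lemma half_lt (m n : M) : n ∈ omega -> m ∈ n -> frac_lt (half n) (half m).
Proof.
  intros Hn Hmn; pose proof (omega_mem Hn Hmn) as Hm.
  pose (n' := exist (fun x : M => x ∈ omega) n Hn : num).
  pose (m' := exist (fun x : M => x ∈ omega) m Hm : num).
  apply frac_lt_iff; exists num1, (nexp n'), num1, (nexp m').
  repeat (split; [auto using positive_1, positive_nexp|]).
  rewrite !nmul_1_l; apply nexp_lt, Hmn.
Qed.

Lemma half_lt_inv (m n : M) : m ∈ omega -> n ∈ omega ->
  frac_lt (half n) (half m) -> m ∈ n.
Proof.
  intros Hm Hn H; destruct (omega_trichotomy Hm Hn) as [L|[->|L]]; [exact L| |].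
  - destruct (frac_lt_irrefl H).
  - destruct (frac_lt_irrefl (frac_lt_trans H (half_lt Hm L))).
Qed.

(** For q = a / b the exponent b suffices, since b < 2^b ≤ a 2^b. *)
Lemma archimedean q : fraction q -> exists n : M, n ∈ omega /\ frac_lt (half n) q.
Proof.
  rewrite fraction_iff; intros [a [b [Ha [Hb ->]]]].
  exists (value b); split; [apply value_omega|].
  apply frac_lt_iff; exists num1, (nexp b), a, b.
  repeat (split; [auto using positive_1, positive_nexp|]).
  rewrite nmul_1_l; apply (lt_le_trans (lt_nexp b)).
  apply lt_iff in Ha as [c ->]; apply le_iff; exists (c * nexp b); ring.
Qed.

(** For a / b < c / d the difference is at least 1 / (b d), and 2^-n with n = b d is smaller than
    that. *)
Lemma frac_gap p q : frac_lt p q ->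
  exists n s : M, n ∈ omega /\ frac_add p (half n) s /\ frac_le s q.
Proof.
  rewrite frac_lt_iff; intros [a [b [c [d [Ha [Hb [Hc [Hd [-> [-> H]]]]]]]]]].
  pose (e := nexp (b * d)).
  assert (He : num0 < e) by apply positive_nexp.
  assert (L : b * d < e) by apply lt_nexp.
  assert (Eh : half (value (b * d)) = ratio num1 e) by reflexivity.
  clearbody e.
  exists (value (b * d)), (ratio (a * e + num1 * b) (b * e)).
  split; [apply value_omega|]; split.
  - rewrite Eh; apply frac_add_iff; exists a, b, num1, e; auto 10 using positive_1.
  - apply frac_le_iff; exists (a * e + num1 * b), (b * e), c, d.
    split; [apply positive_add, positive_mul; assumption|].
    split; [apply positive_mul; assumption|].
    repeat (split; [assumption || reflexivity|]).
    apply lt_iff in H as [k H]; apply lt_iff in L as [l L].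
    apply le_iff; exists (k * e + l + num1).
    replace (c * (b * e)) with (c * b * e) by ring.
    rewrite H; replace ((a * d + (k + num1)) * e) with (a * d * e + k * e + e) by ring.
    rewrite L at 3; ring.
Qed.

#[global] Instance nat_add_def : DefP3 (@nat_add M).
Proof. unfold nat_add, iterates, is_succ, is_omega, is_inductive, is_succ; definable. Qed.
#[global] Instance nat_mul_def : DefP3 (@nat_mul M).
Proof. unfold nat_mul, iterates, is_omega, is_inductive, is_succ; definable. Qed.
#[global] Instance is_fraction_def : DefP3 (@is_fraction M).
Proof. unfold is_fraction; definable. Qed.
#[global] Instance fraction_def : DefP1 (@fraction M).
Proof. unfold fraction; definable. Qed.
#[global] Instance frac_lt_def : DefP2 (@frac_lt M).
Proof. unfold frac_lt; definable. Qed.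
#[global] Instance frac_le_def : DefP2 (@frac_le M).
Proof. unfold frac_le; definable. Qed.
#[global] Instance frac_add_def : DefP3 (@frac_add M).
Proof. unfold frac_add; definable. Qed.

End Arithmetic.

#[global] Opaque add mul exp2 one half.

(** * Quasi-metrics *)

Section QuasiMetrics.
Context {M : set_structure} {HM : ZF M}.

Lemma fraction_pairs (q : M) : fraction q -> q ∈ cart omega omega.
Proof.
  intros [a [b [Ha [_ [Hb [_ H]]]]]]; apply is_nat_iff in Ha, Hb.
  apply is_pair_iff in H; membership; eauto.
Qed.

Lemma in_sep_fractions (P : M -> Prop) {HP : DefP1 P} q : (P q -> fraction q) ->
  q ∈ sep (cart omega omega) P <-> P q.
Proof.
  intro H; rewrite in_sep by exact HP; split; [tauto|].
  intro Hq; split; [apply fraction_pairs; auto | exact Hq].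
Qed.

Lemma dist_iff (X d x y u : M) : is_function d (cart X X) ->
  (dist d x y u <-> x ∈ X /\ y ∈ X /\ u = app d (pair x y)).
Proof.
  intro Hd; unfold dist; split.
  - intros [p [Hp H]]; apply is_pair_iff in Hp; subst p.
    apply (maps_app _ _ Hd) in H as [H ->]; membership in H.
    destruct H as [a [b [Ha [Hb E]]]]; apply pair_inj in E as [-> ->]; auto.
  - intros [Hx [Hy ->]]; exists (pair x y); split; [now apply is_pair_iff|].
    apply (maps_app _ _ Hd); split; [|reflexivity].
    membership; eauto.
Qed.

Lemma is_cartesian_cart (P A B : M) : is_cartesian P A B <-> P = cart A B.
Proof.
  assert (H : is_cartesian (cart A B) A B).
  { intro p; membership; split; intros [a [b [Ha [Hb H]]]]; exists a, b;
      rewrite is_pair_iff in *; auto. }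
  split; [|intros ->; exact H].
  intro HP; apply ext; intro p; rewrite (HP p), (H p); reflexivity.
Qed.

(** The value of the quasi-metric at [(x, y)] is the infimum of all [2 ^ (- n)]
    with [E n x y]. *)
Definition level_cut (E : M -> M -> M -> Prop) (x y : M) : M :=
  sep (cart omega omega) (fun q => exists n, n ∈ omega /\ E n x y /\ frac_lt (half n) q).

(** * Quasi-metrics from decreasing sequences of preorders *)

Section Levels.
Variables (X T : M) (E : M -> M -> M -> Prop).
Context {HE : DefP3 E}.
Hypothesis E_refl : forall n x, n ∈ omega -> x ∈ X -> E n x x.
Hypothesis E_trans : forall n x y z, n ∈ omega -> x ∈ X -> y ∈ X -> z ∈ X ->
  E n x y -> E n y z -> E n x z.
Hypothesis E_zero : forall x y, x ∈ X -> y ∈ X -> E empty x y.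
Hypothesis E_mono : forall m n x y, n ∈ omega -> m ∈ n -> x ∈ X -> y ∈ X ->
  E n x y -> E m x y.
Hypothesis E_separated : forall x y, x ∈ X -> y ∈ X ->
  (forall n, n ∈ omega -> E n x y) -> x = y.
Hypothesis E_open : forall V, V ∈ T <-> subset V X /\
  forall x, x ∈ V -> exists n, n ∈ omega /\ forall y, y ∈ X -> E n x y -> y ∈ V.

(** [lam] takes functions of one argument, so a description recovers the two coordinates from the
    pair. *)
Let d : M := lam (cart X X) (fun p =>
  the (fun u => exists x y, p = pair x y /\ u = level_cut E x y)).

Lemma in_level_cut x y q : q ∈ level_cut E x y <->
  exists n, n ∈ omega /\ E n x y /\ frac_lt (half n) q.
Proof.
  unfold level_cut; rewrite in_sep_fractions; [reflexivity | definable|].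
  intros [n [_ [_ L]]]; apply (frac_lt_fraction L).
Qed.

Lemma level_dist x y u : dist d x y u <-> x ∈ X /\ y ∈ X /\ u = level_cut E x y.
Proof.
  assert (D : DefF1 (fun p => the (fun u => exists x y, p = pair x y /\ u = level_cut E x y))).
  { unfold level_cut; definable. }
  rewrite (@dist_iff X) by exact (@lam_function _ _ _ _ D).
  split; intros [Hx [Hy ->]]; (split; [exact Hx|]); (split; [exact Hy|]);
    unfold d; rewrite app_lam by (exact D || (membership; eauto)).
  - apply the_eq; [eauto|]; intros u [x' [y' [Ep ->]]].
    apply pair_inj in Ep as [-> ->]; reflexivity.
  - symmetry; apply the_eq; [eauto|]; intros u [x' [y' [Ep ->]]].
    apply pair_inj in Ep as [-> ->]; reflexivity.
Qed.

Lemma E_le m n x y : n ∈ omega -> m ∈ succ n -> x ∈ X -> y ∈ X -> E n x y -> E m x y.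
Proof.
  intros Hn H Hx Hy HE'; membership in H; destruct H as [H| ->]; eauto.
Qed.

(** The only possible distances are 0 and powers 2^-k, so a distance strictly below 2^-n is at most
    2^-(n+1). This is the origin of the shift by one level. *)
Lemma level_lt n r x y : half_pow n r -> x ∈ X -> y ∈ X ->
  (real_lt (level_cut E x y) r <-> E (succ n) x y).
Proof.
  intros Hr Hx Hy; apply half_pow_iff in Hr as [Hn Hr]; split.
  - intros [Hs Hne].
    destruct (classic (exists q, q ∈ level_cut E x y /\ ~ q ∈ r)) as [[q [Hq Hqr]]|H].
    + rewrite in_level_cut in Hq; destruct Hq as [k [Hk [Hkxy L]]].
      rewrite Hr in Hqr.
      destruct (frac_lt_or_le (half_fraction Hn) (proj2 (frac_lt_fraction L))) as [C|C];
        [contradiction|].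
      pose proof (half_lt_inv Hn Hk (frac_lt_le_trans L C)) as Hnk.
      apply (E_le Hk); auto; apply succ_mem_succ; auto.
    + exfalso; apply Hne, subset_antisym; [|exact Hs].
      intros q Hq; apply NNPP; intro; eauto.
  - intro HS; split.
    + intros q Hq; rewrite Hr in Hq; rewrite in_level_cut; exists n.
      split; [exact Hn|]; split; [|exact Hq].
      apply (@E_mono n (succ n)); auto using succ_omega, mem_succ.
    + intro F; assert (C : half n ∈ r).
      { rewrite <- F, in_level_cut; exists (succ n).
        split; [now apply succ_omega|]; split; [exact HS|].
        apply half_lt; [now apply succ_omega | apply mem_succ]. }
      rewrite Hr in C; exact (frac_lt_irrefl C).
Qed.

Lemma level_quasi_metric : is_quasi_metric X d.
Proof.
  split; [|split; [|split; [|split]]].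
  - exists (cart X X); split; [now apply is_cartesian_cart|].
    apply lam_function; unfold level_cut; definable.
  - intros x y u Hu; rewrite level_dist in Hu; destruct Hu as [Hx [Hy ->]].
    split; [|split; [|split]].
    + intros q Hq; rewrite in_level_cut in Hq; destruct Hq as [n [_ [_ L]]].
      apply (frac_lt_fraction L).
    (* [E_zero] bounds all distances by 1, so every fraction above 1 lies in the cut. *)
    + destruct (frac_unbounded (half_fraction zero_omega)) as [q Hq].
      exists q; rewrite in_level_cut; exists empty; auto using zero_omega.
    + intros p q Hp L; rewrite in_level_cut in Hp; rewrite in_level_cut; destruct Hp as [n [Hn [Hxy H]]].
      exists n; split; [exact Hn|]; split; [exact Hxy|].
      exact (frac_lt_le_trans H L).
    + intros q Hq; rewrite in_level_cut in Hq; destruct Hq as [n [Hn [Hxy H]]].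
      destruct (frac_dense H) as [p [H1 H2]]; exists p; rewrite in_level_cut; eauto 6.
  - intros x u Hu; rewrite level_dist in Hu; destruct Hu as [Hx [_ ->]].
    intro q; rewrite in_level_cut; split.
    + intros [n [_ [_ L]]]; apply (frac_lt_fraction L).
    + intro Hq; destruct (archimedean Hq) as [n [Hn L]]; eauto.
  - intros x y z u v w s Hu Hv Hw Hs; rewrite level_dist in Hu; rewrite level_dist in Hv; rewrite level_dist in Hw.
    destruct Hu as [Hx [Hy ->]], Hv as [_ [Hz ->]], Hw as [_ [_ ->]].
    intros r Hr; apply Hs in Hr; destruct Hr as [p [q [t [Hp [Hq [Ht Hr]]]]]].
    rewrite in_level_cut in Hp; rewrite in_level_cut in Hq; rewrite in_level_cut.
    destruct Hp as [m [Hm [Hxz Lp]]], Hq as [n [Hn [Hzy Lq]]].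
    destruct (frac_add_lt Ht) as [L1 L2].
    (* At the smaller of the two levels [E_trans] applies. The distance is thus bounded by the
       larger of the two, and a sum of positive fractions exceeds both summands. *)
    destruct (omega_total Hm Hn) as [Hmn|Hmn].
    + exists m; split; [exact Hm|]; split.
      * apply (E_trans Hm Hx Hz Hy Hxz), (E_le Hn Hmn); auto.
      * exact (frac_lt_le_trans (frac_lt_trans Lp L1) Hr).
    + exists n; split; [exact Hn|]; split.
      * apply (fun H => E_trans Hn Hx Hz Hy H Hzy), (E_le Hm Hmn); auto.
      * exact (frac_lt_le_trans (frac_lt_trans Lq L2) Hr).
  - intros x y u Hu Hz; rewrite level_dist in Hu; destruct Hu as [Hx [Hy ->]].
    apply E_separated; auto; intros n Hn.
    pose proof (proj2 (Hz _) (half_fraction Hn)) as H.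
    rewrite in_level_cut in H; destruct H as [m [Hm [Hxy L]]].
    apply (@E_mono n m); auto; apply half_lt_inv; auto.
Qed.

Lemma level_topology : induced_topology X d T.
Proof.
  intro V; rewrite E_open; split; intros [HV H]; (split; [exact HV|]); intros x Hx;
    pose proof (HV _ Hx) as HxX; destruct (H x Hx) as [n Hn].
  - destruct Hn as [Hn Hball].
    assert (Hr : half_pow n (sep (cart omega omega) (fun q => frac_lt (half n) q))).
    { apply half_pow_iff; split; [exact Hn|]; intro q.
      rewrite in_sep_fractions; [reflexivity | definable|].
      intro L; apply (frac_lt_fraction L). }
    eexists n, _; split; [now apply is_nat_iff|]; split; [exact Hr|].
    intros y u Hu L; rewrite level_dist in Hu; destruct Hu as [_ [Hy ->]].
    apply (level_lt Hr) in L; auto.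
    apply Hball; [exact Hy|].
    apply (@E_mono n (succ n)); auto using succ_omega, mem_succ.
  - destruct Hn as [r [Hn [Hr Hball]]]; apply is_nat_iff in Hn.
    exists (succ n); split; [now apply succ_omega|].
    intros y Hy Hxy; apply (Hball y (level_cut E x y)).
    + apply level_dist; auto.
    + apply (level_lt Hr); auto.
Qed.

Lemma quasi_metrizable_of_levels : quasi_metrizable X T.
Proof. exists d; split; [exact level_quasi_metric | exact level_topology]. Qed.

Lemma metrizable_of_levels :
  (forall n x y, n ∈ omega -> x ∈ X -> y ∈ X -> E n x y -> E n y x) -> metrizable X T.
Proof.
  intro E_sym; exists d; split; [|exact level_topology].
  split; [exact level_quasi_metric|].
  intros x y u Hu; rewrite level_dist in Hu; rewrite level_dist; destruct Hu as [Hx [Hy ->]].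
  split; [exact Hy|]; split; [exact Hx|].
  apply ext; intro q; rewrite !in_level_cut.
  split; intros [n [Hn [H L]]]; exists n; auto.
Qed.

End Levels.

(** * Balls of a quasi-metric *)

Section Balls.
Variables (X T d : M).
Hypothesis Hd : is_quasi_metric X d.
Hypothesis HT : induced_topology X d T.

Lemma quasi_metric_function : is_function d (cart X X).
Proof.
  destruct Hd as [[P [HP H]] _]; apply is_cartesian_cart in HP; now subst.
Qed.

(** Reals are open upper cuts, so [half n ∈ app d (pair x y)] says that [y] lies
    in the ball of radius [2 ^ (- n)] about [x]. *)
Lemma ball_open n x : n ∈ omega -> x ∈ X ->
  sep X (fun y => half n ∈ app d (pair x y)) ∈ T.
Proof.
  intros Hn Hx; pose proof quasi_metric_function as Hf.
  destruct Hd as [_ [Hnn [_ [Htri _]]]].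
  apply HT; split; [intros y Hy; membership in Hy; tauto|].
  intros y Hy; membership in Hy; destruct Hy as [Hy Hxy].
  assert (D : forall a b, a ∈ X -> b ∈ X -> dist d a b (app d (pair a b))).
  { intros; apply (dist_iff _ _ _ Hf); auto. }
  destruct (Hnn _ _ _ (D x y Hx Hy)) as [_ [_ [_ Hopen]]].
  (* Openness of the cut leaves room: [p] is above the distance from [x] to [y] and below 2^-n, and
     the gap between [p] and 2^-n contains a radius 2^-k about [y]. *)
  destruct (Hopen _ Hxy) as [p [Hp L]].
  destruct (frac_gap L) as [k [s [Hk [Hs Hsn]]]].
  pose (r := sep (cart omega omega) (fun q => frac_lt (half k) q)).
  assert (Hr : half_pow k r).
  { apply half_pow_iff; split; [exact Hk|]; intro q.
    unfold r; rewrite in_sep_fractions; [reflexivity | definable|].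
    intro L'; apply (frac_lt_fraction L'). }
  exists k, r; split; [now apply is_nat_iff|]; split; [exact Hr|].
  intros z v Hv [Hv1 Hv2].
  pose proof (Hnn _ _ _ Hv) as [Hvf [_ [Hvup _]]].
  assert (Hkv : half k ∈ v).
  (* Strictness of [real_lt] provides a fraction [q] of [v] outside [r]. Then [q] is at most
     [half k], and [v] is upward closed. *)
  { destruct (classic (exists q, q ∈ v /\ ~ q ∈ r)) as [[q [Hq Hqr]]|H].
    - apply half_pow_iff in Hr as [_ Hr]; rewrite Hr in Hqr.
      apply (Hvup q); [exact Hq|].
      destruct (frac_lt_or_le (half_fraction Hk) (Hvf _ Hq)); [contradiction | assumption].
    - destruct Hv2; apply subset_antisym; [|exact Hv1].
      intros q Hq; apply NNPP; intro; eauto. }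
  assert (Hz : z ∈ X) by (apply (dist_iff _ _ _ Hf) in Hv; tauto).
  (* The triangle inequality refers to a given sum, so the sum must first exist as a set of the
     model. *)
  pose (t := sep (cart omega omega) (fun r => exists p q s, p ∈ app d (pair x y) /\
    q ∈ v /\ frac_add p q s /\ frac_le s r)).
  assert (Ht : real_add (app d (pair x y)) v t).
  { intro q; unfold t; rewrite in_sep_fractions; [reflexivity | definable|].
    intros [p' [q' [s' [_ [_ [_ Hq]]]]]].
    destruct Hq as [a [b [c [e [_ [_ [_ [Hq _]]]]]]]]; exists c, e; exact Hq. }
  pose proof (Htri _ _ _ _ _ _ _ (D x z Hx Hz) (D x y Hx Hy) Hv Ht) as Hle.
  membership; split; [exact Hz|].
  apply Hle, Ht; exists p, (half k), s; auto.
Qed.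

Lemma ball_center n x : n ∈ omega -> x ∈ X -> half n ∈ app d (pair x x).
Proof.
  intros Hn Hx; pose proof quasi_metric_function as Hf.
  destruct Hd as [_ [_ [Hz _]]].
  apply (Hz x (app d (pair x x))); [apply (dist_iff _ _ _ Hf); auto|].
  now apply half_fraction.
Qed.

Lemma balls_separate x y : x ∈ X -> y ∈ X ->
  (forall n, n ∈ omega -> half n ∈ app d (pair x y)) -> x = y.
Proof.
  intros Hx Hy H; pose proof quasi_metric_function as Hf.
  destruct Hd as [_ [Hnn [_ [_ Hs]]]].
  assert (D : dist d x y (app d (pair x y))) by (apply (dist_iff _ _ _ Hf); auto).
  apply (Hs _ _ _ D); destruct (Hnn _ _ _ D) as [H1 [_ [Hup _]]].
  intro q; split; [apply H1|]; intro Hq.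
  destruct (archimedean Hq) as [n [Hn L]].
  apply (Hup (half n)); [auto | apply frac_lt_le, L].
Qed.

End Balls.
End QuasiMetrics.

(** * Families of subsets *)

Section Families.
Context {M : set_structure} {HM : ZF M}.

Section Topology.
Variables (X T : M).
Hypothesis HT : is_topology X T.

Lemma open_subset U : U ∈ T -> subset U X.
Proof. apply HT. Qed.

Lemma open_whole : X ∈ T.
Proof. apply HT. Qed.

Lemma open_inter U V : U ∈ T -> V ∈ T -> inter U V ∈ T.
Proof.
  intros HU HV; destruct HT as [_ [_ [_ [_ H]]]]; apply (H U V); auto.
  intro z; apply in_inter.
Qed.

Lemma locally_finite_iff C : locally_finite X T C <-> family_of_subsets X C /\
  forall x, x ∈ X -> exists O, O ∈ T /\ x ∈ O /\
    finite (sep C (fun V => exists y, y ∈ V /\ y ∈ O)).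
Proof.
  split; intros [H1 H2]; (split; [exact H1|]); intros x Hx; destruct (H2 x Hx) as [N H].
  - destruct H as [[_ [O [HO [HxO HON]]]] [S [HS H]]].
    exists O; split; [exact HO|]; split; [exact HxO|].
    apply finite_subset with S; [exact HS|].
    intros V HV; membership in HV; destruct HV as [HV [y [HyV HyO]]].
    apply H; eauto.
  - destruct H as [HO [HxO HF]]; exists N; split.
    + split; [apply open_subset, HO|]; exists N; repeat split; auto; apply subset_refl.
    + eexists; split; [exact HF|]; intro V; membership; tauto.
Qed.

Lemma point_finite_iff C : point_finite X T C <-> family_of_subsets X C /\
  forall x, x ∈ X -> finite (sep C (fun V => x ∈ V)).
Proof.
  split; intros [H1 H2]; (split; [exact H1|]); intros x Hx; pose proof (H2 x Hx) as H.
  - destruct H as [S [HS H]]; apply finite_subset with S; [exact HS|].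
    intros V HV; membership in HV; now apply H.
  - eexists; split; [exact H|]; intro V; membership; tauto.
Qed.

Lemma interior_preserving_iff C : interior_preserving X T C <-> family_of_subsets X C /\
  forall x, x ∈ X -> sep X (fun y => forall U, U ∈ C -> x ∈ U -> y ∈ U) ∈ T.
Proof.
  split; intros [H1 H2]; (split; [exact H1|]); intros x Hx; pose proof (H2 x Hx) as H.
  - destruct H as [I [HI H]].
    match goal with |- ?a ∈ T => replace a with I; [exact HI|] end.
    apply ext; intro y; membership; apply H.
  - eexists; split; [exact H|]; intro y; membership; tauto.
Qed.

Lemma locally_finite_point_finite C : locally_finite X T C -> point_finite X T C.
Proof.
  rewrite locally_finite_iff, point_finite_iff; intros [H1 H2]; split; [exact H1|].
  intros x Hx; destruct (H2 x Hx) as [O [_ [HxO HF]]].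
  apply (finite_subset HF); intros V HV; membership in HV; membership.
  split; [tauto | exists x; tauto].
Qed.

(** Only the finitely many members through [x] contribute to the intersection at [x]. The induction
    runs over all finite subfamilies and keeps the guard [x ∈ U], so a member that misses [x]
    changes nothing. *)
Lemma point_finite_interior_preserving C : subset C T ->
  point_finite X T C -> interior_preserving X T C.
Proof.
  intro HC; rewrite point_finite_iff, interior_preserving_iff; intros [H1 H2].
  split; [exact H1|]; intros x Hx.
  assert (H : forall F, finite F -> subset F C ->
    sep X (fun y => forall U, U ∈ F -> x ∈ U -> y ∈ U) ∈ T).
  { apply (finite_ind (P := fun F => subset F C ->
      sep X (fun y => forall U, U ∈ F -> x ∈ U -> y ∈ U) ∈ T)).
    - intros _; match goal with |- ?a ∈ T => replace a with X; [apply open_whole|] end.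
      apply ext; intro y; membership; split; [|tauto].
      intro Hy; split; [exact Hy|]; intros U HU; destruct (in_empty HU).
    - intros F U _ _ IH HF.
      assert (HF' : subset F C) by (intros V HV; apply HF; membership; auto).
      assert (HU : U ∈ T) by (apply HC, HF; membership; auto).
      destruct (classic (x ∈ U)) as [HxU|HxU].
      + match goal with |- ?a ∈ T => replace a with
          (inter (sep X (fun y => forall U, U ∈ F -> x ∈ U -> y ∈ U)) U) end.
        * apply open_inter; auto.
        * apply ext; intro y; membership; split.
          -- intros [[Hy H] HyU]; split; [exact Hy|].
             intros V HV; membership in HV; destruct HV as [HV| ->]; auto.
          -- intros [Hy H]; split; [split; [exact Hy|]|apply H; membership; auto].
             intros V HV; apply H; membership; auto.
      + match goal with |- ?a ∈ T => replace a with
          (sep X (fun y => forall U, U ∈ F -> x ∈ U -> y ∈ U)); [auto|] end.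
        apply ext; intro y; membership; split; intros [Hy H]; (split; [exact Hy|]).
        * intros V HV; membership in HV; destruct HV as [HV| ->]; [auto|contradiction].
        * intros V HV; apply H; membership; auto. }
  match goal with |- ?a ∈ T => replace a with
    (sep X (fun y => forall U, U ∈ sep C (fun V => x ∈ V) -> x ∈ U -> y ∈ U)) end.
  - apply H; [auto|]; intros V HV; membership in HV; tauto.
  - apply ext; intro y; membership; split; intros [Hy H']; (split; [exact Hy|]);
      intros U HU HxU; apply H'; auto; [membership; auto | membership in HU; tauto].
Qed.

End Topology.

Definition meets (C D : M) : M := Union (image C (fun U => image D (fun V => inter U V))).
Definition preimages (Y : M) (f : M -> M) (C : M) : M :=
  image C (fun V => sep Y (fun y => f y ∈ V)).

#[global] Instance meets_def : DefF2 meets.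
Proof. unfold meets; definable. Qed.

Lemma in_meets C D W : W ∈ meets C D <-> exists U V, U ∈ C /\ V ∈ D /\ W = inter U V.
Proof.
  unfold meets; membership; split.
  - intros [A [HA HW]]; membership in HA; destruct HA as [U [HU ->]].
    membership in HW; destruct HW as [V [HV ->]]; eauto.
  - intros [U [V [HU [HV ->]]]]; exists (image D (fun V => inter U V)).
    membership; split; [exists U | exists V]; auto.
Qed.

Lemma in_preimages Y f {Hf : DefF1 f} C W : W ∈ preimages Y f C <->
  exists V, V ∈ C /\ W = sep Y (fun y => f y ∈ V).
Proof. unfold preimages; rewrite in_image by definable; reflexivity. Qed.

Lemma finite_meets C D : finite C -> finite D -> finite (meets C D).
Proof.
  intros HC HD; apply finite_Union.
  - apply finite_image; [definable | exact HC].
  - intros x Hx; membership in Hx; destruct Hx as [U [_ ->]].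
    apply finite_image; [definable | exact HD].
Qed.

(** The closure properties shared by local finiteness, point-finiteness and
    interior preservation, from which the product theorem follows. *)
Record family_property (P : M -> M -> M -> Prop) : Prop := {
  fp_def : DefP3 P;
  fp_subsets : forall X T C, P X T C -> family_of_subsets X C;
  fp_empty : forall X T, is_topology X T -> P X T empty;
  fp_whole : forall X T, is_topology X T -> P X T (sing X);
  fp_cup : forall X T C D, is_topology X T -> P X T C -> P X T D -> P X T (cup C D);
  fp_meets : forall X T C D, is_topology X T -> P X T C -> P X T D -> P X T (meets C D);
  fp_preimages : forall X T Y S f C, DefF1 f -> is_topology X T -> is_topology Y S ->
    (forall y, y ∈ Y -> f y ∈ X) ->
    (forall V, V ∈ T -> sep Y (fun y => f y ∈ V) ∈ S) ->
    P X T C -> P Y S (preimages Y f C)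
}.

Lemma subsets_empty X : family_of_subsets X (empty : M).
Proof. intros U HU; destruct (in_empty HU). Qed.

Lemma subsets_whole (X : M) : family_of_subsets X (sing X).
Proof. intros U HU; membership in HU; subst; apply subset_refl. Qed.

Lemma subsets_cup (X C D : M) : family_of_subsets X C -> family_of_subsets X D ->
  family_of_subsets X (cup C D).
Proof. intros HC HD U HU; membership in HU; destruct HU; auto. Qed.

Lemma subsets_meets X C D : family_of_subsets X C -> family_of_subsets X (meets C D).
Proof.
  intros HC W HW; apply in_meets in HW as [U [V [HU [_ ->]]]].
  intros z Hz; membership in Hz; apply (HC U HU); tauto.
Qed.

Lemma subsets_preimages Y f {Hf : DefF1 f} C : family_of_subsets Y (preimages Y f C).
Proof.
  intros W HW; rewrite in_preimages in HW by exact Hf; destruct HW as [V [_ ->]].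
  intros z Hz; membership in Hz; tauto.
Qed.

Lemma sep_empty (P : M -> Prop) {HP : DefP1 P} : finite (sep empty P).
Proof.
  apply (finite_subset finite_empty); intros z Hz; membership in Hz; tauto.
Qed.

Lemma sep_sing a (P : M -> Prop) {HP : DefP1 P} : finite (sep (sing a) P).
Proof.
  apply (finite_subset (finite_sing a)); intros z Hz; rewrite in_sep in Hz by exact HP; tauto.
Qed.

Lemma locally_finite_property : family_property (@locally_finite M).
Proof.
  split; [exact _ | intros X T C H; apply H| | | | |].
  - intros X T HT; rewrite (locally_finite_iff HT); split; [apply subsets_empty|].
    intros x Hx; exists X; split; [apply (open_whole HT)|]; split; [exact Hx|].
    apply sep_empty; definable.
  - intros X T HT; rewrite (locally_finite_iff HT); split; [apply subsets_whole|].
    intros x Hx; exists X; split; [apply (open_whole HT)|]; split; [exact Hx|].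
    apply sep_sing; definable.
  - intros X T C D HT; rewrite !(locally_finite_iff HT); intros [C1 C2] [D1 D2].
    split; [now apply subsets_cup|]; intros x Hx.
    destruct (C2 x Hx) as [O1 [HO1 [Hx1 F1]]], (D2 x Hx) as [O2 [HO2 [Hx2 F2]]].
    exists (inter O1 O2); split; [now apply (open_inter HT)|].
    split; [membership; auto|].
    apply (finite_subset (finite_cup F1 F2)); intros V HV; membership in HV; membership.
    destruct HV as [HV [y [HyV Hy]]]; membership in Hy.
    destruct HV; [left|right]; (split; [assumption|exists y; tauto]).
  - intros X T C D HT; rewrite !(locally_finite_iff HT); intros [C1 C2] [D1 D2].
    split; [now apply subsets_meets|]; intros x Hx.
    destruct (C2 x Hx) as [O1 [HO1 [Hx1 F1]]], (D2 x Hx) as [O2 [HO2 [Hx2 F2]]].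
    exists (inter O1 O2); split; [now apply (open_inter HT)|].
    split; [membership; auto|].
    apply (finite_subset (finite_meets F1 F2)); intros W HW.
    rewrite in_sep in HW by definable; destruct HW as [HW [y [HyW Hy]]].
    apply in_meets in HW as [U [V [HU [HV ->]]]]; membership in HyW; membership in Hy.
    apply in_meets; exists U, V; membership.
    repeat split; try assumption; exists y; tauto.
  - intros X T Y S f C Hf HT HS Hmap Hcont.
    rewrite (locally_finite_iff HT), (locally_finite_iff HS); intros [C1 C2].
    split; [now apply subsets_preimages|]; intros y Hy.
    destruct (C2 (f y) (Hmap y Hy)) as [O [HO [HyO F]]].
    exists (sep Y (fun y => f y ∈ O)); split; [auto|]; split; [membership; auto|].
    assert (D : DefF1 (fun V => sep Y (fun y => f y ∈ V))) by definable.
    (* A preimage that meets the preimage of [O] comes from a member that meets [O], and there are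
       finitely many of those. *)
    apply (finite_subset (finite_image (f := fun V => sep Y (fun y => f y ∈ V)) F)).
    intros W HW; rewrite in_sep in HW by definable; destruct HW as [HW [z [Hz1 Hz2]]].
    rewrite in_preimages in HW by exact Hf; destruct HW as [V [HV ->]].
    membership in Hz1; membership in Hz2.
    rewrite in_image by exact D; exists V; split; [|reflexivity].
    membership; split; [exact HV | exists (f z); tauto].
Qed.

Lemma point_finite_property : family_property (@point_finite M).
Proof.
  split; [exact _ | intros X T C H; apply H| | | | |].
  - intros X T HT; rewrite (@point_finite_iff X T); split; [apply subsets_empty|].
    intros x Hx; apply sep_empty; definable.
  - intros X T HT; rewrite (@point_finite_iff X T); split; [apply subsets_whole|].
    intros x Hx; apply sep_sing; definable.
  - intros X T C D HT; rewrite !(@point_finite_iff X T); intros [C1 C2] [D1 D2].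
    split; [now apply subsets_cup|]; intros x Hx.
    apply (finite_subset (finite_cup (C2 x Hx) (D2 x Hx))).
    intros V HV; membership in HV; membership; tauto.
  - intros X T C D HT; rewrite !(@point_finite_iff X T); intros [C1 C2] [D1 D2].
    split; [now apply subsets_meets|]; intros x Hx.
    apply (finite_subset (finite_meets (C2 x Hx) (D2 x Hx))); intros W HW.
    rewrite in_sep in HW by definable; destruct HW as [HW HxW].
    apply in_meets in HW as [U [V [HU [HV ->]]]]; membership in HxW.
    apply in_meets; exists U, V; membership; tauto.
  - intros X T Y S f C Hf HT HS Hmap Hcont.
    rewrite (@point_finite_iff X T), (@point_finite_iff Y S); intros [C1 C2].
    split; [now apply subsets_preimages|]; intros y Hy.
    assert (D : DefF1 (fun V => sep Y (fun y => f y ∈ V))) by definable.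
    apply (finite_subset (finite_image (f := fun V => sep Y (fun y => f y ∈ V))
      (C2 (f y) (Hmap y Hy)))).
    intros W HW; rewrite in_sep in HW by definable; destruct HW as [HW HyW].
    rewrite in_preimages in HW by exact Hf; destruct HW as [V [HV ->]].
    membership in HyW.
    rewrite in_image by exact D; exists V; split; [|reflexivity]; membership; tauto.
Qed.

Lemma interior_preserving_property : family_property (@interior_preserving M).
Proof.
  split; [exact _ | intros X T C H; apply H| | | | |].
  (* The empty family and the family of the whole space are point-finite families of open sets. *)
  - intros X T HT; apply (point_finite_interior_preserving HT).
    + intros U HU; destruct (in_empty HU).
    + apply (fp_empty point_finite_property HT).
  - intros X T HT; apply (point_finite_interior_preserving HT).
    + intros U HU; membership in HU; subst; apply (open_whole HT).
    + apply (fp_whole point_finite_property HT).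
  - intros X T C D HT; rewrite !(@interior_preserving_iff X T); intros [C1 C2] [D1 D2].
    split; [now apply subsets_cup|]; intros x Hx.
    match goal with |- ?a ∈ T => replace a with
      (inter (sep X (fun y => forall U, U ∈ C -> x ∈ U -> y ∈ U))
        (sep X (fun y => forall U, U ∈ D -> x ∈ U -> y ∈ U)));
      [apply (open_inter HT); auto|] end.
    apply ext; intro y; membership; split.
    + intros [[Hy H1] [_ H2]]; split; [exact Hy|]; intros U HU; membership in HU.
      destruct HU; auto.
    + intros [Hy H]; repeat split; auto; intros U HU; apply H; membership; auto.
  - intros X T C D HT; rewrite !(@interior_preserving_iff X T); intros [C1 C2] [D1 D2].
    split; [now apply subsets_meets|]; intros x Hx.
    (* If [x] lies in some [U] of [C] and some [V] of [D], holding one of them fixed while the other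
       factor varies shows that the intersection over [meets C D] is that of the two separate
       intersections. Otherwise no member of [meets C D] contains [x], and the intersection is
       [X]. *)
    destruct (classic ((exists U, U ∈ C /\ x ∈ U) /\ exists V, V ∈ D /\ x ∈ V))
      as [[[U [HU HxU]] [V [HV HxV]]]|N].
    + match goal with |- ?a ∈ T => replace a with
        (inter (sep X (fun y => forall U, U ∈ C -> x ∈ U -> y ∈ U))
          (sep X (fun y => forall U, U ∈ D -> x ∈ U -> y ∈ U)));
        [apply (open_inter HT); auto|] end.
      apply ext; intro y; membership; split.
      * intros [[Hy H1] [_ H2]]; split; [exact Hy|]; intros W HW.
        apply in_meets in HW as [U' [V' [HU' [HV' ->]]]]; membership.
        intros [? ?]; auto.
      * intros [Hy H].
        assert (K : forall U V, U ∈ C -> V ∈ D -> x ∈ U -> x ∈ V -> y ∈ inter U V).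
        { intros U' V' ? ? ? ?; apply H; [apply in_meets; eauto | membership; auto]. }
        repeat split; auto.
        -- intros U' HU' HxU'; pose proof (K U' V HU' HV HxU' HxV) as L.
           membership in L; tauto.
        -- intros V' HV' HxV'; pose proof (K U V' HU HV' HxU HxV') as L.
           membership in L; tauto.
    + match goal with |- ?a ∈ T => replace a with X; [apply (open_whole HT)|] end.
      apply ext; intro y; membership; split; [|tauto].
      intro Hy; split; [exact Hy|]; intros W HW HxW.
      apply in_meets in HW as [U [V [HU [HV ->]]]]; membership in HxW.
      destruct N; split; [exists U | exists V]; tauto.
  - intros X T Y S f C Hf HT HS Hmap Hcont.
    rewrite (@interior_preserving_iff X T), (@interior_preserving_iff Y S).
    intros [C1 C2]; split; [now apply subsets_preimages|]; intros y Hy.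
    (* Preimages commute with intersections: the intersection at [y] is the preimage of the one at
       [f y]. *)
    pose proof (Hcont _ (C2 (f y) (Hmap y Hy))) as H.
    match goal with |- ?a ∈ S =>
      match type of H with ?b ∈ S => replace a with b; [exact H|] end end.
    apply ext; intro z; rewrite !in_sep by definable; split; intros [Hz H'];
      (split; [exact Hz|]).
    + intros W HW HyW; rewrite in_preimages in HW by exact Hf; destruct HW as [V [HV ->]].
      membership in HyW; membership; split; [exact Hz|]; membership in H'.
      apply H'; tauto.
    + membership; split; [auto|]; intros V HV HyV.
      assert (L : z ∈ sep Y (fun y => f y ∈ V)); [|membership in L; tauto].
      apply H'; [rewrite in_preimages by exact Hf; eauto | membership; auto].
Qed.

End Families.

(** * Product spaces *)

Section Products.
Context {M : set_structure} {HM : ZF M}.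
Variables (J X T Y S : M).
Hypothesis Hfam : space_family J X T.
Hypothesis Hprod : is_product_space J X T Y S.

Lemma space_topology j : j ∈ J -> is_topology (app X j) (app T j).
Proof.
  intro Hj; destruct Hfam as [HX [HT H]].
  apply (H j); [exact (app_maps HX Hj) | exact (app_maps HT Hj)].
Qed.

Lemma in_product x : x ∈ Y <->
  is_function x J /\ forall j, j ∈ J -> app x j ∈ app X j.
Proof.
  destruct Hprod as [HY _]; destruct Hfam as [HX _]; rewrite (HY x).
  split; intros [Hx H]; (split; [exact Hx|]).
  - intros j Hj; apply (H j); [exact (app_maps HX Hj) | exact (app_maps Hx Hj)].
  - intros j A a HA Ha; apply (maps_app _ _ HX) in HA as [Hj ->].
    apply (maps_app _ _ Hx) in Ha as [_ ->]; auto.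
Qed.

(** The box is given by any set [O] read through [app] on [F]; restricting it with [lam F] recovers
    the function that the definition of the topology asks for. *)
Lemma product_open_iff U : U ∈ S <-> subset U Y /\
  forall x, x ∈ U -> exists F O, subset F J /\ finite F /\
    (forall j, j ∈ F -> app O j ∈ app T j /\ app x j ∈ app O j) /\
    forall y, y ∈ Y -> (forall j, j ∈ F -> app y j ∈ app O j) -> y ∈ U.
Proof.
  destruct Hprod as [_ HS]; destruct Hfam as [HX [HT _]].
  rewrite (HS U); split; intros [HU H]; (split; [exact HU|]); intros x Hx.
  - destruct (H x Hx) as [F [O [HF [HfF [HO [HOT [Hbox HboxU]]]]]]].
    exists F, O; split; [exact HF|]; split; [exact HfF|]; split.
    + intros j Hj; pose proof (app_maps HO Hj) as Hm; split.
      * apply (HOT j); [exact Hm | apply (app_maps HT); auto].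
      * apply (Hbox j); [exact Hm|].
        apply HU, in_product in Hx as [Hx _]; apply (app_maps Hx); auto.
    + intros y Hy Hyo; apply HboxU; [exact Hy|].
      intros j V a HV Ha; apply (maps_app _ _ HO) in HV as [Hj ->].
      apply in_product in Hy as [Hy _]; apply (maps_app _ _ Hy) in Ha as [_ ->]; auto.
  - destruct (H x Hx) as [F [O [HF [HfF [HO HboxU]]]]].
    assert (D : DefF1 (fun j => app O j)) by definable.
    exists F, (lam F (fun j => app O j)); split; [exact HF|]; split; [exact HfF|].
    split; [apply lam_function; exact D|]; split; [|split].
    + intros j V tau HV Htau; rewrite maps_lam in HV by exact D; destruct HV as [Hj ->].
      apply (maps_app _ _ HT) in Htau as [_ ->]; apply HO, Hj.
    + intros j V a HV Ha; rewrite maps_lam in HV by exact D; destruct HV as [Hj ->].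
      apply HU, in_product in Hx as [Hx _]; apply (maps_app _ _ Hx) in Ha as [_ ->].
      apply HO, Hj.
    + intros y Hy Hbox; apply HboxU; [exact Hy|]; intros j Hj.
      apply (Hbox j); [rewrite maps_lam by exact D; auto|].
      apply in_product in Hy as [Hy _]; apply (app_maps Hy); auto.
Qed.

Lemma product_topology : is_topology Y S.
Proof.
  split; [|split; [|split; [|split]]].
  - intros U HU; now apply product_open_iff in HU.
  - intros U HU; apply product_open_iff; split; intros x Hx; destruct (HU x Hx).
  - apply product_open_iff; split; [apply subset_refl|].
    intros x Hx; exists empty, empty; split; [intros j Hj; destruct (in_empty Hj)|].
    split; [apply finite_empty|]; split; [intros j Hj; destruct (in_empty Hj) | auto].
  - intros C U HC HU; apply product_open_iff; split.
    + intros x Hx; apply HU in Hx as [V [HV Hx]].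
      apply HC, product_open_iff in HV; now apply HV.
    + intros x Hx; apply HU in Hx as [V [HV Hx]].
      pose proof (HC V HV) as HVS; apply product_open_iff in HVS as [_ H].
      destruct (H x Hx) as [F [O [H1 [H2 [H3 H4]]]]]; exists F, O.
      repeat (split; [assumption|]); intros y Hy Hb; apply HU; eauto.
  - intros U V W HU HV HW; apply product_open_iff in HU as [HUY HU], HV as [_ HV].
    apply product_open_iff; split; [intros x Hx; apply HW in Hx; now apply HUY|].
    intros x Hx; apply HW in Hx as [HxU HxV].
    destruct (HU x HxU) as [F1 [O1 [A1 [B1 [C1 D1]]]]].
    destruct (HV x HxV) as [F2 [O2 [A2 [B2 [C2 D2]]]]].
    (* Off [F1] the value [app O1 j] carries no information, and likewise for [O2]; the two boxes
       are therefore intersected at common coordinates only. *)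
    pose (O j := cond (j ∈ F1)
      (cond (j ∈ F2) (inter (app O1 j) (app O2 j)) (app O1 j)) (app O2 j)).
    assert (DO : DefF1 O) by (unfold O; definable).
    assert (E : forall j, j ∈ cup F1 F2 -> forall a, a ∈ O j <->
      (j ∈ F1 -> a ∈ app O1 j) /\ (j ∈ F2 -> a ∈ app O2 j)).
    { intros j Hj a; membership in Hj; unfold O.
      destruct (classic (j ∈ F1)) as [H1|H1]; [rewrite (cond_true _ _ H1)|
        rewrite (cond_false _ _ H1); tauto].
      destruct (classic (j ∈ F2)) as [H2|H2];
        [rewrite (cond_true _ _ H2); membership | rewrite (cond_false _ _ H2)]; tauto. }
    exists (cup F1 F2), (lam (cup F1 F2) O); split; [now apply subset_cup|].
    split; [now apply finite_cup|]; split.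
    + intros j Hj; rewrite app_lam by (exact DO || exact Hj); split.
      * membership in Hj; unfold O.
        destruct (classic (j ∈ F1)) as [H1|H1]; [rewrite (cond_true _ _ H1)|
          rewrite (cond_false _ _ H1); apply C2; tauto].
        destruct (classic (j ∈ F2)) as [H2|H2];
          [rewrite (cond_true _ _ H2) | rewrite (cond_false _ _ H2)]; [|now apply C1].
        apply (open_inter (space_topology (A1 j H1))); [now apply C1 | now apply C2].
      * apply E; [exact Hj|]; split; intro H; [now apply C1 | now apply C2].
    + intros y Hy Hb.
      assert (K : forall j, j ∈ cup F1 F2 ->
        (j ∈ F1 -> app y j ∈ app O1 j) /\ (j ∈ F2 -> app y j ∈ app O2 j)).
      { intros j Hj; apply E; [exact Hj|]; specialize (Hb j Hj).
        now rewrite app_lam in Hb by (exact DO || exact Hj). }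
      apply HW; split; [apply D1 | apply D2]; auto; intros j Hj;
        apply (K j); auto; membership; auto.
Qed.

Lemma cylinder_open j V : j ∈ J -> V ∈ app T j -> sep Y (fun y => app y j ∈ V) ∈ S.
Proof.
  intros Hj HV; apply product_open_iff; split; [intros x Hx; membership in Hx; tauto|].
  intros x Hx; membership in Hx; destruct Hx as [Hx HxV].
  assert (D : DefF1 (fun _ : M => V)) by definable.
  exists (sing j), (lam (sing j) (fun _ => V)).
  split; [intros i Hi; membership in Hi; now subst|].
  split; [apply finite_sing|]; split.
  - intros i Hi; rewrite app_lam by (exact D || exact Hi); membership in Hi; subst i; auto.
  - intros y Hy Hb; membership; split; [exact Hy|].
    assert (Hi : j ∈ sing j) by (membership; reflexivity).
    specialize (Hb j Hi); now rewrite app_lam in Hb by (exact D || exact Hi).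
Qed.

Definition update (x j a : M) : M := lam J (fun i => cond (i = j) a (app x i)).

#[global] Instance update_def : DefF3 update.
Proof. unfold update; definable. Qed.

Lemma app_update x j a i : i ∈ J -> app (update x j a) i = cond (i = j) a (app x i).
Proof. intro Hi; unfold update; now rewrite app_lam by (definable || exact Hi). Qed.

Lemma app_update_eq x j a : j ∈ J -> app (update x j a) j = a.
Proof. intro Hj; rewrite app_update by exact Hj; now apply cond_true. Qed.

Lemma app_update_ne x j a i : i ∈ J -> i <> j -> app (update x j a) i = app x i.
Proof. intros Hi Hn; rewrite app_update by exact Hi; now apply cond_false. Qed.

Lemma update_product x j a : x ∈ Y -> j ∈ J -> a ∈ app X j -> update x j a ∈ Y.
Proof.
  intros Hx Hj Ha; apply in_product in Hx as [_ Hx]; apply in_product; split.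
  - apply lam_function; definable.
  - intros i Hi; destruct (classic (i = j)) as [->|E].
    + now rewrite app_update_eq.
    + rewrite app_update_ne; auto.
Qed.

(** In a basic box around [x] inside [U], changing coordinate [j] leaves all other constraints
    satisfied, so the [j]-th side of the box serves, or the whole factor if [j] is unrestricted.
    This transfers neighbourhoods from the product to one factor. *)
Lemma slice_open x j U : x ∈ U -> U ∈ S -> j ∈ J ->
  exists V, V ∈ app T j /\ app x j ∈ V /\ forall a, a ∈ V -> update x j a ∈ U.
Proof.
  intros Hx HU Hj; apply product_open_iff in HU as [HUY HU].
  destruct (HU x Hx) as [F [O [A [_ [B C]]]]].
  assert (K : forall V, subset V (app X j) -> (j ∈ F -> subset V (app O j)) ->
    forall a, a ∈ V -> update x j a ∈ U).
  { intros V HV HVO a Ha; apply C; [apply update_product; auto|].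
    intros i Hi; destruct (classic (i = j)) as [->|E].
    - rewrite app_update_eq by exact Hj; now apply HVO.
    - rewrite app_update_ne by auto; now apply B. }
  destruct (classic (j ∈ F)) as [HjF|HjF].
  - destruct (B j HjF) as [B1 B2]; exists (app O j); split; [exact B1|].
    split; [exact B2|]; apply K; [|intros _; apply subset_refl].
    apply (open_subset (space_topology Hj) B1).
  - exists (app X j); split; [apply (open_whole (space_topology Hj))|].
    split; [|apply K; [apply subset_refl | contradiction]].
    apply HUY, in_product in Hx; now apply Hx.
Qed.

End Products.

Section ProductExistence.
Context {M : set_structure} {HM : ZF M}.

Lemma product_space_exists (J X T : M) : is_function X J -> is_function T J ->
  exists Y S, is_product_space J X T Y S.
Proof.
  intros HX HT.
  assert (D1 : DefP1 (fun x => is_function x J /\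
    forall j A a, maps X j A -> maps x j a -> a ∈ A)) by definable.
  (* The spaces are elements of [Union (Union X)], so their points lie in one further union; every
     point of the product is then a subset of one cartesian product. *)
  pose (Y := sep (pow (cart J (Union (Union (Union X))))) (fun x => is_function x J /\
    forall j A a, maps X j A -> maps x j a -> a ∈ A)).
  pose (Q U := forall x, x ∈ U -> exists F O,
      subset F J /\ finite F /\ is_function O F /\
      (forall j V tau, maps O j V -> maps T j tau -> V ∈ tau) /\
      in_box O x /\ (forall y, y ∈ Y -> in_box O y -> y ∈ U)).
  assert (D2 : DefP1 Q) by (unfold Q, in_box; definable).
  exists Y, (sep (pow Y) Q); split.
  - intro x; unfold Y; rewrite in_sep by exact D1; split; [tauto|].
    intros [Hx H]; split; [|auto]; membership; intros p Hp.
    destruct (proj1 Hx p Hp) as [j [a [Hj E]]]; apply is_pair_iff in E; subst p.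
    rewrite in_cart; exists j, a; split; [exact Hj|]; split; [|reflexivity].
    assert (Ha : a ∈ app X j).
    { apply (H j); [exact (app_maps HX Hj) | now apply maps_iff]. }
    rewrite in_Union; exists (app X j); split; [exact (app_Union_Union HX Hj) | exact Ha].
  - intro U; rewrite in_sep by exact D2; membership; reflexivity.
Qed.

End ProductExistence.

(** * Bases of products *)

Section SigmaBases.
Context {M : set_structure} {HM : ZF M}.

(** The pieces of the decomposition lie inside the base, hence consist of open sets; so the
    implication between the properties may assume openness. *)
Lemma sigma_weaken (P Q : M -> M -> M -> Prop) X T B :
  (forall C, subset C T -> P X T C -> Q X T C) ->
  sigma_base P X T B -> sigma_base Q X T B.
Proof.
  intros H [[HB HB'] [K [D [HK [HD [HP HU]]]]]]; split; [split; assumption|].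
  exists K, D; repeat (split; [assumption|]); split; [|exact HU].
  intros k C HC; apply H; [|exact (HP k C HC)].
  intros V HV; apply HB, HU; eauto.
Qed.

Definition section (R m : M) : M := sep (Union (Union R)) (fun V => pair m V ∈ R).

#[global] Instance section_def : DefF2 section.
Proof. unfold section; definable. Qed.

Lemma in_section R m V : V ∈ section R m <-> pair m V ∈ R.
Proof.
  unfold section; rewrite in_sep by definable; split; [tauto|].
  intro H; split; [exact (pair_Union_Union H) | exact H].
Qed.

(** Encoding the [n]-th families as the sections of a relation makes the union
    of finitely many decompositions a decomposition again. *)
Definition decomposition (P : M -> M -> M -> Prop) (X T B R : M) : Prop :=
  (forall m, m ∈ omega -> P X T (section R m)) /\
  forall V, V ∈ B <-> exists m, m ∈ omega /\ V ∈ section R m.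

(** An injection carries the index set [K] into [omega], and numbers that code no index receive the
    empty family. The bound by a powerset matters: all decompositions of a base form a set, to which
    multiple choice can be applied. *)
Lemma sigma_decomposition P X T B : family_property P -> is_topology X T ->
  sigma P X T B -> exists R, R ∈ pow (cart omega (pow X)) /\ decomposition P X T B R.
Proof.
  intros FP HT [K [D [HK [HD [HP HU]]]]].
  destruct (countable_elim HK) as [g [Hg Hinj]].
  pose (Q p := exists k V, k ∈ K /\ p = pair (app g k) V /\ V ∈ app D k).
  assert (DQ : DefP1 Q) by (unfold Q; definable).
  assert (HR : forall k V, k ∈ K ->
    (pair (app g k) V ∈ sep (cart omega (pow X)) Q <-> V ∈ app D k)).
  { intros k V Hk; rewrite in_sep by exact DQ; membership; split.
    - intros [_ [k' [V' [Hk' [E HV]]]]]; apply pair_inj in E as [E ->].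
      apply Hinj in E; auto; now subst.
    - intro HV; split; [|exists k, V; auto].
      exists (app g k), V; split; [auto|]; split; [|reflexivity]; membership.
      apply (fp_subsets FP (HP k _ (app_maps HD Hk))), HV. }
  exists (sep (cart omega (pow X)) Q); split; [|split].
  - membership; intros p Hp; rewrite in_sep in Hp by exact DQ; tauto.
  - intros m Hm; destruct (classic (exists k, k ∈ K /\ app g k = m)) as [[k [Hk <-]]|N].
    + replace (section _ _) with (app D k); [exact (HP k _ (app_maps HD Hk))|].
      apply ext; intro V; rewrite in_section; symmetry; apply HR, Hk.
    + replace (section _ _) with (empty : M); [apply (fp_empty FP HT)|].
      symmetry; apply is_empty_iff; intros V HV; rewrite in_section in HV.
      rewrite in_sep in HV by exact DQ; destruct HV as [_ [k [V' [Hk [E _]]]]].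
      apply pair_inj in E as [E _]; apply N; eauto.
  - intro V; rewrite HU; split.
    + intros [k [C [HC HV]]]; apply (maps_app _ _ HD) in HC as [Hk ->].
      exists (app g k); split; [auto|]; rewrite in_section; now apply HR.
    + intros [m [_ HV]]; rewrite in_section in HV.
      pose proof HV as HV'; rewrite in_sep in HV' by exact DQ.
      destruct HV' as [_ [k [V' [Hk [E HV']]]]]; apply pair_inj in E as [-> ->].
      exists k, (app D k); split; [exact (app_maps HD Hk) | exact HV'].
Qed.

Lemma section_Union F m V : V ∈ section (Union F) m <->
  exists R, R ∈ F /\ V ∈ section R m.
Proof.
  rewrite in_section; membership.
  split; intros [R [HR H]]; exists R; (split; [exact HR|]); now apply in_section.
Qed.

(** Each section of a union of relations is the union of their sections, so closure under binary
    unions suffices, by induction on [F]. *)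
Lemma section_Union_property P X T F m : family_property P -> is_topology X T ->
  finite F -> (forall R, R ∈ F -> P X T (section R m)) -> P X T (section (Union F) m).
Proof.
  intros FP HT; pose proof (fp_def FP) as DP; revert F.
  apply (finite_ind (P := fun F => (forall R, R ∈ F -> P X T (section R m)) ->
    P X T (section (Union F) m))).
  - intros _; replace (section _ _) with (empty : M); [apply (fp_empty FP HT)|].
    symmetry; apply is_empty_iff; intros V HV; apply section_Union in HV as [R [HR _]].
    destruct (in_empty HR).
  - intros F R _ _ IH H.
    replace (section (Union (cup F (sing R))) m)
      with (cup (section (Union F) m) (section R m)).
    + apply (fp_cup FP HT); [apply IH; intros|]; apply H; membership; auto.
    + apply ext; intro V; membership; rewrite !section_Union; split.
      * intros [[R' [HR' HV]]|HV]; [exists R' | exists R]; membership; auto.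
      * intros [R' [HR' HV]]; membership in HR'; destruct HR' as [HR'| ->]; eauto.
Qed.

(** * Boxes built from increasing families in the factors *)

Section ProductBase.
Variables (P : M -> M -> M -> Prop) (X T Y S : M) (L : M -> M -> M).
Hypothesis FP : family_property P.
Hypothesis Hfam : space_family omega X T.
Hypothesis Hprod : is_product_space omega X T Y S.
Context {HL : DefF2 L}.
Hypothesis L_property : forall n m, n ∈ omega -> m ∈ omega ->
  P (app X n) (app T n) (L n m).
Hypothesis L_open : forall n m, n ∈ omega -> m ∈ omega -> subset (L n m) (app T n).
Hypothesis L_whole : forall n m, n ∈ omega -> m ∈ omega -> app X n ∈ L n m.
Hypothesis L_mono : forall n m m', n ∈ omega -> m' ∈ omega -> m ∈ succ m' ->
  subset (L n m) (L n m').
Hypothesis L_base : forall n U x, n ∈ omega -> U ∈ app T n -> x ∈ U ->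
  exists m V, m ∈ omega /\ V ∈ L n m /\ x ∈ V /\ subset V U.

Let HY : is_topology Y S := product_topology Hfam Hprod.

(** Boxes that restrict the coordinates below [k], each by a member of level [m]. Recursion on [k]
    adds one coordinate by a preimage and pairwise intersections, the operations under which a
    [family_property] is closed. *)
Definition boxes (m k : M) : M :=
  rec (sing Y) (fun k C => meets C (preimages Y (fun y => app y k) (L k m))) k.

#[local] Instance boxes_def : DefF2 boxes.
Proof. unfold boxes, preimages; definable. Qed.

Lemma boxes_step_def m :
  DefF2 (fun k C => meets C (preimages Y (fun y => app y k) (L k m))).
Proof. unfold preimages; definable. Qed.

Lemma boxes_zero m : boxes m empty = sing Y.
Proof. unfold boxes; now rewrite rec_zero by apply boxes_step_def. Qed.

Lemma in_boxes_succ m k W : k ∈ omega -> (W ∈ boxes m (succ k) <->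
  exists U V, U ∈ boxes m k /\ V ∈ L k m /\
    W = inter U (sep Y (fun y => app y k ∈ V))).
Proof.
  intro Hk; unfold boxes at 1; rewrite rec_succ by (apply boxes_step_def || exact Hk).
  fold (boxes m k); rewrite in_meets; split.
  - intros [U [W' [HU [HW' ->]]]]; rewrite in_preimages in HW' by definable.
    destruct HW' as [V [HV ->]]; eauto.
  - intros [U [V [HU [HV ->]]]]; exists U, (sep Y (fun y => app y k ∈ V)).
    split; [exact HU|]; split; [|reflexivity].
    rewrite in_preimages by definable; eauto.
Qed.

Lemma boxes_property m k : m ∈ omega -> k ∈ omega -> P Y S (boxes m k).
Proof.
  intros Hm; pose proof (fp_def FP) as DP; revert k.
  apply (omega_ind (P := fun k => P Y S (boxes m k))).
  - rewrite boxes_zero; apply (fp_whole FP HY).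
  - intros k Hk IH; unfold boxes; rewrite rec_succ by (apply boxes_step_def || exact Hk).
    fold (boxes m k); apply (fp_meets FP HY IH).
    apply (fp_preimages FP (X := app X k) (T := app T k)); auto.
    + definable.
    + apply (space_topology Hfam Hk).
    + intros y Hy; apply (in_product Hfam Hprod) in Hy; now apply Hy.
    + intros V HV; exact (cylinder_open Hfam Hprod Hk HV).
Qed.

Lemma boxes_open m k : m ∈ omega -> k ∈ omega -> subset (boxes m k) S.
Proof.
  intros Hm; revert k; apply (omega_ind (P := fun k => subset (boxes m k) S)).
  - intros U HU; rewrite boxes_zero in HU; membership in HU; subst; apply (open_whole HY).
  - intros k Hk IH W HW; apply (in_boxes_succ _ _ Hk) in HW as [U [V [HU [HV ->]]]].
    apply (open_inter HY); [auto|].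
    apply (cylinder_open Hfam Hprod Hk), (L_open Hk Hm HV).
Qed.

Lemma boxes_mono_level m m' k : m' ∈ omega -> m ∈ succ m' -> k ∈ omega ->
  subset (boxes m k) (boxes m' k).
Proof.
  intros Hm' Hm; revert k.
  apply (omega_ind (P := fun k => subset (boxes m k) (boxes m' k))).
  - rewrite !boxes_zero; apply subset_refl.
  - intros k Hk IH W HW; apply (in_boxes_succ _ _ Hk) in HW as [U [V [HU [HV ->]]]].
    apply (in_boxes_succ _ _ Hk); exists U, V; split; [auto|]; split; [|reflexivity].
    apply (L_mono Hk Hm' Hm HV).
Qed.

(** Every level contains the whole factor, so a box may be regarded as restricting further
    coordinates trivially. *)
Lemma boxes_mono_coordinate m k k' : m ∈ omega -> k' ∈ omega -> k ∈ succ k' ->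
  subset (boxes m k) (boxes m k').
Proof.
  intros Hm Hk'; revert k' Hk' k.
  apply (omega_ind (P := fun k' => forall k, k ∈ succ k' ->
    subset (boxes m k) (boxes m k'))).
  - intros k Hk; membership in Hk; destruct Hk as [Hk| ->]; [destruct (in_empty Hk)|].
    apply subset_refl.
  - intros k' Hk' IH k Hk; rewrite in_succ in Hk.
    destruct Hk as [Hk| ->]; [|apply subset_refl].
    intros W HW; apply (IH k Hk) in HW.
    apply (in_boxes_succ _ _ Hk'); exists W, (app X k').
    split; [exact HW|]; split; [auto|].
    apply ext; intro y; membership; split; [|tauto].
    intro Hy; assert (HyY : y ∈ Y) by exact (open_subset HY (boxes_open Hm Hk' HW) Hy).
    repeat split; auto.
    apply (in_product Hfam Hprod) in HyY; now apply HyY.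
Qed.

(** The sides are found one coordinate at a time by an induction inside the model, so no choice is
    made. Coordinates outside [F] get the whole factor, and monotonicity in the level brings old and
    new sides to a common level. *)
Lemma boxes_refine F O x k : x ∈ Y -> k ∈ omega ->
  (forall j, j ∈ F -> j ∈ omega /\ app O j ∈ app T j /\ app x j ∈ app O j) ->
  exists m W, m ∈ omega /\ W ∈ boxes m k /\ x ∈ W /\
    forall y j, y ∈ W -> j ∈ k -> j ∈ F -> app y j ∈ app O j.
Proof.
  intros Hx Hk HF; revert k Hk.
  apply (omega_ind (P := fun k => exists m W, m ∈ omega /\ W ∈ boxes m k /\ x ∈ W /\
    forall y j, y ∈ W -> j ∈ k -> j ∈ F -> app y j ∈ app O j)).
  - exists empty, Y; rewrite boxes_zero; membership.
    repeat split; auto using zero_omega.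
    intros y j _ Hj; destruct (in_empty Hj).
  - intros k Hk [m [W [Hm [HW [HxW H]]]]].
    assert (HV : exists m' V, m' ∈ omega /\ V ∈ L k m' /\ app x k ∈ V /\
      (k ∈ F -> subset V (app O k))).
    { destruct (classic (k ∈ F)) as [HkF|HkF].
      - destruct (HF k HkF) as [_ [H1 H2]].
        destruct (L_base Hk H1 H2) as [m' [V [? [? [? ?]]]]]; exists m', V; auto.
      - exists empty, (app X k); split; [apply zero_omega|].
        split; [apply L_whole; auto using zero_omega|]; split; [|contradiction].
        apply (in_product Hfam Hprod) in Hx; now apply Hx. }
    destruct HV as [m' [V [Hm' [HV [HxV HVO]]]]].
    destruct (omega_max Hm Hm') as [N [HN [HmN Hm'N]]].
    exists N, (inter W (sep Y (fun y => app y k ∈ V))).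
    split; [exact HN|]; split; [|split].
    + apply (in_boxes_succ _ _ Hk); exists W, V.
      split; [apply (boxes_mono_level HN HmN Hk HW)|]; split; [|reflexivity].
      apply (L_mono Hk HN Hm'N HV).
    + membership; auto.
    + intros y j Hy Hj HjF; membership in Hy; membership in Hj.
      destruct Hj as [Hj| ->]; [apply H; tauto | apply HVO; tauto].
Qed.

Lemma product_sigma_base : exists B, sigma_base P Y S B.
Proof.
  pose (B := sep S (fun U => exists k, k ∈ omega /\ U ∈ boxes k k)).
  assert (D : DefF1 (fun k => boxes k k)) by definable.
  exists B; split; [split|].
  - intros U HU; unfold B in HU; membership in HU; tauto.
  - intros U x HU Hx; pose proof HU as HU'.
    apply (product_open_iff Hfam Hprod) in HU' as [HUY H].
    destruct (H x Hx) as [F [O [HFw [HF [HO Hbox]]]]].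
    destruct (finite_bound (phi := fun j m => j ∈ m) HF) as [k [Hk Hb]].
    { intros j Hj; exists (succ j); split; [apply succ_omega; auto | apply mem_succ]. }
    { intros j m n Hj Hm Hn; exact (mem_succ_trans Hn Hj Hm). }
    assert (HF' : forall j, j ∈ F ->
      j ∈ omega /\ app O j ∈ app T j /\ app x j ∈ app O j).
    { intros j Hj; split; [auto | apply HO, Hj]. }
    destruct (boxes_refine (HUY x Hx) Hk HF') as [m [W [Hm [HW [HxW HWO]]]]].
    pose proof (boxes_open Hm Hk HW) as HWS.
    exists W; split; [|split; [exact HxW|]].
    + unfold B; membership; split; [exact HWS|].
      (* Raising the level and the number of coordinates to the same [N] places the box on the
         diagonal, so one index enumerates the base. *)
      destruct (omega_max Hm Hk) as [N [HN [HmN HkN]]]; exists N; split; [exact HN|].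
      apply (boxes_mono_coordinate HN HN HkN), (boxes_mono_level HN HmN Hk HW).
    + intros y Hy; apply Hbox; [exact (open_subset HY HWS Hy)|].
      intros j Hj; apply (HWO y j Hy); auto.
  - exists omega, (lam omega (fun k => boxes k k)).
    split; [apply countable_omega|]; split; [apply lam_function; exact D|]; split.
    + intros k C HC; rewrite maps_lam in HC by exact D; destruct HC as [Hk ->].
      now apply boxes_property.
    + intro V; unfold B; membership; split.
      * intros [_ [k [Hk HV]]]; exists k, (boxes k k).
        rewrite maps_lam by exact D; auto.
      * intros [k [C [HC HV]]]; rewrite maps_lam in HC by exact D; destruct HC as [Hk ->].
        split; [exact (boxes_open Hk Hk HV) | eauto].
Qed.

End ProductBase.

Lemma CMC_product_base P : family_property P -> CMC M ->
  countable_products_have_sigma_base P.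
Proof.
  intros FP HC w X T Hw Hfam [Bs [HBs Hbase]] Y S Hprod.
  apply is_omega_iff in Hw; subst w.
  pose proof (fp_def FP) as DP.
  assert (Hb : forall n, n ∈ omega -> sigma_base P (app X n) (app T n) (app Bs n)).
  { intros n Hn; destruct Hfam as [HX [HT _]].
    apply (Hbase n); apply (fun H => app_maps H Hn); assumption. }
  (* The sets offered to multiple choice: all decompositions of the given base of the [n]-th
     factor. *)
  pose (W n := sep (pow (cart omega (pow (app X n))))
    (fun R => decomposition P (app X n) (app T n) (app Bs n) R)).
  assert (DR : forall n, DefP1 (fun R => decomposition P (app X n) (app T n) (app Bs n) R)).
  { intro n; unfold decomposition; definable. }
  assert (DW : DefF1 W) by (unfold W, decomposition; definable).
  destruct (HC omega (lam omega W)) as [f [Hf Hchoice]].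
  { split; [apply infinite_omega | apply countable_omega]. }
  { apply lam_function; exact DW. }
  { intros n A HA; rewrite maps_lam in HA by exact DW; destruct HA as [Hn ->].
    destruct (sigma_decomposition FP (space_topology Hfam Hn) (proj2 (Hb n Hn)))
      as [R HR].
    exists R; unfold W; rewrite in_sep by apply DR; exact HR. }
  assert (Hchosen : forall n, n ∈ omega -> nonempty (app f n) /\ finite (app f n) /\
    forall R, R ∈ app f n -> decomposition P (app X n) (app T n) (app Bs n) R).
  { intros n Hn; destruct (Hchoice n (W n) (app f n)) as [H1 [H2 H3]].
    - rewrite maps_lam by exact DW; auto.
    - exact (app_maps Hf Hn).
    - split; [exact H1|]; split; [exact H2|]; intros R HR.
      apply H3 in HR; unfold W in HR; rewrite in_sep in HR by apply DR; tauto. }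
  (* The finitely many chosen candidates decompose the same base, so their union decomposes it too;
     being canonical, it is a uniform selection of one decomposition per factor. *)
  assert (Hdec : forall n, n ∈ omega ->
    decomposition P (app X n) (app T n) (app Bs n) (Union (app f n))).
  { intros n Hn; destruct (Hchosen n Hn) as [[R0 HR0] [Hfin H]]; split.
    - intros m Hm; apply (section_Union_property FP (space_topology Hfam Hn) Hfin).
      intros R HR; now apply H.
    - intro V; rewrite (proj2 (H R0 HR0) V); split.
      + intros [m [Hm HV]]; exists m; rewrite section_Union; eauto.
      + intros [m [Hm HV]]; apply section_Union in HV as [R [HR HV]].
        apply (H R0 HR0), (H R HR); eauto. }
  (* Levels must increase, so level [m] collects all sections up to [m]; the whole factor is added
     below so that a coordinate can be left unrestricted. *)
  pose (L0 n m := sep (app Bs n) (fun U => exists i, i ∈ succ m /\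
    U ∈ section (Union (app f n)) i)).
  assert (DL0 : DefF2 L0) by (unfold L0; definable).
  pose (L n m := cup (L0 n m) (sing (app X n))).
  assert (DL : DefF2 L) by (unfold L, L0; definable).
  apply (@product_sigma_base P X T Y S L); auto.
  - intros n m Hn Hm; pose proof (space_topology Hfam Hn) as HT.
    apply (fp_cup FP HT); [|apply (fp_whole FP HT)].
    destruct (Hdec n Hn) as [Hd1 Hd2].
    (* The number of collected sections may be nonstandard, so closure under unions is iterated by
       induction in the model. *)
    revert m Hm; apply (omega_ind (P := fun m => P (app X n) (app T n) (L0 n m))).
    + replace (L0 n empty) with (section (Union (app f n)) empty).
      * apply Hd1, zero_omega.
      * apply ext; intro V; unfold L0; membership; split.
        -- intro HV; split; [apply Hd2; eauto using zero_omega|].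
           exists empty; split; [apply mem_succ | exact HV].
        -- intros [_ [i [Hi HV]]]; membership in Hi.
           destruct Hi as [Hi| ->]; [destruct (in_empty Hi) | exact HV].
    + intros m Hm IH.
      replace (L0 n (succ m)) with (cup (L0 n m) (section (Union (app f n)) (succ m))).
      * apply (fp_cup FP HT IH), Hd1, succ_omega, Hm.
      * apply ext; intro V; unfold L0; membership; split.
        -- intros [[HV [i [Hi HVi]]]|HV].
           ++ split; [exact HV|]; exists i; split; [|exact HVi].
              now apply mem_mem_succ.
           ++ split; [apply Hd2; eauto using succ_omega|].
              exists (succ m); split; [apply mem_succ | exact HV].
        -- intros [HV [i [Hi HVi]]]; rewrite in_succ in Hi.
           destruct Hi as [Hi| ->]; [left; eauto | right; exact HVi].
  - intros n m Hn Hm V HV; unfold L, L0 in HV; membership in HV.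
    destruct HV as [[HV _]| ->].
    + destruct (Hb n Hn) as [[HbT _] _]; auto.
    + apply (open_whole (space_topology Hfam Hn)).
  - intros n m Hn Hm; unfold L; membership; auto.
  - intros n m m' Hn Hm' Hm V HV; unfold L, L0 in *; membership in HV; membership.
    destruct HV as [[HV [i [Hi HVi]]]| ->]; [left|right; reflexivity].
    split; [exact HV|]; exists i; split; [|exact HVi].
    exact (succ_trans Hm' Hi Hm).
  - intros n U x Hn HU Hx; destruct (Hb n Hn) as [[_ Hbn] _].
    destruct (Hbn U x HU Hx) as [V [HV [HxV HVU]]].
    pose proof HV as HV'; apply (Hdec n Hn) in HV' as [m [Hm HVm]].
    exists m, V; split; [exact Hm|]; split; [|auto].
    unfold L, L0; membership; left; split; [exact HV|].
    exists m; split; [apply mem_succ | exact HVm].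
Qed.

(** One argument for all three versions: the bases of the factors are weakened from locally finite
    to [P], and the base of the product from [P] to interior-preserving. *)
Lemma product_base_interior_preserving (P : M -> M -> M -> Prop) :
  (forall X T C, is_topology X T -> subset C T -> locally_finite X T C -> P X T C) ->
  (forall X T C, is_topology X T -> subset C T -> P X T C -> interior_preserving X T C) ->
  countable_products_have_sigma_base P ->
  compact_metrizable_products_have_sigma_ip_base M.
Proof.
  intros H1 H2 H w X T Hw Hfam _ [Bs [HBs Hbase]] Y S Hprod.
  pose proof Hw as Hw'; apply is_omega_iff in Hw'; subst w.
  destruct (H omega X T Hw Hfam) with (Y := Y) (S := S) as [B HB]; [|exact Hprod|].
  - exists Bs; split; [exact HBs|]; intros j A tau B HA Htau HB.
    apply sigma_weaken with (@locally_finite M); [|exact (Hbase j A tau B HA Htau HB)].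
    intros C; apply H1; destruct Hfam as [_ [_ Hfam]]; exact (Hfam j A tau HA Htau).
  - exists B; apply sigma_weaken with P; [|exact HB].
    intro C; apply H2, (product_topology Hfam Hprod).
Qed.

End SigmaBases.

(** * One-point compactifications *)

Section Compactification.
Context {M : set_structure} {HM : ZF M}.

Lemma countable_empty : countable (empty : M).
Proof.
  apply (countable_injective (f := fun x => x)); [intros x Hx | intros x x' Hx];
    destruct (in_empty Hx).
Qed.

Lemma finite_family_locally_finite (X T C : M) : is_topology X T -> subset C T ->
  finite C -> locally_finite X T C.
Proof.
  intros HT HC HF; apply (locally_finite_iff HT); split.
  - intros U HU; exact (open_subset HT (HC U HU)).
  - intros x Hx; exists X; split; [apply (open_whole HT)|]; split; [exact Hx|].
    apply (finite_subset HF); intros V HV; membership in HV; tauto.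
Qed.

(** The one-point compactification of the discrete space [A]; by foundation [A]
    itself can serve as the point at infinity. *)
Definition compactification (A : M) : M :=
  sep (pow (succ A)) (fun U => A ∈ U -> finite (diff A U)).

(** All singletons in [A] and all open neighbourhoods of infinity. Being canonical, these bases form
    a family over all factors without choice. *)
Definition compactification_base (A : M) : M :=
  sep (compactification A) (fun V => (exists x, x ∈ A /\ V = sing x) \/ A ∈ V).

#[global] Instance compactification_def : DefF1 compactification.
Proof. unfold compactification; definable. Qed.
#[global] Instance compactification_base_def : DefF1 compactification_base.
Proof. unfold compactification_base; definable. Qed.

Lemma in_compactification A U : U ∈ compactification A <->
  subset U (succ A) /\ (A ∈ U -> finite (diff A U)).
Proof. unfold compactification; membership; reflexivity. Qed.

Lemma compactification_topology A : is_topology (succ A) (compactification A).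
Proof.
  split; [|split; [|split; [|split]]].
  - intros U HU; now apply in_compactification in HU.
  - intros U HU; apply in_compactification; split.
    + intros x Hx; destruct (HU x Hx).
    + intro H; destruct (HU _ H).
  - apply in_compactification; split; [apply subset_refl|]; intros _.
    apply (finite_subset finite_empty); intros x Hx; membership in Hx; tauto.
  - intros C U HC HU; apply in_compactification; split.
    + intros x Hx; apply HU in Hx as [V [HV Hx]].
      apply HC, in_compactification in HV; now apply HV.
    + intro H; apply HU in H as [V [HV H]].
      pose proof (HC V HV) as HV'; apply in_compactification in HV' as [_ HV'].
      apply (finite_subset (HV' H)); intros x Hx; membership in Hx; membership.
      split; [tauto|]; intro HxV; apply Hx, HU; eauto.
  - intros U V W HU HV HW; apply in_compactification in HU as [U1 U2], HV as [V1 V2].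
    apply in_compactification; split; [intros x Hx; apply HW in Hx; now apply U1|].
    intro H; apply HW in H as [HAU HAV].
    apply (finite_subset (finite_cup (U2 HAU) (V2 HAV))); intros x Hx.
    membership in Hx; membership; destruct Hx as [Hx HxW].
    destruct (classic (x ∈ U)) as [HxU|HxU]; [right|left; auto].
    split; [exact Hx|]; intro HxV; apply HxW, HW; auto.
Qed.

Lemma sing_open A x : x ∈ A -> sing x ∈ compactification A.
Proof.
  intro Hx; apply in_compactification; split.
  - intros y Hy; membership in Hy; subst; now apply mem_mem_succ.
  - intro H; membership in H; subst; destruct (mem_irrefl Hx).
Qed.

Lemma compactification_is_base A :
  is_base (succ A) (compactification A) (compactification_base A).
Proof.
  split; [intros V HV; unfold compactification_base in HV; membership in HV; tauto|].
  intros U x HU Hx; destruct (classic (x = A)) as [ ->|E].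
  - exists U; split; [|split; [exact Hx | apply subset_refl]].
    unfold compactification_base; membership; auto.
  - assert (HxA : x ∈ A).
    { apply in_compactification in HU as [HU _]; apply HU in Hx; membership in Hx; tauto. }
    exists (sing x); split; [|split].
    + unfold compactification_base; membership; split; [now apply sing_open | eauto].
    + membership; reflexivity.
    + intros y Hy; membership in Hy; now subst.
Qed.

Lemma compactification_sigma A : countable A ->
  sigma_base (@locally_finite M) (succ A) (compactification A) (compactification_base A).
Proof.
  intro HA; split; [apply compactification_is_base|].
  destruct (countable_elim HA) as [g [Hg Hinj]].
  (* Piece [m] holds the singletons with code below [m] and the neighbourhoods of infinity that omit
     only points with code below [m]. Each piece is finite, hence locally finite. *)
  pose (D m := sep (compactification_base A) (fun V =>
    (exists x, x ∈ A /\ V = sing x /\ app g x ∈ m) \/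
    (A ∈ V /\ forall x, x ∈ A -> ~ x ∈ V -> app g x ∈ m))).
  assert (DD : DefF1 D) by (unfold D; definable).
  exists omega, (lam omega D); split; [apply countable_omega|].
  split; [apply lam_function; exact DD|]; split.
  - intros m C HC; rewrite maps_lam in HC by exact DD; destruct HC as [Hm ->].
    apply finite_family_locally_finite; [apply compactification_topology| |].
    + intros V HV; unfold D, compactification_base in HV; membership in HV; tauto.
    + pose (I := sep A (fun x => app g x ∈ m)).
      assert (HI : finite I) by (apply (finite_initial (g := fun x => app g x)); auto).
      assert (D1 : DefF1 (fun F => diff (succ A) F)) by definable.
      (* The neighbourhoods of infinity in piece [m] are complements of subsets of the finite set
         [I], so there are at most as many as elements of [pow I]. *)
      apply (finite_subset (finite_cup (finite_image (f := fun x => sing x) HI)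
        (finite_image (f := fun F => diff (succ A) F) (finite_pow HI)))).
      intros V HV; unfold D, compactification_base in HV; membership in HV; membership.
      destruct HV as [[HV _] [[x [Hx [-> Hgx]]]|[HAV Hgx]]].
      * left; exists x; split; [unfold I; membership; auto | reflexivity].
      * right; exists (diff (succ A) V); split.
        -- membership; intros x Hx; membership in Hx; unfold I; membership.
           destruct Hx as [[Hx| ->] HxV]; [auto | contradiction].
        -- apply in_compactification in HV as [HV _].
           apply ext; intro x; membership; split.
           ++ intro Hx; pose proof (HV x Hx) as Hx'; membership in Hx'; tauto.
           ++ intros [Hx Hn]; apply NNPP; tauto.
  - intro V; split.
    + intro HV; pose proof HV as HV'; unfold compactification_base in HV'.
      membership in HV'; destruct HV' as [HVT [[x [Hx ->]]|HAV]].
      * exists (succ (app g x)), (D (succ (app g x))); rewrite maps_lam by exact DD.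
        split; [auto using succ_omega|]; unfold D; rewrite in_sep by definable.
        split; [exact HV|]; left; exists x; auto using mem_succ.
      * apply in_compactification in HVT as [_ HVT]; specialize (HVT HAV).
        destruct (finite_value_bound (g := g) HVT) as [m [Hm Hb]].
        { intros x Hx; membership in Hx; apply Hg; tauto. }
        exists m, (D m); rewrite maps_lam by exact DD; split; [auto|].
        unfold D; rewrite in_sep by definable; split; [exact HV|]; right.
        split; [exact HAV|]; intros x Hx HxV; apply Hb; membership; auto.
    + intros [m [C [HC HV]]]; rewrite maps_lam in HC by exact DD; destruct HC as [_ ->].
      unfold D in HV; rewrite in_sep in HV by definable; tauto.
Qed.

(** One member covers infinity and misses finitely many points; these are covered one after another
    by induction, with no simultaneous choice. *)
Lemma compactification_compact A : compact (succ A) (compactification A).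
Proof.
  intros C HC Hcov.
  destruct (Hcov A (mem_succ A)) as [U0 [HU0 HAU0]].
  pose proof (HC U0 HU0) as HF; apply in_compactification in HF as [_ HF].
  specialize (HF HAU0).
  assert (H : forall F, finite F -> subset F A -> exists D, subset D C /\ finite D /\
    forall x, x ∈ F -> exists U, U ∈ D /\ x ∈ U).
  { apply (finite_ind (P := fun F => subset F A -> exists D, subset D C /\ finite D /\
      forall x, x ∈ F -> exists U, U ∈ D /\ x ∈ U)).
    - intros _; exists empty; split; [intros x Hx; destruct (in_empty Hx)|].
      split; [apply finite_empty|]; intros x Hx; destruct (in_empty Hx).
    - intros F x _ _ IH HFA.
      destruct IH as [D [HDC [HD H]]]; [intros y Hy; apply HFA; membership; auto|].
      destruct (Hcov x) as [U [HU HxU]].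
      { apply mem_mem_succ, HFA; membership; auto. }
      exists (cup D (sing U)); split; [|split].
      + apply subset_cup; [exact HDC|]; intros y Hy; membership in Hy; now subst.
      + now apply finite_insert.
      + intros y Hy; membership in Hy; destruct Hy as [Hy| ->].
        * destruct (H y Hy) as [V [HV HyV]]; exists V; membership; auto.
        * exists U; membership; auto. }
  destruct (H _ HF) as [D [HDC [HD HDF]]]; [intros x Hx; membership in Hx; tauto|].
  exists (cup D (sing U0)); split; [|split].
  - apply subset_cup; [exact HDC|]; intros y Hy; membership in Hy; now subst.
  - now apply finite_insert.
  - intros x Hx; destruct (classic (x ∈ U0)) as [HxU|HxU].
    + exists U0; membership; auto.
    + membership in Hx; destruct Hx as [Hx| ->]; [|contradiction].
      destruct (HDF x) as [V [HV HxV]]; [membership; auto|].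
      exists V; membership; auto.
Qed.

(** At level [m] the points with code below [m] are isolated and all others are lumped together with
    infinity. These are equivalence relations, so the distance is symmetric. Infinity is [far] at
    every level vacuously, as [A] is not an element of itself. *)
Lemma compactification_metrizable A : countable A ->
  metrizable (succ A) (compactification A).
Proof.
  intro HA; destruct (countable_elim HA) as [g [Hg Hinj]].
  pose (far m x := x ∈ A -> ~ app g x ∈ m).
  assert (Dfar : DefP2 far) by (unfold far; definable).
  apply (@metrizable_of_levels _ _ (succ A) (compactification A)
    (fun m x y => x = y \/ (far m x /\ far m y))).
  - definable.
  - auto.
  - intros n x y z _ _ _ _ [ ->|[H1 H2]] [ ->|[H3 H4]]; auto.
  - intros x y _ _; right; split; intros _ H; destruct (in_empty H).
  - intros m n x y Hn Hm _ _ [ ->|[H1 H2]]; [auto|right].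
    split; intros Hx H; [apply (H1 Hx) | apply (H2 Hx)]; exact (omega_trans Hn H Hm).
  - intros x y Hx Hy H; apply NNPP; intro E.
    assert (N : forall x, x ∈ A -> exists n, n ∈ omega /\ ~ far n x).
    { intros z Hz; exists (succ (app g z)); split; [auto using succ_omega|].
      intro F; apply (F Hz), mem_succ. }
    membership in Hx; membership in Hy.
    destruct Hx as [Hx|Hx]; [|destruct Hy as [Hy|Hy]; [|congruence]].
    + destruct (N x Hx) as [n [Hn F]]; destruct (H n Hn); tauto.
    + destruct (N y Hy) as [n [Hn F]]; destruct (H n Hn); tauto.
  - intro V; rewrite in_compactification; split; intros [HV H]; (split; [exact HV|]).
    + intros x Hx; destruct (classic (x ∈ A)) as [HxA|HxA].
      * exists (succ (app g x)); split; [auto using succ_omega|].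
        intros y Hy [<-|[F _]]; [exact Hx|]; destruct (F HxA (mem_succ _)).
      * pose proof (HV x Hx) as HxA'; membership in HxA'.
        destruct HxA' as [?| ->]; [contradiction|].
        destruct (finite_value_bound (g := g) (H Hx)) as [m [Hm Hb]].
        { intros y Hy; membership in Hy; apply Hg; tauto. }
        exists m; split; [exact Hm|]; intros y Hy [<-|[_ F]]; [exact Hx|].
        membership in Hy; destruct Hy as [Hy| ->]; [|exact Hx].
        apply NNPP; intro HyV; apply (F Hy), Hb; membership; auto.
    + intro HAV; destruct (H A HAV) as [m [Hm Hb]].
      apply finite_subset with (sep A (fun x => app g x ∈ m)).
      * apply (finite_initial (g := fun x => app g x)); auto.
      * intros x Hx; membership in Hx; membership; split; [tauto|].
        apply NNPP; intro F; apply Hx, Hb; [now apply mem_mem_succ|].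
        right; split; [intro HAA; destruct (mem_irrefl HAA) | intros _; exact F].
  - intros n x y _ _ _ [ ->|[H1 H2]]; auto.
Qed.

(** A single [A n] is exhausted by means of any enumeration of it; the gain is one definable [F] for
    all [n] at once, with no enumerations chosen. *)
Lemma uniform_exhaustion (A : M -> M) {DA : DefF1 A} :
  compact_metrizable_products_have_sigma_ip_base M ->
  (forall n, n ∈ omega -> countable (A n)) ->
  exists F : M -> M -> M, DefF2 F /\ forall n, n ∈ omega ->
    (forall m, m ∈ omega -> finite (F n m)) /\
    forall x, x ∈ A n -> exists m, m ∈ omega /\ x ∈ F n m.
Proof.
  intros H3 HA.
  pose (X := lam omega (fun n => succ (A n))).
  pose (T := lam omega (fun n => compactification (A n))).
  assert (D1 : DefF1 (fun n => succ (A n))) by definable.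
  assert (D2 : DefF1 (fun n => compactification (A n))) by definable.
  assert (D3 : DefF1 (fun n => compactification_base (A n))) by definable.
  assert (HX : is_function X omega) by (apply lam_function; exact D1).
  assert (HT : is_function T omega) by (apply lam_function; exact D2).
  assert (Hspace : forall n B tau, maps X n B -> maps T n tau ->
    n ∈ omega /\ B = succ (A n) /\ tau = compactification (A n)).
  { intros n B tau HB Htau; unfold X in HB; unfold T in Htau.
    rewrite maps_lam in HB by exact D1; rewrite maps_lam in Htau by exact D2; tauto. }
  assert (Hfam : space_family omega X T).
  { split; [exact HX|]; split; [exact HT|]; intros n B tau HB Htau.
    destruct (Hspace n B tau HB Htau) as [_ [-> ->]]; apply compactification_topology. }
  assert (AX : forall n, n ∈ omega -> app X n = succ (A n)).
  { intros n Hn; unfold X; now rewrite app_lam by (exact D1 || exact Hn). }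
  assert (AT : forall n, n ∈ omega -> app T n = compactification (A n)).
  { intros n Hn; unfold T; now rewrite app_lam by (exact D2 || exact Hn). }
  destruct (product_space_exists HX HT) as [Y [S Hprod]].
  destruct (H3 omega X T) with (Y := Y) (S := S) as [B [HB Hsigma]]; auto.
  { now apply is_omega_iff. }
  { intros n C tau HC Htau; destruct (Hspace n C tau HC Htau) as [Hn [-> ->]].
    split; [now apply countable_succ, HA|]; split; [apply compactification_compact|].
    now apply compactification_metrizable, HA. }
  { exists (lam omega (fun n => compactification_base (A n))).
    split; [apply lam_function; exact D3|]; intros n C tau B HC Htau HB.
    destruct (Hspace n C tau HC Htau) as [Hn [-> ->]].
    rewrite maps_lam in HB by exact D3; destruct HB as [_ ->].
    now apply compactification_sigma, HA. }
  pose proof (product_topology Hfam Hprod) as HY.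
  destruct (sigma_decomposition interior_preserving_property HY Hsigma)
    as [R [_ [HR HRB]]].
  (* [A n] is the point at infinity of the [n]-th factor, so this point of the product is
     definable. *)
  pose (pt := lam omega A).
  assert (Apt : forall n, n ∈ omega -> app pt n = A n).
  { intros n Hn; unfold pt; now rewrite app_lam by (exact DA || exact Hn). }
  assert (Hpt : pt ∈ Y).
  { apply (in_product Hfam Hprod); split; [apply lam_function; exact DA|].
    intros n Hn; rewrite AX, Apt by exact Hn; apply mem_succ. }
  pose (O m := sep Y (fun y => forall U, U ∈ section R m -> pt ∈ U -> y ∈ U)).
  assert (DO : DefF1 O) by (unfold O; definable).
  assert (HO : forall m, m ∈ omega -> O m ∈ S).
  { intros m Hm; pose proof (HR m Hm) as H.
    rewrite (@interior_preserving_iff _ _ Y S) in H; now apply H. }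
  exists (fun n m => sep (A n) (fun x => ~ update omega pt n x ∈ O m)).
  split; [definable|]; intros n Hn; split.
  - intros m Hm.
    (* The slice of [O m] through [pt] in coordinate [n] contains a neighbourhood of infinity, which
       misses only finitely many points of [A n]. *)
    assert (HptO : pt ∈ O m) by (unfold O; membership; auto).
    destruct (slice_open Hfam Hprod HptO (HO m Hm) Hn) as [V [HV [HAV HVO]]].
    rewrite AT in HV by exact Hn; rewrite Apt in HAV by exact Hn.
    apply in_compactification in HV as [_ HV]; apply (finite_subset (HV HAV)).
    intros x Hx; membership in Hx; membership; split; [tauto|].
    intro HxV; apply Hx, HVO, HxV.
  - intros x Hx.
    (* Omitting [x] from the factor gives an open cylinder around [pt]. A member [U] of the base
       between them lies in some section [m]; then [O m] is inside [U], and putting [x] at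
       coordinate [n] leaves [O m]. *)
    assert (HV : diff (succ (A n)) (sing x) ∈ app T n).
    { rewrite AT by exact Hn; apply in_compactification; split.
      - intros y Hy; membership in Hy; membership; tauto.
      - intros _; apply (finite_subset (finite_sing x)); intros y Hy.
        membership in Hy; membership; destruct Hy as [Hy Hn'].
        apply NNPP; tauto. }
    pose proof (cylinder_open Hfam Hprod Hn HV) as HU.
    destruct (proj2 HB _ pt HU) as [U [HUB [HptU HUV]]].
    { membership; rewrite Apt by exact Hn; split; [exact Hpt|].
      split; [right; reflexivity|]; intro E; rewrite <- E in Hx.
      exact (mem_irrefl Hx). }
    apply HRB in HUB as [m [Hm HUm]]; exists m; split; [exact Hm|].
    membership; split; [exact Hx|]; intro H; unfold O in H; membership in H.
    destruct H as [_ H]; pose proof (HUV _ (H U HUm HptU)) as K.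
    membership in K; rewrite app_update_eq in K by exact Hn; tauto.
Qed.

End Compactification.

(** * Cofinite spaces *)

Section Cofinite.
Context {M : set_structure} {HM : ZF M}.

Lemma finite_complement_iff (A U : M) :
  (exists C, is_diff C A U /\ finite C) <-> finite (diff A U).
Proof.
  split.
  - intros [C [HC HF]]; apply (finite_subset HF); intros x Hx; membership in Hx.
    now apply HC.
  - intro H; exists (diff A U); split; [intro z; apply in_diff | exact H].
Qed.

Lemma cofinite_iff A T U : is_cofinite_topology A T ->
  (U ∈ T <-> U = empty \/ (subset U A /\ finite (diff A U))).
Proof.
  intro HT; rewrite (HT U), is_empty_iff, finite_complement_iff.
  reflexivity.
Qed.

Definition cofinite (A : M) : M :=
  sep (pow A) (fun U => U = empty \/ finite (diff A U)).

#[global] Instance cofinite_def : DefF1 cofinite.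
Proof. unfold cofinite; definable. Qed.

Lemma in_cofinite A U : U ∈ cofinite A <->
  U = empty \/ (subset U A /\ finite (diff A U)).
Proof.
  unfold cofinite; membership; split; [tauto|].
  intros [ ->|H]; [|tauto]; split; [|auto].
  intros x Hx; destruct (in_empty Hx).
Qed.

Lemma cofinite_is_cofinite A : is_cofinite_topology A (cofinite A).
Proof.
  intro U; rewrite in_cofinite, is_empty_iff, finite_complement_iff.
  reflexivity.
Qed.

Lemma cofinite_topology A : is_topology A (cofinite A).
Proof.
  split; [|split; [|split; [|split]]].
  - intros U HU; unfold cofinite in HU; membership in HU; tauto.
  - intros U HU; apply in_cofinite; left; now apply is_empty_iff.
  - apply in_cofinite; right; split; [apply subset_refl|].
    apply (finite_subset finite_empty); intros x Hx; membership in Hx; tauto.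
  - intros C U HC HU; apply in_cofinite.
    destruct (classic (U = empty)) as [E|E]; [auto|right]; split.
    + intros x Hx; apply HU in Hx as [V [HV Hx]].
      apply HC in HV; unfold cofinite in HV; membership in HV; now apply HV.
    + assert (H : exists x, x ∈ U).
      { apply NNPP; intro N; apply E, is_empty_iff; intros x Hx; eauto. }
      destruct H as [x Hx]; apply HU in Hx as [V [HV Hx]].
      pose proof (HC V HV) as HV'; apply in_cofinite in HV' as [ ->|[_ HV']].
      * destruct (in_empty Hx).
      * apply (finite_subset HV'); intros y Hy; membership in Hy; membership.
        split; [tauto|]; intro HyV; apply Hy, HU; eauto.
  - intros U V W HU HV HW; apply in_cofinite in HU, HV; apply in_cofinite.
    destruct HU as [ ->|[U1 U2]]; [left|destruct HV as [ ->|[V1 V2]]; [left|right]].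
    + apply is_empty_iff; intros x Hx; apply HW in Hx as [Hx _]; exact (in_empty Hx).
    + apply is_empty_iff; intros x Hx; apply HW in Hx as [_ Hx]; exact (in_empty Hx).
    + split; [intros x Hx; apply HW in Hx; now apply U1|].
      apply (finite_subset (finite_cup U2 V2)); intros x Hx.
      membership in Hx; membership; destruct Hx as [Hx HxW].
      destruct (classic (x ∈ U)) as [HxU|HxU]; [right|left; auto].
      split; [exact Hx|]; intro HxV; apply HxW, HW; auto.
Qed.

(** At level [m] the ball about [x] consists of [x] and all points with code not below [m], a
    cofinite set. Only the second point is tested, so the relation is not symmetric. *)
Lemma cofinite_quasi_metrizable A : countable A -> quasi_metrizable A (cofinite A).
Proof.
  intro HA; destruct (countable_elim HA) as [g [Hg Hinj]].
  apply (@quasi_metrizable_of_levels _ _ A (cofinite A)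
    (fun m x y => x = y \/ ~ app g y ∈ m)).
  - definable.
  - auto.
  - intros n x y z _ _ _ _ [ ->|H1] [ ->|H2]; auto.
  - intros x y _ _; right; apply in_empty.
  - intros m n x y Hn Hm _ _ [ ->|H]; [auto|right]; intro F.
    exact (H (omega_trans Hn F Hm)).
  - intros x y Hx Hy H; destruct (H (succ (app g y))) as [E|E]; auto using succ_omega.
    destruct E; apply mem_succ.
  - intro V; rewrite in_cofinite; split.
    + intros [ ->|[HV HF]]; (split; [try exact HV|]);
        try (intros x Hx; destruct (in_empty Hx); fail).
      destruct (finite_value_bound (g := g) HF) as [m [Hm Hb]].
      { intros x Hx; membership in Hx; apply Hg; tauto. }
      intros x Hx; exists m; split; [exact Hm|]; intros y Hy [<-|H]; [exact Hx|].
      apply NNPP; intro HyV; apply H, Hb; membership; auto.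
    + intros [HV H]; destruct (classic (V = empty)) as [E|E]; [auto|right].
      split; [exact HV|].
      assert (Hx : exists x, x ∈ V).
      { apply NNPP; intro N; apply E, is_empty_iff; intros x Hx; eauto. }
      destruct Hx as [x Hx]; destruct (H x Hx) as [m [Hm Hb]].
      apply finite_subset with (sep A (fun x => app g x ∈ m)).
      * apply (finite_initial (g := fun x => app g x)); auto.
      * intros y Hy; membership in Hy; membership; split; [tauto|].
        apply NNPP; intro F; apply Hy, Hb; tauto.
Qed.

(** Level [m] inspects only the coordinates with code below [m], and there [y] either agrees with
    [x] or avoids the first [m] finite sets of the exhaustion. Each ball is therefore a box with
    finitely many cofinite sides. *)
Lemma product_cofinite_quasi_metrizable J X T Y S (G : M -> M -> M) {DG : DefF2 G} :
  countable J -> space_family J X T ->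
  (forall j, j ∈ J -> is_cofinite_topology (app X j) (app T j)) ->
  is_product_space J X T Y S ->
  (forall j m, j ∈ J -> m ∈ omega -> finite (G j m)) ->
  (forall j x, j ∈ J -> x ∈ app X j -> exists m, m ∈ omega /\ x ∈ G j m) ->
  quasi_metrizable Y S.
Proof.
  intros HJ Hfam Hcof Hprod HGf HGc.
  destruct (countable_elim HJ) as [g [Hg Hinj]].
  apply (@quasi_metrizable_of_levels _ _ Y S (fun m x y => forall j, j ∈ J ->
    app g j ∈ m -> app x j = app y j \/ forall i, i ∈ m -> ~ app y j ∈ G j i)).
  - definable.
  - auto.
  - intros n x y z _ _ _ _ H1 H2 j Hj Hjn.
    destruct (H2 j Hj Hjn) as [<-|H]; auto.
  - intros x y _ _ j Hj H; destruct (in_empty H).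
  - intros m n x y Hn Hm _ _ H j Hj Hjm.
    destruct (H j Hj (omega_trans Hn Hjm Hm)) as [E|E]; [auto|right].
    intros i Hi; apply E, (omega_trans Hn Hi Hm).
  - intros x y Hx Hy H.
    apply (in_product Hfam Hprod) in Hx as [Hx1 Hx2], Hy as [Hy1 Hy2].
    apply (function_ext Hx1 Hy1); intros j Hj.
    destruct (HGc j _ Hj (Hy2 j Hj)) as [i [Hi HiG]].
    (* Level [succ n] both inspects coordinate [j] and includes the finite set containing the [j]-th
       coordinate of [y], which leaves only equality. *)
    destruct (omega_max (Hg j Hj) Hi) as [n [Hn [H1 H2]]].
    destruct (H (succ n) (succ_omega Hn) j Hj H1) as [E|E]; [exact E|].
    destruct (E i H2 HiG).
  - intro V; rewrite (product_open_iff Hfam Hprod).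
    split; intros [HVY H]; (split; [exact HVY|]); intros x Hx.
    + destruct (H x Hx) as [F [O [HF [HFf [HO Hbox]]]]].
      (* Two bounds are combined: [m0] exceeds the codes of the restricted coordinates, and [m1]
         exceeds, for each point omitted by a side of the box, the index of some finite set
         containing it. *)
      destruct (finite_value_bound (g := g) HFf) as [m0 [Hm0 Hb0]]; [auto|].
      destruct (finite_bound (phi := fun j m => forall y, y ∈ diff (app X j) (app O j) ->
        exists i, i ∈ m /\ y ∈ G j i) HFf) as [m1 [Hm1 Hb1]].
      { intros j Hj; destruct (HO j Hj) as [HOT HxO].
        apply (cofinite_iff _ (Hcof j (HF j Hj))) in HOT as [E|[_ Hfin]].
        { rewrite E in HxO; destruct (in_empty HxO). }
        apply (finite_bound (phi := fun y m => exists i, i ∈ m /\ y ∈ G j i) Hfin).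
        - intros y Hy; membership in Hy.
          destruct (HGc j y (HF j Hj)) as [i [Hi HiG]]; [tauto|].
          exists (succ i); split; [now apply succ_omega|].
          exists i; auto using mem_succ.
        - intros y m n [i [Hi HiG]] Hmn Hn; exists i; split; [|exact HiG].
          exact (mem_succ_trans Hn Hi Hmn). }
      { intros j m n Hy Hmn Hn y HyO; destruct (Hy y HyO) as [i [Hi HiG]].
        exists i; split; [|exact HiG].
        exact (mem_succ_trans Hn Hi Hmn). }
      destruct (omega_max Hm0 Hm1) as [m [Hm [H0m H1m]]].
      exists (succ m); split; [now apply succ_omega|].
      intros y Hy HE; apply Hbox; [exact Hy|]; intros j Hj.
      destruct (HO j Hj) as [_ HxO].
      assert (Hgj : app g j ∈ succ m).
      { exact (omega_trans (succ_omega Hm) (Hb0 j Hj) H0m). }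
      destruct (HE j (HF j Hj) Hgj) as [<-|HG]; [exact HxO|].
      apply NNPP; intro HyO.
      apply (in_product Hfam Hprod) in Hy as [_ Hy].
      destruct (Hb1 j Hj (app y j)) as [i [Hi HiG]]; [membership; auto|].
      exact (HG i (omega_trans (succ_omega Hm) Hi H1m) HiG).
    + destruct (H x Hx) as [m [Hm Hb]].
      (* The level-[m] ball about [x] is itself a basic box. Its side at [j] omits only points of
         the sets [G j i] with [i ∈ m], a finite union of finite sets. *)
      pose (F := sep J (fun j => app g j ∈ m)).
      pose (O j := sep (app X j) (fun y => app x j = y \/ forall i, i ∈ m -> ~ y ∈ G j i)).
      assert (DO : DefF1 O) by (unfold O; definable).
      assert (HF : forall j, j ∈ F -> j ∈ J) by (intros j Hj; unfold F in Hj;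
        membership in Hj; tauto).
      exists F, (lam F O); split; [exact HF|]; split; [|split].
      * apply (finite_initial (g := fun x => app g x)); auto.
      * intros j Hj; rewrite app_lam by (exact DO || exact Hj).
        pose proof (HF j Hj) as HjJ; split.
        -- apply (cofinite_iff _ (Hcof j HjJ)); right; split.
           ++ intros y Hy; unfold O in Hy; membership in Hy; tauto.
           ++ assert (DGj : DefF1 (fun i => G j i)) by definable.
              apply finite_subset with (Union (image m (fun i => G j i))).
              ** apply finite_Union; [apply finite_image; [exact DGj | now apply finite_omega]|].
                 intros z Hz; rewrite in_image in Hz by exact DGj.
                 destruct Hz as [i [Hi ->]]; apply HGf; [exact HjJ|].
                 exact (omega_mem Hm Hi).
              ** intros y Hy; unfold O in Hy; membership in Hy; destruct Hy as [Hy Hn].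
                 membership; apply NNPP; intro N; apply Hn; split; [exact Hy|]; right.
                 intros i Hi HiG; apply N; exists (G j i); split; [|exact HiG].
                 rewrite in_image by exact DGj; eauto.
        -- apply HVY, (in_product Hfam Hprod) in Hx as [_ Hx].
           unfold O; membership; auto.
      * intros y Hy HyO; apply Hb; [exact Hy|]; intros j Hj Hjm.
        assert (HjF : j ∈ F) by (unfold F; membership; auto).
        specialize (HyO j HjF); rewrite app_lam in HyO by (exact DO || exact HjF).
        unfold O in HyO; membership in HyO; tauto.
Qed.

Lemma sigma_ip_base_quasi_metrizable :
  compact_metrizable_products_have_sigma_ip_base M -> CPcofin_omega_QM M.
Proof.
  intros H3 J X T HJ Hfam Hsp Y S Hprod.
  pose proof Hfam as [HX [HT _]].
  destruct (countable_elim HJ) as [g [Hg Hinj]].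
  (* Reindexing from [J] to [omega] along the injection [g]: the collected family has the single
     member [app X j] if [n] codes [j], and otherwise its union is empty. *)
  pose (A n := Union (sep (Union (Union X)) (fun B => exists j, j ∈ J /\
    app g j = n /\ B = app X j))).
  assert (DA : DefF1 A) by (unfold A; definable).
  assert (HA : forall j, j ∈ J -> A (app g j) = app X j).
  { intros j Hj; apply ext; intro x; unfold A; rewrite in_Union; split.
    - intros [B [HB Hx]]; membership in HB; destruct HB as [_ [i [Hi [E ->]]]].
      apply Hinj in E; auto; now subst.
    - intro Hx; exists (app X j); split; [|exact Hx]; rewrite in_sep by definable.
      split; [exact (app_Union_Union HX Hj) | eauto]. }
  destruct (uniform_exhaustion (A := A) H3) as [F [DF HF]].
  { intros n Hn; destruct (classic (exists j, j ∈ J /\ app g j = n)) as [[j [Hj <-]]|N].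
    - rewrite HA by exact Hj; apply (Hsp j _ (app T j));
        [exact (app_maps HX Hj) | exact (app_maps HT Hj)].
    - replace (A n) with (empty : M); [apply countable_empty|].
      symmetry; apply is_empty_iff; intros x Hx; unfold A in Hx; membership in Hx.
      destruct Hx as [B [HB _]]; membership in HB; destruct HB as [_ [j [Hj [E _]]]]; eauto. }
  apply (@product_cofinite_quasi_metrizable J X T Y S (fun j m => F (app g j) m)); auto.
  - definable.
  - intros j Hj; apply (Hsp j); [exact (app_maps HX Hj) | exact (app_maps HT Hj)].
  - intros j m Hj Hm; now apply HF; auto.
  - intros j x Hj Hx; apply (HF _ (Hg j Hj)); now rewrite HA.
Qed.

(** Trichotomy makes the least index unique, so a description names it and nothing is chosen. *)
Lemma the_least (P : M -> Prop) {HP : DefP1 P} n : n ∈ omega -> P n ->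
  exists m, m ∈ omega /\ P m /\
    the (fun m => m ∈ omega /\ P m /\ forall k, k ∈ m -> ~ P k) = m.
Proof.
  intros Hn H; destruct (omega_least Hn H) as [m [Hm [Pm Hl]]].
  exists m; split; [exact Hm|]; split; [exact Pm|]; apply the_eq; [auto|].
  intros k [Hk [Pk Hl']]; destruct (omega_trichotomy Hm Hk) as [L|[L|L]]; auto.
  - destruct (Hl' m L Pm).
  - destruct (Hl k L Pk).
Qed.

Lemma quasi_metrizable_multiple_choice : CPcofin_omega_QM M -> CMC_omega M.
Proof.
  intros HQ J X [_ HJ] HX Hden.
  assert (HXj : forall j, j ∈ J -> denumerable (app X j)).
  { intros j Hj; exact (Hden j _ (app_maps HX Hj)). }
  (* Each factor is enlarged by itself as an extra point, so that the product has the definable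
     point [pt]. *)
  pose (X' := lam J (fun j => succ (app X j))).
  pose (T' := lam J (fun j => cofinite (succ (app X j)))).
  assert (D1 : DefF1 (fun j => succ (app X j))) by definable.
  assert (D2 : DefF1 (fun j => cofinite (succ (app X j)))) by definable.
  assert (D3 : DefF1 (fun j => app X j)) by definable.
  assert (HX' : is_function X' J) by (apply lam_function; exact D1).
  assert (HT' : is_function T' J) by (apply lam_function; exact D2).
  assert (Hspace : forall j B tau, maps X' j B -> maps T' j tau ->
    j ∈ J /\ B = succ (app X j) /\ tau = cofinite (succ (app X j))).
  { intros n B tau HB Htau; unfold X' in HB; unfold T' in Htau.
    rewrite maps_lam in HB by exact D1; rewrite maps_lam in Htau by exact D2; tauto. }
  assert (Hfam : space_family J X' T').
  { split; [exact HX'|]; split; [exact HT'|]; intros n B tau HB Htau.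
    destruct (Hspace n B tau HB Htau) as [_ [-> ->]]; apply cofinite_topology. }
  assert (AX : forall j, j ∈ J -> app X' j = succ (app X j)).
  { intros j Hj; unfold X'; now rewrite app_lam by (exact D1 || exact Hj). }
  assert (AT : forall j, j ∈ J -> app T' j = cofinite (succ (app X j))).
  { intros j Hj; unfold T'; now rewrite app_lam by (exact D2 || exact Hj). }
  destruct (product_space_exists HX' HT') as [Y [S Hprod]].
  destruct (HQ J X' T' HJ Hfam) with (Y := Y) (S := S) as [d [Hd Hind]]; auto.
  { intros j B tau HB Htau; destruct (Hspace j B tau HB Htau) as [Hj [-> ->]].
    assert (HC : countable (succ (app X j))) by (apply countable_succ, HXj, Hj).
    split; [now apply cofinite_quasi_metrizable|]; split; [exact HC|].
    apply cofinite_is_cofinite. }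
  pose (pt := lam J (fun j => app X j)).
  assert (Apt : forall j, j ∈ J -> app pt j = app X j).
  { intros j Hj; unfold pt; now rewrite app_lam by (exact D3 || exact Hj). }
  assert (Hpt : pt ∈ Y).
  { apply (in_product Hfam Hprod); split; [apply lam_function; exact D3|].
    intros j Hj; rewrite AX, Apt by exact Hj; apply mem_succ. }
  (* The points [x] of the [j]-th set that carry [pt] out of its ball of radius 2^-m when put at
     coordinate [j]. *)
  pose (F j m := sep (app X j)
    (fun x => ~ half m ∈ app d (pair pt (update J pt j x)))).
  assert (DF : DefF2 F) by (unfold F; definable).
  pose (f j := F j (the (fun m => m ∈ omega /\ nonempty (F j m) /\
    forall k, k ∈ m -> ~ nonempty (F j k)))).
  assert (Df : DefF1 f) by (unfold f; definable).
  exists (lam J f); split; [apply lam_function; exact Df|].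
  intros j A B HA HB; apply (maps_app _ _ HX) in HA as [Hj ->].
  rewrite maps_lam in HB by exact Df; destruct HB as [_ ->].
  assert (Hsub : forall x, x ∈ app X j -> update J pt j x ∈ Y).
  { intros x Hx; apply (update_product Hfam Hprod Hpt Hj).
    rewrite AX by exact Hj; now apply mem_mem_succ. }
  (* Denumerability gives a point [x] of [app X j]. If every [F j m] were empty, the modified point
     would lie in all balls about [pt], hence equal [pt], and [x] would be [app X j] itself, against
     foundation. *)
  assert (Hcov : exists m, m ∈ omega /\ nonempty (F j m)).
  { assert (Hx : exists x, x ∈ app X j).
    { apply NNPP; intro N; apply (proj1 (HXj j Hj)).
      apply (finite_subset finite_empty); intros x Hx; destruct N; eauto. }
    destruct Hx as [x Hx]; apply NNPP; intro N.
    assert (E : pt = update J pt j x).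
    { apply (balls_separate Hd Hpt (Hsub x Hx)); intros m Hm.
      apply NNPP; intro H; apply N; exists m; split; [exact Hm|].
      exists x; unfold F; membership; auto. }
    apply (@mem_irrefl _ _ x).
    replace x with (app X j) at 2; [exact Hx|].
    rewrite <- (Apt j Hj), E at 1; now apply app_update_eq. }
  destruct Hcov as [m [Hm Hne]].
  (* Balls are open, so the slice of a ball in coordinate [j] contains an open set through the added
     point. That set is nonempty, hence cofinite, and [F j m] lies in its complement. *)
  assert (Hfin : forall m, m ∈ omega -> finite (F j m)).
  { intros k Hk; pose proof (ball_open Hd Hind Hk Hpt) as HU.
    assert (HptU : pt ∈ sep Y (fun y => half k ∈ app d (pair pt y))).
    { membership; split; [exact Hpt | exact (ball_center Hd Hk Hpt)]. }
    destruct (slice_open Hfam Hprod HptU HU Hj) as [V [HV [HXV HVU]]].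
    rewrite AT in HV by exact Hj; rewrite Apt in HXV by exact Hj.
    apply in_cofinite in HV as [ ->|[_ HV]]; [destruct (in_empty HXV)|].
    apply (finite_subset HV); intros x Hx; unfold F in Hx; membership in Hx; membership.
    split; [tauto|]; intro HxV; apply Hx.
    pose proof (HVU x HxV) as K; membership in K; tauto. }
  destruct (the_least (P := fun m => nonempty (F j m)) Hm Hne) as [k [Hk [Hnek E]]].
  unfold f; rewrite E; split; [exact Hnek|]; split; [now apply Hfin|].
  intros x Hx; unfold F in Hx; membership in Hx; tauto.
Qed.

End Cofinite.

Theorem theorem3p27 (M : set_structure) (HM : ZF M) :
  (CMC M -> countable_products_have_sigma_base (@locally_finite M)) /\
  (CMC M -> countable_products_have_sigma_base (@point_finite M)) /\
  (CMC M -> countable_products_have_sigma_base (@interior_preserving M)) /\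
  (countable_products_have_sigma_base (@locally_finite M) ->
     compact_metrizable_products_have_sigma_ip_base M) /\
  (countable_products_have_sigma_base (@point_finite M) ->
     compact_metrizable_products_have_sigma_ip_base M) /\
  (countable_products_have_sigma_base (@interior_preserving M) ->
     compact_metrizable_products_have_sigma_ip_base M) /\
  (compact_metrizable_products_have_sigma_ip_base M -> CPcofin_omega_QM M) /\
  (CPcofin_omega_QM M -> CMC_omega M).
Proof.
  assert (lf_ip : forall X T C : M, is_topology X T -> subset C T ->
    locally_finite X T C -> interior_preserving X T C).
  { intros X T C HT HC H; apply (point_finite_interior_preserving HT HC).
    exact (locally_finite_point_finite HT H). }
  repeat split.
  - apply CMC_product_base, locally_finite_property.
  - apply CMC_product_base, point_finite_property.
  - apply CMC_product_base, interior_preserving_property.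
  - apply product_base_interior_preserving; auto.
  - apply product_base_interior_preserving.
    + intros X T C HT _; apply (locally_finite_point_finite HT).
    + intros X T C HT HC; apply (point_finite_interior_preserving HT HC).
  - apply product_base_interior_preserving; auto.
  - apply sigma_ip_base_quasi_metrizable.
  - apply quasi_metrizable_multiple_choice.
Qed.
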